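(* Let $d\ge 2$ be an integer and let $R_t^{(d)}$, $t\ge 0$, be the radial part of the Brownian motion on the $d$-dimensional hyperbolic space $\mathbb{H}^d$, started at the pole $o$, under the probability measure $P=P_o$. Let $\Phi(x)=\frac{1}{\sqrt{2\pi}}\int_x^{\infty}e^{-u^2/2}\,\mathrm{d}u$ for $x\in\mathbb{R}$. (1) For any $d\ge 2$, there exists a constant $c_1>0$ such that $$\sup_{x\in\mathbb{R}}\left|P\left(\frac{R_t^{(d)}-(d-1)t/2}{\sqrt{t}}\ge x\right)-\Phi(x)\right|\le\frac{c_1}{\sqrt{t}},\qquad t\ge 1.$$ (2) Moreover, if $d=2$ or $d\ge 3$ is odd, then there exists a constant $c_2>0$ such that $$P\left(\frac{R_t^{(d)}-(d-1)t/2}{\sqrt{t}}\ge 0\right)-\Phi(0)\ge\frac{c_2}{\sqrt{t}},\qquad t\ge 1.$$ Namely, the convergence rate $t^{-1/2}$ in (1) is sharp for these $d$.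
   Context: $\mathbb{H}^d$ is the $d$-dimensional hyperbolic space with a pole $o$: the spherically symmetric Riemannian manifold whose metric in geodesic polar coordinates $(r,\theta)$ around $o$ is $\mathrm{d}s^2=\mathrm{d}r^2+(\sinh r)^2\,\mathrm{d}\theta^2$, where $\mathrm{d}\theta^2$ is the standard metric on the unit sphere $S^{d-1}$. Let $\rho$ denote the Riemannian distance function on $\mathbb{H}^d$ and $\Delta$ its Laplace-Beltrami operator. $X=(\{X_t\}_{t\ge 0},\{P_x\}_{x\in\mathbb{H}^d})$ is the Brownian motion on $\mathbb{H}^d$ generated by $\Delta/2$, where $P_x$ is the law of the process started at $x$. Put $R_t^{(d)}=\rho(o,X_t)$ for $t\ge 0$ and $P=P_o$. The constants $c_1,c_2$ may depend on $d$ but not on $t$ or $x$. Note that $\Phi$ is the upper tail of the standard normal distribution. *)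

(* Defs.v *)
From HB Require Import structures.
From mathcomp Require Import all_boot all_order all_algebra.
From mathcomp Require Import all_classical all_reals all_analysis.
From mathcomp Require Import ring.
Set Implicit Arguments.
Unset Strict Implicit.
Unset Printing Implicit Defensive.
Import Order.TTheory GRing.Theory Num.Theory.
Import numFieldNormedType.Exports.
Local Open Scope classical_set_scope.
Local Open Scope ring_scope.

(* A Riemannian manifold diffeomorphic to R^d is presented in one global      *)
(* chart: its points are the row vectors 'rV[R]_d and its metric tensor is    *)
(* the matrix-valued function g.                                              *)

Section Riemannian.
Context {R : realType} {d : nat}.
Implicit Types (g : 'rV[R]_d -> 'M[R]_d) (f : 'rV[R]_d -> R).

Definition partial (i : 'I_d) f : 'rV[R]_d -> R :=
  fun x => 'D_(delta_mx 0 i : 'rV[R]_d) f x.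

Fixpoint Ck (k : nat) f : Prop :=
  if k is k'.+1 then
    (forall x i, derivable f x (delta_mx 0 i : 'rV[R]_d)) /\
    (forall i, Ck k' (partial i f))
  else continuous f.

Definition test_function f : Prop :=
  (forall k, Ck k f) /\ compact (closure [set x | f x != 0]).

Definition laplace_beltrami g f (x : 'rV[R]_d) : R :=
  (Num.sqrt (\det (g x)))^-1 *
  \sum_(i < d) partial i (fun y => Num.sqrt (\det (g y)) *
                   \sum_(j < d) invmx (g y) i j * partial j f y) x.

Definition metric_form g (x v w : 'rV[R]_d) : R := (v *m g x *m w^T) 0 0.

Definition C1_curve (c : R -> 'rV[R]_d) : Prop :=
  (forall t, derivable c t 1) /\ continuous (derive1 c).

Definition curve_length g (c : R -> 'rV[R]_d) : R :=
  \int[lebesgue_measure]_(t in `[0, 1])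
    Num.sqrt (metric_form g (c t) (derive1 c t) (derive1 c t)).

(* Allowing only C^1 curves, instead of piecewise C^1 ones, does not change   *)
(* the infimum: the velocity may vanish, so corners can be reparametrised.    *)
Definition riemannian_distance g (x y : 'rV[R]_d) : R :=
  inf [set l | exists c, [/\ C1_curve c, c 0 = x, c 1 = y &
                             l = curve_length g c]].

End Riemannian.

Section Hyperbolic.
Context {R : realType} {d : nat}.

Definition sinh (r : R) : R := (expR r - expR (- r)) / 2.

Definition dotv (x y : 'rV[R]_d) : R := \sum_(i < d) x 0 i * y 0 i.

Definition enorm (x : 'rV[R]_d) : R := Num.sqrt (dotv x x).

(* The chart is the one of geodesic polar coordinates: (r, theta) is sent to  *)
(* x = r theta in R^d, so the pole is 0. At x <> 0, dr(v) = <x, v> / r and    *)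
(* r^2 dtheta^2(v, v) = |v|^2 - dr(v)^2, so that dr^2 + sinh(r)^2 dtheta^2    *)
(* has the matrix below (see hyperbolic_metric_polar); it extends smoothly by *)
(* the identity at the pole.                                                  *)
Definition hyperbolic_metric (x : 'rV[R]_d) : 'M[R]_d :=
  if x == 0 then 1%:M else
  let r := enorm x in
  let radial := (r ^+ 2)^-1 *: (x^T *m x) in
  radial + (sinh r / r) ^+ 2 *: (1%:M - radial).

Definition pole : 'rV[R]_d := 0.

Definition hyperbolic_distance : 'rV[R]_d -> 'rV[R]_d -> R :=
  riemannian_distance hyperbolic_metric.

Definition hyperbolic_laplacian : ('rV[R]_d -> R) -> 'rV[R]_d -> R :=
  laplace_beltrami hyperbolic_metric.

Lemma dotvE (v w : 'rV[R]_d) : (v *m w^T) 0 0 = dotv v w.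
Proof. by rewrite mxE; apply: eq_bigr => i _; rewrite mxE. Qed.

Lemma hyperbolic_metric_polar (r a : R) (theta w : 'rV[R]_d) :
  0 < r -> dotv theta theta = 1 -> dotv theta w = 0 ->
  let v := a *: theta + r *: w in
  metric_form hyperbolic_metric (r *: theta) v v
  = a ^+ 2 + sinh r ^+ 2 * dotv w w.
Proof.
move=> r0 tt tw v.
have dDl (x y z : 'rV[R]_d) : dotv (x + y) z = dotv x z + dotv y z.
  by rewrite -big_split; apply: eq_bigr => i _; rewrite mxE mulrDl.
have dZl k (x z : 'rV[R]_d) : dotv (k *: x) z = k * dotv x z.
  by rewrite mulr_sumr; apply: eq_bigr => i _; rewrite mxE mulrA.
have dC (x y : 'rV[R]_d) : dotv x y = dotv y x.
  by apply: eq_bigr => i _; rewrite mulrC.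
have rank1 (x : 'rV[R]_d) : (v *m (x^T *m x) *m v^T) 0 0 = dotv v x ^+ 2.
  rewrite mulmxA -mulmxA mxE big_ord_recl big_ord0 addr0 !dotvE.
  by rewrite (dC x) expr2.
have theta0 : theta != 0.
  apply: contra_eq_neq tt => ->; rewrite /dotv big1 1?eq_sym ?oner_neq0 // => i _.
  by rewrite mxE mul0r.
have enormE : enorm (r *: theta) = r.
  by rewrite /enorm dZl dC dZl tt mulr1 -expr2 sqrtr_sqr gtr0_norm.
have vx : dotv v (r *: theta) = r * a.
  by rewrite dC dZl /v dC dDl !dZl (dC w) tt tw mulr0 addr0 mulr1.
have vv : dotv v v = a ^+ 2 + r ^+ 2 * dotv w w.
  rewrite {1}/v dDl !dZl ![dotv _ v]dC /v !dDl !dZl tt tw (dC w theta) tw.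
  by rewrite !mulr0 mulr1 addr0 add0r -expr2 mulrA -expr2.
rewrite /metric_form /hyperbolic_metric scaler_eq0 (gt_eqF r0) (negPf theta0).
rewrite enormE; move: (rank1 (r *: theta)); set Q := _^T *m _ => rank1x.
rewrite mulmxDr mulmxDl -!scalemxAr -!scalemxAl mulmxBr mulmxBl mulmx1.
rewrite -!scalemxAr -!scalemxAl.
set A := v *m Q *m _; set B := v *m v^T.
have -> : (r ^- 2 *: A + (sinh r / r) ^+ 2 *: (B - r ^- 2 *: A)) 0 0 =
    r ^- 2 * A 0 0 + (sinh r / r) ^+ 2 * (B 0 0 - r ^- 2 * A 0 0).
  by rewrite !mxE.
rewrite rank1x dotvE vx vv.
by field; rewrite gt_eqF.
Qed.

End Hyperbolic.

Section Diffusion.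
Context {R : realType} {dO : measure_display} {Omega : measurableType dO}.

(* The sigma-algebra generated by X_s for 0 <= s <= t, where the state space  *)
(* carries its Borel sigma-algebra.                                           *)
Definition natural_filtration {d : nat} (X : R -> Omega -> 'rV[R]_d) (t : R) :
    set (set Omega) :=
  <<s [set A | exists s U, [/\ 0 <= s <= t, open U & A = X s @^-1` U]] >>.

Definition martingale (P : probability Omega R) (F : R -> set (set Omega))
    (M : R -> Omega -> R) : Prop :=
  [/\ forall t, 0 <= t -> P.-integrable setT (EFin \o M t),
      forall t (B : set R), 0 <= t -> measurable B -> F t (M t @^-1` B) &
      forall s t A, 0 <= s <= t -> F s A ->
        \int[P]_(w in A) M t w = \int[P]_(w in A) M s w].

(* (X, (P_x)_x) is the diffusion generated by the operator L: under P_x the   *)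
(* process starts at x, has continuous paths and solves the martingale        *)
(* problem for L on smooth compactly supported functions.                     *)
Record diffusion {d : nat} (L : ('rV[R]_d -> R) -> 'rV[R]_d -> R)
    (X : R -> Omega -> 'rV[R]_d) (P : 'rV[R]_d -> probability Omega R) : Prop :=
  Diffusion {
    diffusion_measurable : forall t U, 0 <= t -> open U ->
      measurable (X t @^-1` U) ;
    diffusion_continuous : forall w,
      {within `[0, +oo[, continuous (fun t => X t w)} ;
    diffusion_start : forall x, P x [set w | X 0 w = x] = 1%E ;
    diffusion_martingale : forall x f, test_function f ->
      martingale (P x) (natural_filtration X)
        (fun t w => f (X t w) - f (X 0 w)
                    - \int[lebesgue_measure]_(s in `[0, t]) L f (X s w)) }.

Definition hyperbolic_brownian_motion {d : nat} (X : R -> Omega -> 'rV[R]_d)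
    (P : 'rV[R]_d -> probability Omega R) : Prop :=
  diffusion (fun f x => hyperbolic_laplacian f x / 2) X P.

Definition radial_part {d : nat} (X : R -> Omega -> 'rV[R]_d) (t : R)
    (w : Omega) : R := hyperbolic_distance pole (X t w).

End Diffusion.

Definition Phi {R : realType} (x : R) : R :=
  (Num.sqrt (2 * pi))^-1 *
  \int[lebesgue_measure]_(u in `[x, +oo[) expR (- (u ^+ 2) / 2).

(* P((R_t^{(d)} - (d-1)t/2) / sqrt t >= x) for P = P_o *)
Definition radial_tail {R : realType} {dO : measure_display}
    {Omega : measurableType dO} {d : nat} (X : R -> Omega -> 'rV[R]_d)
    (P : 'rV[R]_d -> probability Omega R) (t x : R) : R :=
  fine (P pole [set w |
    (radial_part X t w - (d%:R - 1) * t / 2) / Num.sqrt t >= x]).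

(* Main.v *)
Require Import Defs.
From HB Require Import structures.
From mathcomp Require Import all_boot all_order all_algebra.
From mathcomp Require Import all_classical all_reals all_analysis.
From mathcomp Require Import measurable_realfun ring lra.
Set Implicit Arguments.
Unset Strict Implicit.
Unset Printing Implicit Defensive.
Import Order.TTheory GRing.Theory Num.Theory.
Import numFieldNormedType.Exports.
Local Open Scope classical_set_scope.
Local Open Scope ring_scope.

(** Write [z = cosh r] for the radial coordinate, [m = (d - 1) / 2] for the
    escape speed, and [Z] for the generator [Delta / 2] on functions of [z],
    namely [((z^2 - 1) F'' + d z F') / 2]. Both parts follow from comparing the
    tail of [R_t] with explicit functions [A (s, z)] of time and space: if
    [dA/ds + Z A >= 0] then [E A (s, cosh R_s)] is nondecreasing in [s], and it is
    nonincreasing if the sign is reversed ([compare]). Since [X] is only known to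
    solve the martingale problem for compactly supported smooth functions, this
    comparison is derived from Dynkin's formula for functions constant at
    infinity ([mean_profile_le]) and then extended by a cutoff in [ln z].

    The functions used are Gaussian. In terms of the distance [r], [Z] is
    [(F'' + (d - 1) coth r F') / 2], whose drift exceeds [m] everywhere and by
    an amount of order [exp (- 2 r)] far from the pole. Hence the tail
    probability of a Brownian motion with constant drift [m],
    [A = Phi (- (r - a + m (t - s)) / sqrt (t - s))], is a subsolution, and this
    gives [P (R_t >= a) >= Phi ((a - m t) / sqrt t)] ([far_prob_ge_Phi]), the easy
    half of part (1), with no error term. Two regularisations are
    needed: a terminal variance [del^2] makes [A] smooth at [s = t], and
    [ln (z + sqrt (z^2 - 1 + e^2))] replaces [r = arcosh z], which is not smooth
    at the pole.

    Part (2) quantifies this inequality at [a = m t]. During the time interval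
    [[0, 1/2]] the particle is typically at a bounded distance from the pole, where
    the excess drift is bounded below; there [dA/ds + Z A] is at least a constant
    over [sqrt t], because the Gaussian density of variance about [t] is of this
    order near its centre. The gain is harvested by adding to [A] a multiple of
    a cutoff that decreases linearly in time ([tail_gain]).

    For the upper bound, [ln (2 z)] replaces [r]: it is at least [r], and for it
    the drift is at most [m] up to a term in [z^-2]. The indicator of
    [R_t >= a] is dominated, up to [1 / sqrt t], by a ramp of width one, the
    difference of two call prices ([ramp]), which solves the constant drift equation; its defect is at
    most [z^-2 / sqrt v], where [v] is the remaining variance
    ([backward_ramp]). This is absorbed by the barrier
    [32 (sqrt v / (v + 8)) z^(-1/2)]: since the process is transient, the mean of
    [z^(-1/2)] decreases exponentially, and this pays for a source term
    [z^(-1/2) / sqrt v] at the price of an initial value of order [1 / sqrt t].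
    Moving the threshold of a normal tail by a bounded amount and changing the
    variance from [t] to [t + 1 / t] cost [O (1 / sqrt t)] as well
    ([far_prob_le_Phi]).

    The geometry enters through two facts: in the given chart the distance to the
    pole is the Euclidean norm ([hyperbolic_distance_pole]), and the
    Laplace-Beltrami operator acts on functions of [z] as twice the operator [Z]
    ([hyperbolic_laplacian_radial]). *)

(** * Smooth functions on an open subset of R^n *)

Section DirectionalDerivatives.
Context {R : realType} {V : normedModType R}.
Implicit Types (f g : V -> R) (x v : V).

(** The chain rule along a direction: it reduces to the one for functions of one
    real variable by restriction to the line through [x] directed by [v]. *)
Lemma is_derive_comp_dir f (g : R -> R) x v df dg :
  is_derive x v f df -> is_derive (f x) 1 g dg ->
  is_derive x v (g \o f) (dg * df).
Proof.
move=> [fd <-] [gd <-].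
have line h : f (h *: v + x) = (fun h : R => f (h *: v + x)) h by [].
have fd1 : derivable (fun h : R => f (h *: v + x)) 0 1.
  exact: (derivable1P f x v).1.
have shift0 (u : V -> R) : 'D_v u x = 'D_1 (fun h : R => u (h *: v + x)) 0.
  rewrite /derive; set u1 := fun h => h^-1 *: _; set u2 := fun h => h^-1 *: _.
  suff -> : u1 = u2 by [].
  apply/funext => h; rewrite /u1 /u2 /=.
  by rewrite addr0 scale0r add0r [_%:A]mulr1.
have gd1 : derivable g ((fun h : R => f (h *: v + x)) 0) 1.
  by rewrite scale0r add0r.
have [d e] : is_derive (0 : R) 1 (g \o (fun h : R => f (h *: v + x)))
    ('D_1 g (f x) * 'D_v f x).
  rewrite (shift0 f); apply: is_derive1_comp.
    by apply: DeriveDef => //; rewrite scale0r add0r.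
  exact: DeriveDef.
by apply: DeriveDef; [exact: (derivable1P (g \o f) x v).2 | rewrite shift0].
Qed.

Lemma is_derive_const (c : R) x v : is_derive x v (fun=> c) 0.
Proof. exact: is_derive_cst. Qed.

Lemma is_derive_mul f g x v df dg :
  is_derive x v f df -> is_derive x v g dg ->
  is_derive x v (fun y => f y * g y) (f x * dg + g x * df).
Proof. exact: is_deriveM. Qed.

Lemma is_derive_add f g x v df dg :
  is_derive x v f df -> is_derive x v g dg ->
  is_derive x v (fun y => f y + g y) (df + dg).
Proof. exact: is_deriveD. Qed.

Lemma is_derive_sub f g x v df dg :
  is_derive x v f df -> is_derive x v g dg ->
  is_derive x v (fun y => f y - g y) (df - dg).
Proof. exact: is_deriveB. Qed.

Lemma is_derive_mulC c f x v df :
  is_derive x v f df -> is_derive x v (fun y => c * f y) (c * df).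
Proof. exact: is_deriveZ. Qed.

Lemma is_derive_exp f m x v df : is_derive x v f df ->
  is_derive x v (fun y => f y ^+ m) (m%:R * f x ^+ m.-1 * df).
Proof. by move=> fd; have := is_deriveX m fd; rewrite exprfctE. Qed.

Lemma is_derive_inv f x v df : f x != 0 ->
  is_derive x v f df -> is_derive x v (fun y => (f y)^-1) (- (f x) ^- 2 * df).
Proof.
move=> f0 [fd <-]; apply: DeriveDef; first exact: derivableV.
by rewrite deriveV.
Qed.

Lemma is_derive_expRf f x v df :
  is_derive x v f df -> is_derive x v (fun y => expR (f y)) (expR (f x) * df).
Proof. by move=> fd; apply: is_derive_comp_dir. Qed.

Lemma is_derive_lnf f x v df : 0 < f x ->
  is_derive x v f df -> is_derive x v (fun y => ln (f y)) ((f x)^-1 * df).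
Proof.
by move=> f0 fd; apply: is_derive_comp_dir => //; exact: is_derive1_ln.
Qed.

Lemma is_derive_sqrtf f x v df : 0 < f x -> is_derive x v f df ->
  is_derive x v (fun y => Num.sqrt (f y)) ((2 * Num.sqrt (f x))^-1 * df).
Proof.
by move=> f0 fd; apply: is_derive_comp_dir => //; exact: is_derive1_sqrt.
Qed.

End DirectionalDerivatives.

Lemma is_derive_coord {R : realType} {n : nat} (x v : 'rV[R]_n) j :
  is_derive x v (fun y : 'rV[R]_n => y 0 j) (v 0 j).
Proof.
apply: DeriveDef; first exact/diff_derivable/differentiable_coord.
have := derive_mx (@derivable_id _ _ x v).
by rewrite derive_id => /matrixP /(_ 0 j); rewrite !mxE.
Qed.

Section Smooth.
Context {R : realType} {n : nat}.
Implicit Types (D : set 'rV[R]_n) (f g : 'rV[R]_n -> R) (k : nat).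

(** [C^k] on [D], each derivative of order below [k] being also required to be
    continuous: this makes the notion decreasing in [k], which the inductions
    below rely on. *)
Fixpoint smooth_upto D k f : Prop :=
  (forall x, D x -> {for x, continuous f}) /\
  if k is k'.+1 then
    (forall x i, D x -> derivable f x (delta_mx 0 i : 'rV[R]_n)) /\
    (forall i, smooth_upto D k' (partial i f))
  else True.

Definition smooth_on D f := forall k, smooth_upto D k f.

Lemma smooth_upto_continuous D k f : smooth_upto D k f ->
  forall x, D x -> {for x, continuous f}.
Proof. by case: k => [|k] [+ _]. Qed.

Lemma smooth_upto_pred D k f : smooth_upto D k.+1 f -> smooth_upto D k f.
Proof.
elim: k f => [|k IH] f /= [cf [df pf]]; first by [].
by split=> //; split=> // i; apply/IH/pf.
Qed.

Lemma smooth_upto_Ck k f : smooth_upto setT k f -> Ck k f.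
Proof.
elim: k f => [|k IH] f /= [cf]; first by move=> _ x; apply: cf.
by move=> [df pf]; split=> [x i|i]; [apply: df | apply/IH/pf].
Qed.

Section OpenDomain.
Variable D : set 'rV[R]_n.
Hypothesis openD : open D.

Let near_eq f g : (forall x, D x -> f x = g x) ->
  forall x, D x -> \near x, f x = g x.
Proof.
move=> fg x Dx; have : nbhs x D by exact: open_nbhs_nbhs.
by apply: filterS => y; exact: fg.
Qed.

Lemma eq_smooth_upto k f g : (forall x, D x -> f x = g x) ->
  smooth_upto D k f -> smooth_upto D k g.
Proof.
elim: k f g => [|k IH] f g fg.
  move=> [cf _]; split=> // x Dx.
  rewrite /prop_for /continuous_at -(fg x Dx); apply: cvg_trans (cf _ Dx).
  exact: near_eq_cvg (near_eq fg Dx).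
move=> [cf [df pf]]; split.
  move=> x Dx; rewrite /prop_for /continuous_at -(fg x Dx); apply: cvg_trans (cf _ Dx).
  exact: near_eq_cvg (near_eq fg Dx).
split=> [x i Dx|i]; first exact/(near_eq_derivable (near_eq fg Dx))/df.
by apply: IH (pf i) => x Dx; exact: near_eq_derive (near_eq fg Dx).
Qed.

Lemma smooth_upto_is_derive k f (f' : 'I_n -> 'rV[R]_n -> R) :
  (forall x, D x -> {for x, continuous f}) ->
  (forall x i, D x -> is_derive x (delta_mx 0 i : 'rV[R]_n) f (f' i x)) ->
  (forall i, smooth_upto D k (f' i)) -> smooth_upto D k.+1 f.
Proof.
move=> cf df sf'; split=> //; split=> [x i Dx|i]; first by have [] := df x i Dx.
by apply: eq_smooth_upto (sf' i) => x Dx; have [_ <-] := df x i Dx.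
Qed.

Lemma smooth_upto_derivable k f x i : smooth_upto D k.+1 f -> D x ->
  is_derive x (delta_mx 0 i : 'rV[R]_n) f (partial i f x).
Proof. by move=> [_ [df _]] Dx; exact/derivableP/df. Qed.

Lemma smooth_upto_cst k c : smooth_upto D k (fun=> c).
Proof.
elim: k c => [|k IH] c; first by split=> // x _; exact: cst_continuous.
apply: (@smooth_upto_is_derive _ _ (fun _ _ => 0)) => [x _|i].
- exact: cst_continuous.
- exact: IH.
Qed.

Lemma smooth_upto_coord k j : smooth_upto D k (fun x : 'rV[R]_n => x 0 j).
Proof.
case: k => [|k].
  by split=> // x _; exact: coord_continuous.
apply: (@smooth_upto_is_derive _ _ (fun i _ => (delta_mx 0 i : 'rV[R]_n) 0 j)).
- by move=> x _; exact: coord_continuous.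
- by move=> x i _; exact: is_derive_coord.
- by move=> i; exact: smooth_upto_cst.
Qed.

Lemma smooth_uptoD k f g : smooth_upto D k f -> smooth_upto D k g ->
  smooth_upto D k (fun x => f x + g x).
Proof.
elim: k f g => [|k IH] f g sf sg.
  by split=> // x Dx; apply: continuousD; [apply: sf.1 | apply: sg.1].
apply: (@smooth_upto_is_derive _ _ (fun i x => partial i f x + partial i g x)).
- by move=> x Dx; apply: continuousD; [apply: sf.1 | apply: sg.1].
- by move=> x i Dx; apply: is_derive_add; apply: smooth_upto_derivable; eassumption.
- by move=> i; apply: IH; [apply: sf.2.2 | apply: sg.2.2].
Qed.

Lemma smooth_uptoM k f g : smooth_upto D k f -> smooth_upto D k g ->
  smooth_upto D k (fun x => f x * g x).
Proof.
elim: k f g => [|k IH] f g sf sg.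
  by split=> // x Dx; apply: continuousM; [apply: sf.1 | apply: sg.1].
apply: (@smooth_upto_is_derive _ _
  (fun i x => f x * partial i g x + g x * partial i f x)).
- by move=> x Dx; apply: continuousM; [apply: sf.1 | apply: sg.1].
- by move=> x i Dx; apply: is_derive_mul; apply: smooth_upto_derivable; eassumption.
- move=> i; apply: smooth_uptoD; apply: IH; try exact: smooth_upto_pred.
    exact: sg.2.2.
  exact: sf.2.2.
Qed.

(** The chain rule raises the order of [g \o f] by one as soon as [g' \o f] has
    the previous order, so an induction gives the smoothness of [g \o f] when
    the derivatives of [g] are expressed through [g] itself. *)
Lemma smooth_upto_comp k f (g g' : R -> R) :
  (forall x, D x -> is_derive (f x) 1 g (g' (f x))) ->
  smooth_upto D k (g' \o f) -> smooth_upto D k.+1 f ->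
  smooth_upto D k.+1 (g \o f).
Proof.
move=> dg sg' sf.
apply: (@smooth_upto_is_derive _ _ (fun i x => (g' \o f) x * partial i f x)).
- move=> x Dx; apply: continuous_comp; first exact: sf.1.
  have [+ _] := dg x Dx.
  by move=> /derivable1_diffP/differentiable_continuous.
- move=> x i Dx; apply: is_derive_comp_dir; last exact: dg.
  by apply: smooth_upto_derivable; eassumption.
- by move=> i; apply: smooth_uptoM => //; exact: sf.2.2.
Qed.

Lemma smooth_upto_comp0 f (g g' : R -> R) :
  (forall x, D x -> is_derive (f x) 1 g (g' (f x))) ->
  smooth_upto D 0 f -> smooth_upto D 0 (g \o f).
Proof.
move=> dg [cf _]; split=> // x Dx; apply: continuous_comp; first exact: cf.
by have [+ _] := dg x Dx; move=> /derivable1_diffP/differentiable_continuous.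
Qed.

Lemma eq_smooth_on f g : (forall x, D x -> f x = g x) ->
  smooth_on D f -> smooth_on D g.
Proof. by move=> fg sf k; apply: eq_smooth_upto (sf k). Qed.

Lemma smooth_on_cst c : smooth_on D (fun=> c).
Proof. by move=> k; exact: smooth_upto_cst. Qed.

Lemma smooth_on_coord j : smooth_on D (fun x : 'rV[R]_n => x 0 j).
Proof. by move=> k; exact: smooth_upto_coord. Qed.

Lemma smooth_onD f g : smooth_on D f -> smooth_on D g ->
  smooth_on D (fun x => f x + g x).
Proof. by move=> sf sg k; apply: smooth_uptoD. Qed.

Lemma smooth_onM f g : smooth_on D f -> smooth_on D g ->
  smooth_on D (fun x => f x * g x).
Proof. by move=> sf sg k; apply: smooth_uptoM. Qed.

Lemma smooth_onN f : smooth_on D f -> smooth_on D (fun x => - f x).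
Proof.
move=> sf; apply: (@eq_smooth_on (fun x => -1 * f x)).
  by move=> x _; rewrite mulN1r.
by apply: smooth_onM => //; exact: smooth_on_cst.
Qed.

Lemma smooth_onB f g : smooth_on D f -> smooth_on D g ->
  smooth_on D (fun x => f x - g x).
Proof. by move=> sf sg; apply: smooth_onD => //; exact: smooth_onN. Qed.

Lemma smooth_on_sum (I : finType) (F : I -> 'rV[R]_n -> R) :
  (forall i, smooth_on D (F i)) -> smooth_on D (fun x => \sum_i F i x).
Proof.
move=> sF; elim: (index_enum I) => [|i s IH].
  apply: (@eq_smooth_on (fun=> 0)); last exact: smooth_on_cst.
  by move=> x _; rewrite big_nil.
apply: (@eq_smooth_on (fun x => F i x + \sum_(j <- s) F j x)).
  by move=> x _; rewrite big_cons.
exact: smooth_onD.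
Qed.

Lemma smooth_onX f m : smooth_on D f -> smooth_on D (fun x => f x ^+ m).
Proof.
move=> sf; elim: m => [|m IH].
  apply: (@eq_smooth_on (fun=> 1)); last exact: smooth_on_cst.
  by move=> x _; rewrite expr0.
apply: (@eq_smooth_on (fun x => f x * f x ^+ m)); last exact: smooth_onM.
by move=> x _; rewrite exprS.
Qed.

Lemma smooth_on_comp f (g g' : R -> R) :
  (forall x, D x -> is_derive (f x) 1 g (g' (f x))) ->
  smooth_on D f -> smooth_on D (g' \o f) -> smooth_on D (g \o f).
Proof.
move=> dg sf sg' [|k]; first exact: smooth_upto_comp0 dg (sf 0%N).
exact: smooth_upto_comp dg (sg' k) (sf k.+1).
Qed.

(** The successive derivatives of the outer function are given as a sequence. *)
Lemma smooth_on_comp_seq f (g : nat -> R -> R) :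
  (forall k x, D x -> is_derive (f x) 1 (g k) (g k.+1 (f x))) ->
  smooth_on D f -> smooth_on D (g 0%N \o f).
Proof.
move=> dg sf k; suff: forall j, smooth_upto D k (g j \o f) by [].
elim: k => [|k IH] j.
  exact: smooth_upto_comp0 (dg j) (sf 0%N).
by apply: smooth_upto_comp (dg j) _ (sf k.+1); exact: IH.
Qed.

Lemma smooth_on_expR f : smooth_on D f -> smooth_on D (fun x => expR (f x)).
Proof.
by move=> sf; apply: (@smooth_on_comp_seq f (fun=> expR)) => // k x _;
  exact: is_derive_expR.
Qed.

Lemma smooth_onV f : (forall x, D x -> f x != 0) ->
  smooth_on D f -> smooth_on D (fun x => (f x)^-1).
Proof.
move=> f0 sf.
have dinv x : D x -> is_derive (f x) 1 GRing.inv (- (f x) ^- 2 : R).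
  move=> Dx; rewrite -[- _ : R]mulr1.
  by apply: (@is_derive_inv _ _ id (f x) 1 1 (f0 x Dx)).
case=> [|k]; first exact: (@smooth_upto_comp0 f GRing.inv (fun y => - y ^- 2)).
elim: k => [|k IH].
  apply: (@smooth_upto_comp 0 f GRing.inv (fun y => - y ^- 2)) => //.
  apply: (@eq_smooth_upto _ (fun x => -1 * ((f x)^-1 * (f x)^-1))).
    by move=> x _ /=; rewrite mulN1r -invfM expr2.
  have s0 : smooth_upto D 0 (fun x => (f x)^-1).
    exact: (@smooth_upto_comp0 f GRing.inv (fun y => - y ^- 2)).
  by do 2?apply: smooth_uptoM => //; exact: smooth_upto_cst.
apply: (@smooth_upto_comp _ f GRing.inv (fun y => - y ^- 2)) => //.
apply: (@eq_smooth_upto _ (fun x => -1 * ((f x)^-1 * (f x)^-1))).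
  by move=> x _ /=; rewrite mulN1r -invfM expr2.
by do 2?apply: smooth_uptoM => //; exact: smooth_upto_cst.
Qed.

Lemma smooth_on_ln f : (forall x, D x -> 0 < f x) ->
  smooth_on D f -> smooth_on D (fun x => ln (f x)).
Proof.
move=> f0 sf.
have dln x : D x -> is_derive (f x) 1 (@ln R) (f x)^-1.
  by move=> Dx; exact/is_derive1_ln/f0.
apply: (smooth_on_comp dln sf).
by apply: smooth_onV => // x Dx; rewrite gt_eqF// f0.
Qed.

Lemma smooth_on_sqrt f : (forall x, D x -> 0 < f x) ->
  smooth_on D f -> smooth_on D (fun x => Num.sqrt (f x)).
Proof.
move=> f0 sf; apply: (@eq_smooth_on (fun x => expR (2^-1 * ln (f x)))).
  move=> x Dx; have fx0 := f0 x Dx.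
  apply/eqP; rewrite -(@eqrXn2 _ 2) ?expR_ge0 ?sqrtr_ge0//.
  rewrite sqr_sqrtr ?(ltW fx0)// -expRM_natl mulrA.
  by rewrite (_ : 2%:R * 2^-1 = 1 :> R) ?mul1r ?lnK ?posrE// mulfV.
apply: smooth_on_expR; apply: smooth_onM; first exact: smooth_on_cst.
exact: smooth_on_ln.
Qed.

End OpenDomain.
End Smooth.

(** * Power series with coefficients dominated by those of exp *)

Section PowerSeries.
Context {R : realType}.
Implicit Types (a b : nat -> R) (x q r : R).

(** This class is stable under [pseries_diffs], so such a series is smooth on
    the whole line. *)
Definition exp_dominated a := forall n, `|a n| <= n`!%:R^-1.

Definition power_series a x : R := limn (pseries a x).

Lemma is_cvg_power_series a x : exp_dominated a -> cvgn (pseries a x).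
Proof.
move=> ha; apply: normed_cvg.
apply: (@series_le_cvg _ _ (exp_coeff `|x|)) => [n|n|n|].
- exact: normr_ge0.
- by rewrite exp_coeff_ge0.
- by rewrite /exp_coeff /= normrM normrX mulrC ler_wpM2l ?exprn_ge0.
- exact: is_cvg_series_exp_coeff.
Qed.

Lemma exp_dominated_diffs a : exp_dominated a -> exp_dominated (pseries_diffs a).
Proof.
move=> ha n; rewrite /pseries_diffs normrM normr_nat.
apply: le_trans (ler_wpM2l _ (ha n.+1)) _ => //.
by rewrite factS natrM invfM mulrA divff ?mul1r// pnatr_eq0.
Qed.

Lemma is_derive_power_series a x : exp_dominated a ->
  is_derive x 1 (power_series a) (power_series (pseries_diffs a) x).
Proof.
move=> ha; apply: (@pseries_snd_diffs _ a (`|x| + 1)).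
- exact: is_cvg_power_series.
- exact/is_cvg_power_series/exp_dominated_diffs.
- exact/is_cvg_power_series/exp_dominated_diffs/exp_dominated_diffs.
- by rewrite [ltRHS]ger0_norm ?addr_ge0// ltrDl.
Qed.

Lemma power_seriesZ c a x : exp_dominated a ->
  power_series (fun n => c * a n) x = c * power_series a x.
Proof.
move=> ha; have e := lim_seriesZ c (@is_cvg_power_series a x ha).
rewrite /power_series /pseries -[RHS]e.
by congr (limn (series _)); apply/funext => n /=; rewrite -mulrA.
Qed.

Lemma power_seriesD a b x : exp_dominated a -> exp_dominated b ->
  power_series (fun n => a n + b n) x = power_series a x + power_series b x.
Proof.
move=> ha hb.
have e := lim_seriesD (@is_cvg_power_series a x ha) (@is_cvg_power_series b x hb).
rewrite /power_series /pseries -[RHS]e.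
by congr (limn (series _)); apply/funext => n /=; rewrite mulrDl.
Qed.

(** Reindexing turns identities between [cosh_sq], [sinhc] and [sinhc_quot] into
    identities between coefficients. *)
Lemma power_series_shift a x : exp_dominated a ->
  exp_dominated (fun n => a n.+1) ->
  x * power_series (fun n => a n.+1) x = power_series a x - a 0%N.
Proof.
move=> ha ha'; apply/esym/eqP; rewrite subr_eq; apply/eqP.
have c1 := @is_cvg_power_series _ x ha'.
have : (fun n => pseries a x n.+1) @ \oo -->
    x * power_series (fun n => a n.+1) x + a 0%N.
  rewrite [X in X @ _ --> _](_ : _ =
      (fun n => x * pseries (fun n => a n.+1) x n + a 0%N)); last first.
    apply/funext => n; rewrite /pseries /series /=.
    rewrite !big_mkord big_ord_recl expr0 mulr1 addrC; congr (_ + _).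
    by rewrite mulr_sumr; apply: eq_bigr => i _; rewrite /= exprS mulrCA.
  by apply: cvgD; [apply: cvgMr|exact: cvg_cst].
by rewrite (cvg_shiftS (pseries a x)) => /cvg_lim <-.
Qed.

Lemma power_series_ge0 a x : exp_dominated a -> (forall n, 0 <= a n) -> 0 <= x ->
  0 <= power_series a x.
Proof.
move=> ha a0 x0; apply: limr_ge; first exact: is_cvg_power_series.
by apply: nearW => n; apply: sumr_ge0 => i _; rewrite mulr_ge0 ?exprn_ge0.
Qed.

Lemma power_series0 a : exp_dominated a -> power_series a 0 = a 0%N.
Proof.
move=> ha; apply/eqP; rewrite -subr_eq0 /power_series; apply/eqP.
have -> : pseries a 0 = (fun n => if n is n'.+1 then a 0%N else 0).
  apply/funext => -[|n]; rewrite /pseries /series /=; first by rewrite big_geq.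
  rewrite big_mkord big_ord_recl expr0 mulr1 big1 ?addr0// => i _.
  by rewrite expr0n mulr0.
apply/eqP; rewrite subr_eq0; apply/eqP/cvg_lim => //.
by rewrite -cvg_shiftS; exact: cvg_cst.
Qed.

Lemma smooth_on_power_series n (D : set 'rV[R]_n) (f : 'rV[R]_n -> R) a :
  open D -> exp_dominated a -> smooth_on D f ->
  smooth_on D (fun p => power_series a (f p)).
Proof.
move=> oD ha sf.
apply: (@smooth_on_comp_seq _ _ _ oD f
  (fun k => power_series (iter k (@pseries_diffs R) a))) => // k p _.
apply: is_derive_power_series; elim: k => //= k; exact: exp_dominated_diffs.
Qed.

(** ** cosh and sinh as functions of the squared distance *)

Definition fact_coef j n : R := ((2 * n + j)`!)%:R^-1.

Lemma fact_coef_dominated j : exp_dominated (fact_coef j).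
Proof.
move=> n; rewrite ger0_norm ?invr_ge0// lef_pV2 ?posrE ?ltr0n ?fact_gt0//.
by rewrite ler_nat; apply: leq_fact; rewrite mul2n -addnn -addnA leq_addr.
Qed.

Lemma fact_coef_ge0 j n : 0 <= fact_coef j n.
Proof. by rewrite invr_ge0. Qed.

(** [cosh_sq (r ^ 2) = cosh r] and [sinhc (r ^ 2) = sinh r / r]; as functions of
    [q = r ^ 2] they are entire, which is what makes functions of the hyperbolic
    distance smooth at the pole. *)
Definition cosh_sq : R -> R := power_series (fact_coef 0).
Definition sinhc : R -> R := power_series (fact_coef 1).

(** [(sinhc q - 1) / q], extended to [q = 0]. *)
Definition sinhc_quot : R -> R := power_series (fact_coef 3).

Lemma is_derive_cosh_sq q : is_derive q 1 cosh_sq (sinhc q / 2).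
Proof.
rewrite (_ : sinhc q / 2 = power_series (pseries_diffs (fact_coef 0)) q).
  exact/is_derive_power_series/fact_coef_dominated.
rewrite mulrC -power_seriesZ; last exact: fact_coef_dominated.
congr power_series; apply/funext => n; rewrite /pseries_diffs /fact_coef.
rewrite (_ : 2 * n.+1 + 0 = (2 * n + 1).+1)%N; last by rewrite addn0 mulnS addnC addn2 addn1.
rewrite factS natrM invfM (_ : (2 * n + 1).+1 = 2 * n.+1)%N; last first.
  by rewrite mulnS addn1.
by rewrite natrM invfM; field; rewrite pnatr_eq0 -lt0n fact_gt0 nat1r pnatr_eq0.
Qed.

Definition sinhc' : R -> R := power_series (pseries_diffs (fact_coef 1)).

Lemma is_derive_sinhc q : is_derive q 1 sinhc (sinhc' q).
Proof. exact/is_derive_power_series/fact_coef_dominated. Qed.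

Lemma sinhcE q : sinhc q = 1 + q * sinhc_quot q.
Proof.
have eS n : fact_coef 1 n.+1 = fact_coef 3 n.
  by rewrite /fact_coef mulnS -addnA (addnC 2%N) -addnA.
rewrite (_ : sinhc_quot = power_series (fun n => fact_coef 1 n.+1)); last first.
  by congr power_series; apply/funext => n; rewrite eS.
rewrite power_series_shift; [|exact: fact_coef_dominated|].
  by rewrite {2}/fact_coef muln0 add0n (_ : 1`! = 1)%N // invr1 addrC subrK.
by move=> n; rewrite eS; exact: fact_coef_dominated.
Qed.

(** The identity [d/dr (sinh r) = cosh r] written in the variable [q = r ^ 2]. *)
Lemma sinhc_cosh_sq q : sinhc q + 2 * q * sinhc' q = cosh_sq q.
Proof.
have dom : exp_dominated (fun n => (2 * n)%:R * fact_coef 1 n).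
  move=> [|n]; first by rewrite muln0 mul0r normr0 invr_ge0.
  rewrite normrM normr_nat ger0_norm ?fact_coef_ge0// /fact_coef.
  rewrite addn1 factS [X in _ * X^-1]natrM invfM mulrA.
  apply: (@le_trans _ _ ((2 * n.+1)`!)%:R^-1).
    by rewrite ler_piMl ?invr_ge0// ler_pdivrMr ?ltr0n// mul1r ler_nat.
  rewrite lef_pV2 ?posrE ?ltr0n ?fact_gt0// ler_nat; apply: leq_fact.
  by rewrite mul2n -addnn leq_addr.
have e : 2 * q * sinhc' q = power_series (fun n => (2 * n)%:R * fact_coef 1 n) q.
  rewrite -[RHS]subr0 -[X in _ = _ - X](mul0r (fact_coef 1 0)).
  have de : (fun n => (2 * n.+1)%:R * fact_coef 1 n.+1) =
            (fun n => 2 * pseries_diffs (fact_coef 1) n).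
    by apply/funext => n; rewrite /pseries_diffs natrM mulrA.
  have := power_series_shift q dom.
  rewrite de mul0r subr0 => <-.
    rewrite power_seriesZ; first by rewrite mulrA (mulrC q).
    exact/exp_dominated_diffs/fact_coef_dominated.
  rewrite -de => n; apply: le_trans (dom n.+1) _.
  by rewrite lef_pV2 ?posrE ?ltr0n ?fact_gt0// ler_nat leq_fact.
rewrite e -power_seriesD//; last exact: fact_coef_dominated.
congr power_series; apply/funext => n; rewrite /fact_coef addn0 addn1 factS.
rewrite [(_.+1 * _)%:R]natrM invfM -natr1; field.
by rewrite pnatr_eq0 -lt0n fact_gt0 -natrM natr1 pnatr_eq0.
Qed.

Lemma cosh_sq_sinhc q : cosh_sq q ^+ 2 - q * sinhc q ^+ 2 = 1.
Proof.
pose f q := cosh_sq q ^+ 2 - q * sinhc q ^+ 2.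
have f0 : f 0 = 1.
  rewrite /f mul0r subr0 /cosh_sq power_series0; last exact: fact_coef_dominated.
  by rewrite /fact_coef muln0 addn0 fact0 invr1 expr1n.
rewrite -[LHS]/(f q) -f0; apply: is_derive_0_is_cst => y.
have dC := is_derive_cosh_sq y; have dS := is_derive_sinhc y.
have sqr (g : R -> R) dg : is_derive y 1 g dg ->
    is_derive y 1 (fun x => g x ^+ 2) (g y * dg + g y * dg).
  by move=> gd; under eq_fun do rewrite expr2; exact: is_derive_mul.
refine (is_derive_eq (is_derive_sub (sqr _ _ dC)
  (is_derive_mul (is_derive_id _ _) (sqr _ _ dS))) _).
by rewrite -(sinhc_cosh_sq y); field.
Qed.

Lemma cosh_sq_sqr r : cosh_sq (r ^+ 2) + r * sinhc (r ^+ 2) = expR r.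
Proof.
pose f r := (cosh_sq (r ^+ 2) + r * sinhc (r ^+ 2)) * expR (- r).
have f0 : f 0 = 1.
  rewrite /f mul0r addr0 oppr0 expR0 mulr1 expr0n /= /cosh_sq power_series0.
    by rewrite /fact_coef muln0 addn0 fact0 invr1.
  exact: fact_coef_dominated.
suff fr : f r = 1 by rewrite -[LHS]mulr1 -(expRxMexpNx_1 r) mulrCA -/(f r) mulrC fr mul1r.
rewrite -f0; apply: is_derive_0_is_cst => y.
have dsq : is_derive y 1 (fun y : R => y ^+ 2) (y * 1 + y * 1).
  by under eq_fun do rewrite expr2; exact: is_derive_mul.
have dC : is_derive y 1 (fun y => cosh_sq (y ^+ 2)) (sinhc (y ^+ 2) / 2 * (y * 1 + y * 1)).
  by apply: is_derive_comp_dir => //; exact: is_derive_cosh_sq.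
have dS : is_derive y 1 (fun y => sinhc (y ^+ 2)) (sinhc' (y ^+ 2) * (y * 1 + y * 1)).
  by apply: is_derive_comp_dir => //; exact: is_derive_sinhc.
have dE : is_derive y 1 (fun y : R => expR (- y)) (expR (- y) * - 1).
  by apply: is_derive_expRf; exact: is_deriveN.
refine (is_derive_eq (is_derive_mul
  (is_derive_add dC (is_derive_mul (is_derive_id _ _) dS)) dE) _).
by rewrite -(sinhc_cosh_sq (y ^+ 2)); field.
Qed.

Lemma sinhc_ge1 q : 0 <= q -> 1 <= sinhc q.
Proof.
move=> q0; rewrite sinhcE lerDl mulr_ge0// power_series_ge0//.
  exact: fact_coef_dominated.
exact: fact_coef_ge0.
Qed.

Lemma cosh_sq_ge1 q : 0 <= q -> 1 <= cosh_sq q.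
Proof.
move=> q0; have C0 : 0 <= cosh_sq q.
  apply: power_series_ge0 => //; first exact: fact_coef_dominated.
  exact: fact_coef_ge0.
rewrite -(@ler_sqr _ 1) ?nnegrE// expr1n -(cosh_sq_sinhc q) gerBl.
by rewrite mulr_ge0 ?sqr_ge0.
Qed.

Lemma sinhc_sqr r : r * sinhc (r ^+ 2) = sinh r.
Proof.
have := cosh_sq_sqr r; have := cosh_sq_sqr (- r).
by rewrite sqrrN /sinh => <- <-; field.
Qed.

Lemma continuous_power_series a : exp_dominated a -> continuous (power_series a).
Proof.
move=> ha q; apply: differentiable_continuous; apply/derivable1_diffP.
by have [] := is_derive_power_series q ha.
Qed.

End PowerSeries.

(** * A smooth monotone cutoff *)

Section Cutoff.
Context {R : realType}.
Implicit Types (x y : R) (P : {poly R}).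

(** The functions [P(1/x) exp(1 - 1/x)], continued by 0, are closed under
    differentiation, so all of them are smooth; the case [P = 1] is the classical
    function that is flat at the origin, normalised at [x = 1]. *)
Definition flat P x : R := if 0 < x then P.[x^-1] * expR (1 - x^-1) else 0.

Definition flat_deriv P : {poly R} := 'X^2 * (P - P^`()).

Lemma flat_le0 P x : x <= 0 -> flat P x = 0.
Proof. by rewrite /flat ltNge => ->. Qed.

Lemma poly_expR_bounded P :
  exists2 K, 0 <= K & forall y, 0 <= y -> `|P.[y]| * expR (1 - y) <= K.
Proof.
elim/poly_ind: P => [|P c _].
  by exists 0 => // y _; rewrite horner0 normr0 mul0r.
set Q := _ + _.
exists (expR 1 * \sum_(i < size Q) `|Q`_i| * (i`!)%:R) => [|y y0].
  apply: mulr_ge0; first exact: expR_ge0.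
  by apply: sumr_ge0 => i _; exact: mulr_ge0.
rewrite expRD mulrCA ler_wpM2l ?expR_ge0//.
rewrite horner_coef (le_trans (ler_wpM2r _ (ler_norm_sum _ _ _))) ?expR_ge0//.
rewrite mulr_suml ler_sum// => i _.
rewrite normrM -mulrA ler_wpM2l// ger0_norm ?exprn_ge0//.
rewrite expRN ler_pdivrMr ?expR_gt0// -ler_pdivrMl ?ltr0n ?fact_gt0//.
case: (nat_of_ord i) => [|n].
  by rewrite fact0 invr1 mul1r expr0 -expR0 ler_expR.
rewrite mulrC; apply: le_trans (expR_ge1Dxn n y0).
by rewrite lerDr.
Qed.

Lemma flat_bounded P : exists2 K, 0 <= K & forall x, `|flat P x| <= K.
Proof.
have [K K0 hK] := poly_expR_bounded P; exists K => // x.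
rewrite /flat; case: ifPn => [x0|_]; last by rewrite normr0.
by rewrite normrM [X in _ * X]ger0_norm ?expR_ge0// hK// invr_ge0 ltW.
Qed.

(** Multiplying [P] by [X^2] divides [flat P] by [x ^ 2], so the quadratic bound is
    the boundedness of another member of the family; it gives the derivative at
    the origin. *)
Let flat_quadratic P : exists2 K, 0 <= K & forall x, `|flat P x| <= K * x ^+ 2.
Proof.
have [K K0 hK] := flat_bounded ('X^2 * P); exists K => // x.
case: (ltP 0 x) => [x0|x0]; last first.
  by rewrite flat_le0// normr0 mulr_ge0 ?sqr_ge0.
have -> : flat P x = x ^+ 2 * flat ('X^2 * P) x.
  rewrite /flat x0 hornerM hornerXn exprVn !mulrA divff ?mul1r//.
  by rewrite expf_neq0// gt_eqF.
by rewrite normrM ger0_norm ?sqr_ge0// mulrC ler_wpM2r ?sqr_ge0.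
Qed.

Lemma is_derive_flat P x : is_derive x 1 (flat P) (flat (flat_deriv P) x).
Proof.
have [x0|x0|->] := ltgtP x 0.
- rewrite (flat_le0 _ (ltW x0)).
  refine (near_eq_is_derive _ (is_derive_cst (0 : R) x 1)).
  near=> y; rewrite flat_le0//; apply: ltW; near: y.
  exact: lt_nbhsl.
- have xN0 : x != 0 by rewrite gt_eqF.
  rewrite /flat x0.
  have dV : is_derive x 1 (fun y : R => y^-1) (- x ^- 2 * 1).
    exact: (@is_derive_inv _ _ id).
  have dP : is_derive x^-1 1 (horner P) P^`().[x^-1].
    by apply: DeriveDef; [exact: derivable_horner | rewrite -derive1E -derivE].
  have d : is_derive x 1 (fun y => P.[y^-1] * expR (1 - y^-1))
      ((flat_deriv P).[x^-1] * expR (1 - x^-1)).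
    refine (is_derive_eq (is_derive_mul (is_derive_comp_dir dV dP)
      (is_derive_expRf (is_derive_sub (is_derive_const 1 _ _) dV))) _).
    rewrite /flat_deriv hornerM hornerXn hornerD hornerN /= -exprVn.
    by ring.
  refine (near_eq_is_derive _ d); near=> y; rewrite /flat.
  suff -> : 0 < y by [].
  by near: y; exact: lt_nbhsr.
- rewrite flat_le0//.
  have [K0 K0_ge0 hK0] := flat_quadratic P.
  have [K K_gt0 hK] : exists2 K, 0 < K & forall x, `|flat P x| <= K * x ^+ 2.
    exists (K0 + 1) => [|y]; first by rewrite ltr_wpDl.
    by apply: le_trans (hK0 y) _; rewrite ler_wpM2r ?sqr_ge0 ?lerDl.
  suff h : (fun h => h^-1 *: ((flat P \o shift 0) (h *: 1) - flat P 0)) @ 0^'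
      --> (0 : R).
    by apply: DeriveDef; [apply/cvg_ex; exists 0 | exact: cvg_lim].
  apply/cvgrPdist_le => e e0; near=> h.
  have h0 : h != 0 by near: h; exact: nbhs_dnbhs_neq.
  rewrite /= [flat P 0]flat_le0// subr0 sub0r normrN addr0 [h *: 1]mulr1.
  rewrite normrM normfV ler_pdivrMl ?normr_gt0//.
  apply: le_trans (hK h) _; rewrite -(real_normK (num_real h)).
  rewrite expr2 mulrCA ler_wpM2l//.
  rewrite -ler_pdivlMl//; near: h; apply: dnbhs0_le.
  by rewrite mulr_gt0 ?invr_gt0.
Unshelve. all: by end_near. Qed.

Definition bump : R -> R := flat 1.
Definition bump' : R -> R := flat (flat_deriv 1).
Definition bump'' : R -> R := flat (flat_deriv (flat_deriv 1)).

Lemma bump_ge0 x : 0 <= bump x.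
Proof.
by rewrite /bump /flat; case: ifP => // _; rewrite hornerC mul1r expR_ge0.
Qed.

Lemma bump_le1 x : x <= 1 -> bump x <= 1.
Proof.
rewrite /bump /flat; case: ifP => // x0 x1.
by rewrite hornerC mul1r expR_le1 subr_le0 -invr1 lef_pV2 ?posrE.
Qed.

Lemma bump1 : bump 1 = 1.
Proof. by rewrite /bump /flat ltr01 hornerC invr1 subrr expR0 mul1r. Qed.

Lemma smooth_on_bump n (D : set 'rV[R]_n) (f : 'rV[R]_n -> R) :
  open D -> smooth_on D f -> smooth_on D (fun p => bump (f p)).
Proof.
move=> oD sf.
apply: (@smooth_on_comp_seq _ _ _ oD f (fun k => flat (iter k flat_deriv 1)))
  => // k p _.
exact: is_derive_flat.
Qed.

End Cutoff.

(** * The hyperbolic metric and its Laplacian on radial functions *)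

Section RankOne.
Context {R : realType} {n : nat}.

(** The two block factorisations of one bordered matrix compute its determinant
    in two ways. *)
Lemma det_scalar_rank1 (s c : R) (v : 'rV[R]_n) : s != 0 ->
  \det (s%:M + c *: (v^T *m v)) = s ^+ n * (1 + c / s * dotv v v).
Proof.
move=> s0; pose B : 'M[R]_(1 + n) := block_mx 1%:M v (- (c *: v^T)) s%:M.
have <- : \det B = \det (s%:M + c *: (v^T *m v)).
  have e : block_mx 1%:M 0 (c *: v^T) 1%:M *m B =
      block_mx 1%:M v 0 (s%:M + c *: (v^T *m v)).
    rewrite /B mulmx_block !mul1mx !mul0mx !addr0 mulmx1 addrN.
    by rewrite -scalemxAl addrC.
  have := congr1 determinant e.
  by rewrite det_mulmx det_lblock det_ublock !det1 !mul1r.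
have e : B *m block_mx 1%:M 0 (s^-1 *: (c *: v^T)) 1%:M =
    block_mx (1%:M + s^-1 *: (v *m (c *: v^T))) v 0 s%:M.
  rewrite /B mulmx_block !mulmx1 !mulmx0 !add0r -scalemxAr.
  by rewrite mul_scalar_mx scalerA divff// scale1r addNr.
have := congr1 determinant e.
rewrite det_mulmx det_lblock det_ublock !det1 !mulr1 => ->.
rewrite det_scalar mulrC; congr (_ * _).
rewrite det_mx11 -scalemxAr scalerA mxE [X in _ + X]mxE dotvE mxE eqxx.
by rewrite [s^-1 * c]mulrC.
Qed.

End RankOne.

Section HyperbolicMetric.
Context {R : realType} {n : nat}.
Implicit Types x v : 'rV[R]_n.

Lemma dotv_ge0 x : 0 <= dotv x x.
Proof. by apply: sumr_ge0 => i _; rewrite -expr2 sqr_ge0. Qed.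

Lemma enorm_sqr x : enorm x ^+ 2 = dotv x x.
Proof. by rewrite sqr_sqrtr// dotv_ge0. Qed.

Lemma dotv_eq0 x : (dotv x x == 0) = (x == 0).
Proof.
apply/eqP/eqP => [|->]; last by rewrite /dotv big1// => i _; rewrite mxE mul0r.
move=> /psumr_eq0P h; apply/rowP => i; rewrite mxE; apply/eqP.
rewrite -sqrf_eq0 expr2 h// => j _; by rewrite -expr2 sqr_ge0.
Qed.

Lemma enorm_gt0 x : (0 < enorm x) = (x != 0).
Proof. by rewrite sqrtr_gt0 lt_neqAle dotv_ge0 andbT eq_sym dotv_eq0. Qed.

Lemma cauchy_schwarz x v : dotv x v ^+ 2 <= dotv x x * dotv v v.
Proof.
have [->|x0] := eqVneq x 0.
  rewrite {1}/dotv big1 ?expr0n ?mulr_ge0 ?dotv_ge0//.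
  by move=> i _; rewrite mxE mul0r.
have q0 : 0 < dotv x x by rewrite lt_neqAle dotv_ge0 andbT eq_sym dotv_eq0.
have expand (q b : R) : \sum_(i < n) (q * v 0 i - b * x 0 i) ^+ 2 =
    q ^+ 2 * dotv v v - 2 * q * b * dotv x v + b ^+ 2 * dotv x x.
  rewrite /dotv !mulr_sumr -sumrN -!big_split /=.
  by apply: eq_bigr => i _; ring.
have : 0 <= \sum_(i < n) (dotv x x * v 0 i - dotv x v * x 0 i) ^+ 2.
  by apply: sumr_ge0 => i _; exact: sqr_ge0.
rewrite expand.
rewrite (_ : _ + _ = dotv x x * (dotv x x * dotv v v - dotv x v ^+ 2)).
  by rewrite pmulr_rge0// subr_ge0.
ring.
Qed.

(** In terms of [sinhc] the metric is given by one analytic formula, also at the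
    pole. *)
Lemma hyperbolic_metricE x : let q := dotv x x in
  hyperbolic_metric x =
  (sinhc q ^+ 2)%:M + (- (sinhc q + 1) * sinhc_quot q) *: (x^T *m x).
Proof.
move=> q; rewrite /hyperbolic_metric; case: ifPn => [/eqP x0|x0].
  rewrite /q x0 trmx0 mulmx0 scaler0 addr0.
  have -> : dotv (0 : 'rV[R]_n) 0 = 0 by apply/eqP; rewrite dotv_eq0.
  by rewrite sinhcE mul0r addr0 expr1n.
have r0 : 0 < enorm x by rewrite enorm_gt0.
have q0 : q != 0 by rewrite dotv_eq0.
have -> : sinh (enorm x) / enorm x = sinhc q.
  by rewrite -sinhc_sqr enorm_sqr -/q mulrAC divff ?mul1r ?gt_eqF.
rewrite enorm_sqr -/q scalerBr scale_scalar_mx mulr1 addrCA; congr (_ + _).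
rewrite scalerA -[X in X - _]scale1r -scalerA -scalerBl scalerA; congr (_ *: _).
by rewrite (sinhcE q); field.
Qed.

Lemma det_hyperbolic_metric x :
  \det (hyperbolic_metric x) = (sinhc (dotv x x) ^+ n / sinhc (dotv x x)) ^+ 2.
Proof.
set q := dotv x x; have S0 : sinhc q != 0.
  by rewrite gt_eqF// (lt_le_trans ltr01)// sinhc_ge1// dotv_ge0.
rewrite hyperbolic_metricE det_scalar_rank1 -/q ?expf_neq0//.
rewrite expr_div_n -!exprM mulnC; congr (_ * _).
rewrite [in LHS](_ : _ / _ * q = (1 - sinhc q ^+ 2) / sinhc q ^+ 2).
  by field.
rewrite mulrAC; congr (_ / _).
by rewrite sinhcE; ring.
Qed.

Lemma hyperbolic_metric_radial x : x *m invmx (hyperbolic_metric x) = x.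
Proof.
have S0 : sinhc (dotv x x) != 0.
  by rewrite gt_eqF// (lt_le_trans ltr01)// sinhc_ge1// dotv_ge0.
have gu : hyperbolic_metric x \in unitmx.
  rewrite unitmxE det_hyperbolic_metric unitfE expf_neq0// mulf_neq0//.
    by rewrite expf_neq0.
  by rewrite invr_eq0.
suff e : x *m hyperbolic_metric x = x by rewrite -{1}e mulmxK.
rewrite hyperbolic_metricE mulmxDr mul_mx_scalar -scalemxAr mulmxA.
have -> : x *m x^T = (dotv x x)%:M.
  by rewrite [LHS]mx11_scalar dotvE.
rewrite mul_scalar_mx scalerA -scalerDl -[RHS]scale1r; congr (_ *: _).
by rewrite (sinhcE (dotv x x)); ring.
Qed.

End HyperbolicMetric.

Section HyperbolicLaplacian.
Context {R : realType} {n : nat}.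
Implicit Types x v : 'rV[R]_n.

(** cosh of the distance to the pole. *)
Definition cosh_dist x : R := cosh_sq (dotv x x).

Lemma cosh_dist_ge1 x : 1 <= cosh_dist x.
Proof. exact/cosh_sq_ge1/dotv_ge0. Qed.

Lemma cosh_dist_pole : cosh_dist pole = 1.
Proof.
have := cosh_sq_sinhc (dotv (0 : 'rV[R]_n) 0).
rewrite /cosh_dist /pole; have -> : dotv (0 : 'rV[R]_n) 0 = 0.
  by apply/eqP; rewrite dotv_eq0.
rewrite mul0r subr0 => /eqP; rewrite sqrf_eq1 => /orP[/eqP//|/eqP h].
by have := @cosh_sq_ge1 R 0 (lexx 0); rewrite h; lra.
Qed.

Lemma cosh_dist_sum x : cosh_dist x + sinh (enorm x) = expR (enorm x).
Proof.
by rewrite /cosh_dist -enorm_sqr -cosh_sq_sqr sinhc_sqr.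
Qed.

Lemma is_derive_dotv x i :
  is_derive x (delta_mx 0 i : 'rV[R]_n) (fun y => dotv y y) (2 * x 0 i).
Proof.
have d : is_derive x (delta_mx 0 i : 'rV[R]_n)
    (\sum_(j < n) (fun y : 'rV[R]_n => y 0 j * y 0 j))
    (\sum_(j < n) (x 0 j * (delta_mx 0 i : 'rV[R]_n) 0 j +
                   x 0 j * (delta_mx 0 i : 'rV[R]_n) 0 j)).
  by apply: is_derive_sum => j; apply: is_derive_mul; exact: is_derive_coord.
rewrite (_ : (fun y => dotv y y) =
  \sum_(j < n) (fun y : 'rV[R]_n => y 0 j * y 0 j)); last first.
  by apply/funext => y; rewrite fct_sumE.
apply: is_derive_eq d _.
rewrite (bigD1 i)//= big1 => [|j ji].
  by rewrite mxE !eqxx addr0 /=; ring.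
by rewrite !mxE eqxx /= (negPf ji) mulr0 addr0.
Qed.

Lemma is_derive_cosh_dist x i :
  is_derive x (delta_mx 0 i : 'rV[R]_n) cosh_dist (sinhc (dotv x x) * x 0 i).
Proof.
refine (is_derive_eq
  (is_derive_comp_dir (is_derive_dotv x i) (is_derive_cosh_sq _)) _).
by field.
Qed.

Lemma smooth_on_dotv D : open D -> smooth_on D (fun x => dotv x x).
Proof.
by move=> oD; apply: smooth_on_sum => // i; apply: smooth_onM => //;
  exact: smooth_on_coord.
Qed.

Lemma smooth_on_cosh_dist D : open D -> smooth_on D cosh_dist.
Proof.
move=> oD; apply: smooth_on_power_series => //; last exact: smooth_on_dotv.
exact: fact_coef_dominated.
Qed.

Let invmx_radial x : invmx (hyperbolic_metric x) *m x^T = x^T.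
Proof.
have sym : (hyperbolic_metric x)^T = hyperbolic_metric x.
  rewrite hyperbolic_metricE linearD /= tr_scalar_mx linearZ /= trmx_mul.
  by rewrite trmxK.
by rewrite -{1}sym -trmx_inv -trmx_mul hyperbolic_metric_radial.
Qed.

(** Since the metric fixes the radial direction, the flux of a function of
    [z = cosh r] is [J F'(z) (sinh r / r) x] with [J = (sinh r / r) ^ (n - 1)] the
    volume density, and its divergence only involves [cosh' = sinh] in the
    variable [q = r ^ 2]. *)
Lemma hyperbolic_laplacian_radial (F F1 F2 : R -> R) x :
  (forall z : R, 1 <= z -> is_derive z 1 F (F1 z)) ->
  (forall z : R, 1 <= z -> is_derive z 1 F1 (F2 z)) ->
  hyperbolic_laplacian (F \o cosh_dist) x =
  (cosh_dist x ^+ 2 - 1) * F2 (cosh_dist x) +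
  n%:R * cosh_dist x * F1 (cosh_dist x).
Proof.
move=> dF dF1; rewrite /hyperbolic_laplacian /laplace_beltrami.
have S0 (y : 'rV[R]_n) : sinhc (dotv y y) != 0 :> R.
  by rewrite gt_eqF// (lt_le_trans ltr01)// sinhc_ge1// dotv_ge0.
have sqrt_det (y : 'rV[R]_n) : Num.sqrt (\det (hyperbolic_metric y)) =
    sinhc (dotv y y) ^+ n / sinhc (dotv y y).
  have S1 : 0 <= sinhc (dotv y y).
    by rewrite (le_trans ler01)// sinhc_ge1// dotv_ge0.
  rewrite det_hyperbolic_metric sqrtr_sqr; apply: ger0_norm.
  by apply: divr_ge0 => //; exact: exprn_ge0.
have dF_dist j (y : 'rV[R]_n) : partial j (F \o cosh_dist) y =
    F1 (cosh_dist y) * (sinhc (dotv y y) * y 0 j).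
  have [_ e] := is_derive_comp_dir (is_derive_cosh_dist y j)
    (dF _ (cosh_dist_ge1 y)).
  by rewrite /partial e.
have flux i (y : 'rV[R]_n) : Num.sqrt (\det (hyperbolic_metric y)) *
    (\sum_(j < n) invmx (hyperbolic_metric y) i j * partial j (F \o cosh_dist) y)
    = sinhc (dotv y y) ^+ n * F1 (cosh_dist y) * y 0 i.
  have := congr1 (fun M : 'cV[R]_n => M i 0) (invmx_radial y); rewrite !mxE => e.
  transitivity (Num.sqrt (\det (hyperbolic_metric y)) *
    (F1 (cosh_dist y) * sinhc (dotv y y) * y 0 i)).
    congr (_ * _); rewrite -e mulr_sumr; apply: eq_bigr => j _.
    by rewrite dF_dist mxE; ring.
  by rewrite sqrt_det; field.
set q := dotv x x; set z := cosh_dist x.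
pose dflux i := sinhc q ^+ n * F1 z +
  x 0 i ^+ 2 * (n%:R * sinhc q ^+ n / sinhc q * (sinhc' q * 2) * F1 z +
                sinhc q ^+ n * (F2 z * sinhc q)).
have dS i : is_derive x (delta_mx 0 i : 'rV[R]_n) (fun y => sinhc (dotv y y) ^+ n)
    (n%:R * sinhc q ^+ n / sinhc q * (sinhc' q * (2 * x 0 i))).
  have d1 := is_derive_comp_dir (is_derive_dotv x i) (is_derive_sinhc _).
  refine (is_derive_eq (is_derive_exp n d1) _).
  rewrite -/q /=.
  have -> : n%:R * sinhc q ^+ n.-1 = n%:R * sinhc q ^+ n / sinhc q.
    by case: (posnP n) => [->|/prednK <-]; rewrite ?mul0r// exprSr mulrA mulfK ?S0.
  by [].
rewrite (eq_bigr dflux) => [|i _]; last first.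
  rewrite /partial (_ : (fun y => _) =
    (fun y => sinhc (dotv y y) ^+ n * F1 (cosh_dist y) * y 0 i)); last first.
    by apply/funext => y; exact: flux.
  have dF1_dist := is_derive_comp_dir (is_derive_cosh_dist x i)
    (dF1 _ (cosh_dist_ge1 x)).
  have [_ ->] := is_derive_mul (is_derive_mul (dS i) dF1_dist)
    (is_derive_coord x (delta_mx 0 i : 'rV[R]_n) i).
  by rewrite mxE !eqxx /= /dflux -/q -/z; ring.
rewrite /dflux big_split /= -[X in _ + X]mulr_suml sumr_const card_ord.
have -> : \sum_(i < n) x 0 i ^+ 2 = q.
  by apply: eq_bigr => i _; rewrite expr2.
rewrite sqrt_det -/q -mulr_natl.
have z2 : z ^+ 2 - 1 = q * sinhc q ^+ 2.
  by rewrite -(cosh_sq_sinhc q) -[cosh_sq q]/z; ring.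
rewrite z2 -[X in _ = _ + _ * X * _](sinhc_cosh_sq q : _ = z).
have Sn0 : sinhc q ^+ n != 0 by rewrite expf_neq0// S0.
by field; rewrite Sn0 S0.
Qed.

End HyperbolicLaplacian.

(** * The distance to the pole is the Euclidean norm of the chart *)

Section DistanceToPole.
Context {R : realType} {n : nat}.
Implicit Types x v : 'rV[R]_n.
Local Notation mu := (@lebesgue_measure R).

Let hform x v : R := metric_form hyperbolic_metric x v v.

Lemma hyperbolic_formE x v : hform x v =
  sinhc (dotv x x) ^+ 2 * dotv v v -
  (sinhc (dotv x x) + 1) * sinhc_quot (dotv x x) * dotv x v ^+ 2.
Proof.
rewrite /hform /metric_form hyperbolic_metricE mulmxDr mulmxDl mxE.
rewrite mul_mx_scalar -!scalemxAl mxE dotvE -scalemxAr -scalemxAl mxE.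
have -> : (v *m (x^T *m x) *m v^T) 0 0 = dotv x v ^+ 2.
  rewrite mulmxA -mulmxA mxE big_ord_recl big_ord0 addr0 !dotvE expr2.
  by congr (_ * _); apply: eq_bigr => i _; rewrite mulrC.
by ring.
Qed.

(** Dropping the angular part of the metric. *)
Lemma sqr_dotv_le_form x v : dotv x v ^+ 2 <= dotv x x * hform x v.
Proof.
rewrite hyperbolic_formE; have := cauchy_schwarz x v; have := dotv_ge0 x.
set q := dotv x x; set b := dotv x v; set a := dotv v v => q0 ba.
have eT : (sinhc q + 1) * (q * sinhc_quot q) = sinhc q ^+ 2 - 1.
  by rewrite (sinhcE q); ring.
rewrite (_ : q * _ = b ^+ 2 + sinhc q ^+ 2 * (q * a - b ^+ 2)); last first.
  transitivity (sinhc q ^+ 2 * (q * a) -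
      (sinhc q + 1) * (q * sinhc_quot q) * b ^+ 2); first by ring.
  by rewrite eT; ring.
by rewrite lerDl mulr_ge0 ?sqr_ge0// subr_ge0.
Qed.

Lemma hyperbolic_form_ge0 x v : 0 <= hform x v.
Proof.
have [->|x0] := eqVneq x 0.
  have d0 w : dotv (0 : 'rV[R]_n) w = 0.
    by rewrite /dotv big1// => i _; rewrite mxE mul0r.
  by rewrite hyperbolic_formE !d0 expr0n mulr0 subr0 mulr_ge0 ?sqr_ge0 ?dotv_ge0.
have q0 : 0 < dotv x x by rewrite lt_neqAle dotv_ge0 andbT eq_sym dotv_eq0.
by rewrite -(pmulr_rge0 _ q0) (le_trans _ (sqr_dotv_le_form x v))// sqr_ge0.
Qed.

Lemma hyperbolic_form_radial x t : hform (t *: x) x = dotv x x.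
Proof.
have e : dotv (t *: x) x = t * dotv x x.
  by rewrite /dotv mulr_sumr; apply: eq_bigr => i _; rewrite mxE mulrA.
have e2 : dotv (t *: x) (t *: x) = t ^+ 2 * dotv x x.
  by rewrite /dotv mulr_sumr; apply: eq_bigr => i _; rewrite !mxE; ring.
rewrite hyperbolic_formE e e2; set q := dotv x x.
rewrite {1}(sinhcE (t ^+ 2 * q)) (sinhcE (t ^+ 2 * q)); ring.
Qed.

Let continuous_dotv (a b : R -> 'rV[R]_n) :
  (forall i, continuous (fun t => a t 0 i)) ->
  (forall i, continuous (fun t => b t 0 i)) ->
  continuous (fun t => dotv (a t) (b t)).
Proof.
move=> ca cb t; rewrite /dotv; elim: (index_enum _) => [|i s IH].
  by under eq_fun do rewrite big_nil; exact: cvg_cst.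
under eq_fun do rewrite big_cons.
by apply: cvgD => //; apply: cvgM; [exact: ca | exact: cb].
Qed.

Let curve_coord (c : R -> 'rV[R]_n) : C1_curve c ->
  (forall (t : R) i, is_derive t 1 (fun t => c t 0 i) (derive1 c t 0 i)) /\
  (forall i, continuous (fun t => derive1 c t 0 i)).
Proof.
move=> [dc cc]; split=> [t i|i t].
  apply: DeriveDef; first by have /derivable_mxP := dc t; apply.
  by rewrite derive1E derive_mx// mxE.
apply: (@continuous_comp _ _ _ (derive1 c) (fun M : 'rV[R]_n => M 0 i)).
  exact: cc.
exact: coord_continuous.
Qed.

(** The speed of the curve is at least the derivative of its Euclidean norm,
    because the metric is [dr^2] plus a nonnegative form. *)
Lemma enorm_le_curve_length (c : R -> 'rV[R]_n) : C1_curve c -> c 0 = 0 ->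
  enorm (c 1) <= curve_length hyperbolic_metric c.
Proof.
move=> c1 c0; have [dc cdc] := curve_coord c1.
have cc i : continuous (fun t => c t 0 i).
  move=> t; apply: differentiable_continuous; apply/derivable1_diffP.
  by have [] := dc t i.
pose sp t := Num.sqrt (hform (c t) (derive1 c t)).
have cform : continuous (fun t => hform (c t) (derive1 c t)).
  rewrite (_ : (fun t => _) = (fun t =>
    sinhc (dotv (c t) (c t)) * sinhc (dotv (c t) (c t)) *
      dotv (derive1 c t) (derive1 c t) -
    (sinhc (dotv (c t) (c t)) + 1) * sinhc_quot (dotv (c t) (c t)) *
      (dotv (c t) (derive1 c t) * dotv (c t) (derive1 c t)))); last first.
    by apply/funext => t; rewrite hyperbolic_formE !expr2.
  have cq : continuous (fun t => dotv (c t) (c t)) by exact: continuous_dotv.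
  have cb : continuous (fun t => dotv (c t) (derive1 c t)).
    exact: continuous_dotv.
  have cS t : {for t, continuous (fun t => sinhc (dotv (c t) (c t)))}.
    apply: (@continuous_comp _ _ _ (fun t => dotv (c t) (c t)) sinhc _ (cq t)).
    exact/continuous_power_series/fact_coef_dominated.
  have cT t : {for t, continuous (fun t => sinhc_quot (dotv (c t) (c t)))}.
    apply: (@continuous_comp _ _ _ (fun t => dotv (c t) (c t)) sinhc_quot _ (cq t)).
    exact/continuous_power_series/fact_coef_dominated.
  move=> t; apply: cvgB; apply: cvgM.
  - by apply: cvgM; exact: cS.
  - exact: continuous_dotv.
  - apply: cvgM; last exact: cT.
    by apply: cvgD; [exact: cS | exact: cvg_cst].
  - by apply: cvgM; exact: cb.
have csp : continuous sp.
  move=> t.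
  apply: (@continuous_comp _ _ _ (fun t => hform (c t) (derive1 c t)) Num.sqrt).
    exact: cform.
  exact: sqrt_continuous.
apply/ler_addgt0Pr => e e0.
(* [enorm] is not differentiable at the pole, but this majorant is. *)
pose h t := Num.sqrt (e ^+ 2 + dotv (c t) (c t)).
have h0 t : 0 < e ^+ 2 + dotv (c t) (c t).
  by rewrite ltr_wpDr ?dotv_ge0 ?exprn_gt0.
have dh (t : R) : is_derive t 1 h ((h t)^-1 * dotv (c t) (derive1 c t)).
  have dq : is_derive t 1 (fun t => dotv (c t) (c t))
      (2 * dotv (c t) (derive1 c t)).
    rewrite /dotv (_ : (fun t => _) =
      \sum_(i < n) (fun t => c t 0 i * c t 0 i)); last first.
      by apply/funext => y; rewrite fct_sumE.
    rewrite mulr_sumr.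
    apply: is_derive_sum => i.
    apply: (is_derive_eq (is_derive_mul (dc t i) (dc t i))); ring.
  refine (is_derive_eq (@is_derive_sqrtf _ _
    (fun t => e ^+ 2 + dotv (c t) (c t)) t 1 _ (h0 t)
    (is_derive_add (is_derive_const (e ^+ 2) t 1) dq)) _).
  by rewrite -/(h t) add0r; field; rewrite gt_eqF// sqrtr_gt0 h0.
have h_gt0 t : 0 < h t by rewrite sqrtr_gt0 h0.
have ch t : {for t, continuous h}.
  apply: differentiable_continuous; apply/derivable1_diffP.
  by have [] := dh t.
pose dh' t := (h t)^-1 * dotv (c t) (derive1 c t).
have cdh : continuous dh'.
  move=> t; apply: cvgM; last exact: continuous_dotv.
  by apply: cvgV; [rewrite gt_eqF | exact: ch].
have le_speed t : dh' t <= sp t.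
  rewrite /dh' ler_pdivrMl// (le_trans (ler_norm _))// -sqrtr_sqr.
  rewrite /h /sp -sqrtrM ?(ltW (h0 t))// ler_wsqrtr//.
  apply: le_trans (sqr_dotv_le_form _ _) _.
  by rewrite ler_wpM2r ?hyperbolic_form_ge0// lerDr sqr_ge0.
have integrable01 (f : R -> R) : continuous f -> mu.-integrable `[0, 1] (EFin \o f).
  move=> cf; apply: continuous_compact_integrable; first exact: segment_compact.
  exact: continuous_subspaceT.
have ftc : \int[mu]_(t in `[0, 1]) dh' t = h 1 - h 0.
  rewrite /Rintegral (@continuous_FTC2 _ dh' h)//.
  - exact: continuous_subspaceT.
  - split=> [t _||].
    + by have [] := dh t.
    + exact/cvg_at_right_filter/ch.
    + exact/cvg_at_left_filter/ch.
  - by move=> t _; rewrite derive1E; have [_ ->] := dh t.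
have h00 : h 0 = e.
  rewrite /h c0 (_ : dotv 0 0 = 0) ?addr0 ?sqrtr_sqr ?gtr0_norm//.
  by apply/eqP; rewrite dotv_eq0.
have h11 : enorm (c 1) <= h 1 by rewrite ler_wsqrtr// lerDr sqr_ge0.
apply: (le_trans h11); rewrite -lerBlDr -{1}h00 -ftc.
by apply: le_Rintegral => //; [exact: integrable01 | exact: integrable01].
Qed.

(** The lower bound is attained by the radial segment. *)
Lemma hyperbolic_distance_pole x : hyperbolic_distance pole x = enorm x.
Proof.
rewrite /hyperbolic_distance /riemannian_distance; set A := [set l | _].
have lbA : lbound A (enorm x).
  by move=> l [c [cc c0 <- ->]]; exact: enorm_le_curve_length.
have Ax : A (enorm x).
  have dZ (t : R) : is_derive t 1 (fun t : R => t *: x) x.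
    have e i j : is_derive t 1 (fun t => (t *: x) i j) (x i j).
      rewrite (_ : (fun t => _) = (fun t => x i j * t)); last first.
        by apply/funext => s; rewrite mxE mulrC.
      refine (is_derive_eq (is_derive_mulC (x i j) (is_derive_id t 1)) _).
      by rewrite mulr1.
    have d : derivable (fun t : R => t *: x) t 1.
      by apply/derivable_mxP => i j; have [] := e i j.
    apply: DeriveDef => //; rewrite derive_mx//; apply/matrixP => i j.
    by rewrite mxE; have [_ ->] := e i j.
  have d1 : derive1 (fun t : R => t *: x) = cst x.
    by apply/funext => t; rewrite derive1E; have [_ ->] := dZ t.
  exists (fun t => t *: x); split.
  - split; first by move=> t; have [] := dZ t.
    by rewrite d1; exact: cst_continuous.
  - by rewrite scale0r.
  - by rewrite scale1r.
  - rewrite /curve_length d1.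
    under eq_Rintegral do rewrite -/(hform _ _) hyperbolic_form_radial.
    rewrite Rintegral_cst//= lebesgue_measure_itv /= lte_fin ltr01.
    by rewrite oppr0 adde0 mulr1.
apply/eqP; rewrite eq_le; apply/andP; split.
  by apply: ge_inf => //; exists (enorm x).
by apply: lb_le_inf => //; exists (enorm x).
Qed.
End DistanceToPole.

(** * From the martingale problem to Dynkin's formula *)

Section Paths.
Context {R : realType} {d : measure_display} {T : measurableType d}.
Variable P : probability T R.
Implicit Types (u : R -> T -> R).
Local Notation mu := (@lebesgue_measure R).

Lemma measurable_fun_open_preimage (f : T -> R) :
  (forall U : set R, open U -> measurable (f @^-1` U)) -> measurable_fun setT f.
Proof.
move=> fo; apply: (measurability _ (RGenOInfty.measurableE R)).
by move=> _ [_ [x ->] <-]; rewrite setTI; apply: fo; exact: interval_open.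
Qed.

(** A process with continuous paths is the limit of the step processes obtained
    by sampling it on the grids [k / (n + 1)], and these are jointly measurable. *)
Lemma measurable_fun_continuous_paths u :
  (forall s, measurable_fun setT (u s)) ->
  (forall s w, s <= 0 -> u s w = u 0 w) ->
  (forall w, continuous (u^~ w)) ->
  measurable_fun setT (fun p : T * R => u p.2 p.1).
Proof.
move=> mu_u u0 cu.
pose k n (s : R) : nat := Num.truncn (s * n.+1%:R).
pose un n (p : T * R) := u ((k n p.2)%:R / n.+1%:R) p.1.
apply: (@measurable_fun_cvg _ _ _ setT un) => [n|[w s] _].
  move=> _ B mB; rewrite setTI.
  have -> : un n @^-1` B = \bigcup_j
      ((u (j%:R / n.+1%:R) @^-1` B) `*` [set s | k n s = j]).
    apply/seteqP; split => [[w s] /= h|[w s] [j _ [/= h kj]]].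
      by exists (k n s).
    by rewrite /un /preimage /= kj.
  apply: bigcupT_measurable => j; apply: measurableX.
    by rewrite -[X in measurable X]setTI; exact: mu_u.
  have -> : [set s | k n s = j] = [set s | (k n s <= j)%N] `\`
      [set s | (k n s < j)%N].
    apply/seteqP; split => s /=; first by move=> ->; rewrite leqnn ltnn.
    by move=> [h1 /negP]; rewrite -leqNgt => h2; apply/eqP; rewrite eqn_leq h1.
  have mle i : measurable [set s | (k n s <= i)%N].
    have -> : [set s | (k n s <= i)%N] = `]-oo, (i.+1%:R / n.+1%:R)[%classic.
      apply/seteqP; split => s /=; rewrite in_itv /= truncn_le_nat;
      by rewrite ltr_pdivlMr.
    exact: measurable_itv.
  apply: measurableD => //; case: j => [|j].
    by rewrite (_ : [set _ | _] = set0)//; apply/seteqP; split.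
  exact: mle.
have [s0|s0] := leP s 0.
  have -> : un^~ (w, s) = cst (u s w); last exact: cvg_cst.
  apply/funext => n; rewrite /un /k /= (u0 s)//.
  have -> : Num.truncn (s * n.+1%:R) = 0%N.
    apply/eqP; rewrite -leqn0 truncn_le_nat (le_lt_trans _ ltr01)//.
    by rewrite mulr_le0_ge0.
  by rewrite mul0r.
have grid : (fun n => (k n s)%:R / n.+1%:R) @ \oo --> s.
  apply/cvgrPdist_le => e e0; near=> n.
  have n0 : 0 < n.+1%:R :> R by [].
  have /andP[h1 h2] : (k n s)%:R <= s * n.+1%:R < (k n s).+1%:R.
    by apply: truncn_itv; rewrite mulr_ge0// ltW.
  rewrite ger0_norm; last by rewrite subr_ge0 ler_pdivrMr.
  rewrite lerBlDr -lerBlDl ler_pdivlMr// mulrBl.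
  have : 1 <= e * n.+1%:R.
    rewrite -ler_pdivrMl// mulr1 -natr1 ler_wpDr//; near: n.
    exact: nbhs_infty_ger.
  by move: h2; rewrite -natr1; lra.
exact: (cvg_comp _ _ grid (cu w s)).
Unshelve. all: by end_near. Qed.

(** The bound [K] makes [u] integrable on the product, where it is multiplied by
    the indicator of [[a, b]]. *)
Lemma fubini_paths u (K a b : R) : a <= b ->
  measurable_fun setT (fun p : T * R => u p.2 p.1) ->
  (forall s w, `|u s w| <= K) ->
  [/\ P.-integrable setT (EFin \o (fun w => \int[mu]_(s in `[a, b]) u s w)),
      mu.-integrable `[a, b] (EFin \o (fun s => \int[P]_w u s w)) &
      \int[P]_w (\int[mu]_(s in `[a, b]) u s w) =
      \int[mu]_(s in `[a, b]) (\int[P]_w u s w)].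
Proof.
move=> ab mu_u uK.
pose f (p : T * R) : \bar R := (u p.2 p.1 * \1_`[a, b] p.2)%:E.
have m1 (w : T) : measurable_fun setT (u^~ w).
  exact: (measurable_fun_pair2 w mu_u).
have m2 (s : R) : measurable_fun setT (u s).
  exact: (measurable_fun_pair1 s mu_u).
have mf : measurable_fun setT f.
  apply/measurable_EFinP; apply: measurable_funM => //.
  exact: measurableT_comp.
have restr (w : T) (s : R) : f (w, s) = ((EFin \o u^~ w) \_ `[a, b]) s.
  by rewrite /f patchE indicE /=; case: ifP => _; rewrite ?mulr1 ?mulr0.
have mab : measurable (`[a, b]%classic : set R) by exact: measurable_itv.
have K0 : 0 <= K by rewrite (le_trans _ (uK 0 point)).
have muab : mu `[a, b]%classic = (b - a)%:E.
  rewrite lebesgue_measure_itv /= lte_fin; case: ltP => // ba.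
  by rewrite (@le_anti _ _ a b) ?ab// subrr.
have imf : (P \x mu)%E.-integrable setT f.
  apply/integrable12ltyP => //.
  apply: (@le_lt_trans _ _ (\int[P]_w (K * (b - a))%:E)%E); last first.
    by rewrite integral_cst//= probability_setT mule1 ltry.
  apply: ge0_le_integral => //.
  - by move=> w _; exact: integral_ge0.
  - have mabs : measurable_fun setT (abse \o f) by exact: measurableT_comp.
    exact: (measurable_fun_fubini_tonelli_F (m2 := mu) _ mabs
      (fun=> abse_ge0 _)).
  move=> w _; apply: (@le_trans _ _ (\int[mu]_s (K%:E * (\1_`[a, b] s)%:E))%E).
    apply: ge0_le_integral => //.
    - by apply: measurableT_comp => //; exact: (measurable_fun_pair2 w mf).
    - by apply: emeasurable_funM => //; apply/measurable_EFinP.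
    move=> s _; rewrite /f /= -EFinM lee_fin normrM ler_pM//.
    by rewrite ger0_norm.
  rewrite ge0_integralZl//; last exact/measurable_EFinP.
  by rewrite integral_indic// setIT /= muab -EFinM.
have eF w : (\int[mu]_s f (w, s))%E = (\int[mu]_(s in `[a, b]) (u s w)%:E)%E.
  by rewrite [RHS]integral_mkcond; apply: eq_integral => s _; exact: restr.
have bnd1 w : mu.-integrable `[a, b] (EFin \o u^~ w).
  apply: measurable_bounded_integrable => //.
  - by rewrite /= muab ltry.
  - exact: (measurable_funS measurableT (@subsetT _ _) (m1 w)).
  - by exists K; split; [exact: num_real | move=> x Kx y _; apply: (le_trans (uK _ _)); exact: ltW].
have bnd2 s : P.-integrable setT (EFin \o u s).
  apply: measurable_bounded_integrable => //.
  - by rewrite (le_lt_trans (probability_le1 _ _))// ltry.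
  - by exists K; split; [exact: num_real | move=> x Kx y _; apply: (le_trans (uK _ _)); exact: ltW].
have eF' w : (\int[mu]_s f (w, s))%E = (\int[mu]_(s in `[a, b]) u s w)%:E.
  by rewrite eF /Rintegral fineK//; apply: integrable_fin_num => //; exact: bnd1.
have eG s : (\int[P]_w f (w, s))%E =
    ((EFin \o (fun s => \int[P]_w u s w)) \_ `[a, b]) s.
  rewrite patchE; case: ifP => sab; last first.
    rewrite integral0_eq// => w _; by rewrite restr patchE sab.
  under eq_integral do rewrite restr patchE sab.
  by rewrite /= /Rintegral fineK//; apply: integrable_fin_num => //; exact: bnd2.
have iF := integrable_fubini_F imf.
split.
- by apply: eq_integrable iF => // w _; rewrite /fubini_F eF'.
- apply: measurable_bounded_integrable => //.
  + by rewrite /= muab ltry.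
  + apply/measurable_EFinP/(measurable_restrictT _ mab).
    rewrite (_ : _ \_ _ = fubini_G P f); first exact: measurable_fubini_G imf.
    by apply/funext => s; rewrite /fubini_G eG.
  + exists K; split; [exact: num_real | move=> x Kx s _ /=].
    apply: le_trans (ltW Kx); apply: le_trans (le_normr_Rintegral _ (bnd2 s)) _ => //.
    rewrite (@le_trans _ _ (\int[P]_w K))//; last first.
      by rewrite Rintegral_cst//= probability_setT mulr1.
    apply: le_Rintegral => //.
      exact: (integrable_abse (bnd2 s)).
    exact: finite_measure_integrable_cst.
- have := Fubini imf.
  under eq_integral do rewrite eF'.
  under [X in _ = X -> _]eq_integral do rewrite eG.
  by rewrite -integral_mkcond /Rintegral => ->.
Qed.

End Paths.

Section Dynkin.
Context {R : realType} {dO : measure_display} {Omega : measurableType dO}.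
Context {d : nat} {X : R -> Omega -> 'rV[R]_d}.
Context {P : 'rV[R]_d -> probability Omega R}.
Hypothesis hX : hyperbolic_brownian_motion X P.
Implicit Types (f g : 'rV[R]_d -> R) (s a b K L : R).
Local Notation mu := (@lebesgue_measure R).

Definition mean s f : R := \int[P pole]_w f (X s w).

Lemma measurable_observable s f : 0 <= s -> continuous f ->
  measurable_fun setT (fun w => f (X s w)).
Proof.
move=> s0 /continuousP cf; apply: measurable_fun_open_preimage => U oU.
exact: (diffusion_measurable hX s0 (cf _ oU)).
Qed.

Lemma integrable_observable s f K : 0 <= s -> continuous f ->
  (forall x, `|f x| <= K) -> (P pole).-integrable setT (EFin \o (fun w => f (X s w))).
Proof.
move=> s0 cf fK; apply: measurable_bounded_integrable => //.
- by rewrite (le_lt_trans (probability_le1 _ _))// ltry.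
- exact: measurable_observable.
- by exists K; split; [exact: num_real | move=> y Ky w _; exact: le_trans (fK _) (ltW Ky)].
Qed.

Lemma mean_pole f : continuous f -> mean 0 f = f pole.
Proof.
move=> cf; rewrite /mean /Rintegral.
have start := diffusion_start hX pole.
have m0 := measurable_observable (lexx 0) cf.
set A := [set w | X 0 w = pole] in start.
have mA : measurable A.
  rewrite -[A]setCK; apply: measurableC.
  rewrite (_ : ~` A = X 0 @^-1` (~` [set pole])) //.
  apply: (diffusion_measurable hX (lexx 0)).
  apply: closed_openC; apply: accessible_closed_set1.
  by apply: hausdorff_accessible; exact: norm_hausdorff.
have -> : (\int[P pole]_w (f (X 0 w))%:E = \int[P pole]_w (f pole)%:E)%E.
  apply: ae_eq_integral => //; first exact/measurable_EFinP.
  exists (~` A); split; first exact: measurableC.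
    by have h := probability_setC (P pole) mA; rewrite start subee in h.
  by move=> w /= h Aw; apply: h => _; rewrite Aw.
by rewrite integral_cst//= probability_setT mule1.
Qed.

(** Paths are frozen at negative times, where nothing is known about [X]. *)
Let path_ext g s w : R := g (X (Num.max s 0) w).

Let continuous_path_ext g : continuous g -> forall w, continuous ((path_ext g)^~ w).
Proof.
move=> cg w s.
apply: (@continuous_comp _ _ _ (fun s => X (Num.max s 0) w) g); last exact: cg.
have /subspace_continuousP cX := @diffusion_continuous _ _ _ _ _ _ _ hX w.
have c0 (y : R) : `[0, +oo[%classic (Num.max y 0).
  by rewrite /= in_itv /= andbT le_max lexx orbT.
apply: (cvg_comp _ _ _ (cX _ (c0 s))).
move=> U; rewrite /within /= => hU.
have cmax : continuous (fun s : R => Num.max s 0).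
  by move=> y; apply: continuous_max; [exact: cvg_id|exact: cvg_cst].
have h : nbhs s (fun y => Num.max y 0 \in `[0, +oo[ -> U (Num.max y 0)).
  exact: cmax s _ hU.
suff : nbhs s (fun y => U (Num.max y 0)) by [].
by apply: filterS h => y; apply; exact: c0.
Qed.

(** The expectation of the martingale is constant; the exchange of expectation
    and time integral needs boundedness of [f] and of its image under the
    generator. *)
Lemma dynkin f K K' a b : test_function f -> continuous f ->
  let g := fun x => hyperbolic_laplacian f x / 2 in
  (forall x, `|f x| <= K) -> continuous g -> (forall x, `|g x| <= K') ->
  0 <= a <= b ->
  mu.-integrable `[a, b] (EFin \o (fun s => mean s g)) /\
  mean b f - mean a f = \int[mu]_(s in `[a, b]) mean s g.
Proof.
move=> tf cf g fK cg gK /andP[a0 ab].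
have b0 := le_trans a0 ab.
pose u := path_ext g.
have mu_u : measurable_fun setT (fun p : Omega * R => u p.2 p.1).
  apply: measurable_fun_continuous_paths.
  - move=> s; apply: measurable_observable => //.
    by rewrite le_max lexx orbT.
  - by move=> s w s0; rewrite /u /path_ext maxxx max_r.
  - exact: continuous_path_ext.
have uK s w : `|u s w| <= K' by exact: gK.
have uE s w : 0 <= s -> u s w = g (X s w).
  by move=> s0; rewrite /u /path_ext max_l.
have eu t w : \int[mu]_(s in `[0, t]) g (X s w) = \int[mu]_(s in `[0, t]) u s w.
  apply: eq_Rintegral => s; rewrite inE /= in_itv /= => /andP[s0 _].
  by rewrite uE.
have mean_u s : 0 <= s -> \int[P pole]_w u s w = mean s g.
  by move=> s0; apply: eq_Rintegral => w _; rewrite uE.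
have em c t : 0 <= c -> \int[mu]_(s in `[c, t]) (\int[P pole]_w u s w) =
    \int[mu]_(s in `[c, t]) mean s g.
  move=> c0; apply: eq_Rintegral => s; rewrite inE /= in_itv /= => /andP[s0 _].
  by rewrite mean_u// (le_trans c0 s0).
have [imart _ mart] := diffusion_martingale hX pole tf.
have meanM t : 0 <= t -> \int[P pole]_w (f (X t w) - f (X 0 w) -
    \int[mu]_(s in `[0, t]) g (X s w)) =
    mean t f - mean 0 f - \int[mu]_(s in `[0, t]) mean s g.
  move=> t0; have [iI _ eI] := fubini_paths (P pole) t0 mu_u uK.
  under eq_Rintegral do rewrite eu.
  have it := integrable_observable t0 cf fK.
  have i0 := integrable_observable (lexx 0) cf fK.
  rewrite (RintegralB measurableT (integrableB measurableT it i0) iI).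
  congr (_ - _); first exact: (RintegralB measurableT it i0).
  by apply: (etrans eI); exact: em.
have hT : natural_filtration X a setT.
  exact: (@measurableT _ (g_sigma_algebraType _)).
have := mart a b setT; rewrite a0 ab => /(_ isT hT); rewrite !meanM// => e.
have [_ ib _] := fubini_paths (P pole) b0 mu_u uK.
have [_ iab _] := fubini_paths (P pole) ab mu_u uK.
have mean_int c t : 0 <= c ->
    mu.-integrable `[c, t] (EFin \o (fun s => \int[P pole]_w u s w)) ->
    mu.-integrable `[c, t] (EFin \o (fun s => mean s g)).
  move=> c0; apply: eq_integrable; first exact: measurable_itv.
  move=> s sc.
  have s0 : 0 <= s.
    move: sc; rewrite inE /= in_itv /= => /andP[cs _]; exact: le_trans cs.
  exact: (congr1 EFin (mean_u s s0)).
have iab' := mean_int _ _ a0 iab.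
split=> //.
have ib' := mean_int _ _ (lexx 0) ib.
have split_int := @Rintegral_itvB _ (fun s => mean s g) (BLeft 0) (BRight b) a ib'.
rewrite -Rintegral_itv_obnd_cbnd; last first.
  apply: integrableS iab' => //.
  by apply: subset_itvr; rewrite bnd_simp.
rewrite -split_int ?bnd_simp//.
by move: e; lra.
Qed.

End Dynkin.

(** * Means of radial functions along the process *)

Section RadialProfiles.
Context {R : realType}.
Implicit Types (s t z a b K : R).

(** A function on the plane is differentiated along one of its coordinate lines
    as a function of one variable. *)
Lemma is_derive_line {n : nat} (U : 'rV[R]_n -> R) (c : R -> 'rV[R]_n) s
    (e : 'rV[R]_n) dU :
  (forall h, c (h + s) = h *: e + c s) -> is_derive (c s) e U dU ->
  is_derive s 1 (U \o c) dU.
Proof.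
move=> ce [+ <-]; rewrite /derivable => dU1.
have q : (fun h => h^-1 *: (((U \o c) \o shift s) (h *: 1) - (U \o c) s)) =
         (fun h => h^-1 *: ((U \o shift (c s)) (h *: e) - U (c s))).
  by apply/funext => h /=; rewrite -ce [h *: 1]mulr1.
by apply: DeriveDef; rewrite /derivable /derive q.
Qed.

(** Functions of time [s] and of [z = cosh r] are functions on the plane. *)
Definition pt s z : 'rV[R]_2 := \row_j (if j == 0 then s else z).

Lemma pt0 s z : pt s z 0 0 = s. Proof. by rewrite mxE. Qed.
Lemma pt1 s z : pt s z 0 1 = z. Proof. by rewrite mxE. Qed.

Let pt_shift_s s z h : pt (h + s) z = h *: (delta_mx 0 0 : 'rV[R]_2) + pt s z.
Proof.
apply/rowP => j; rewrite !mxE /=; case: (j == 0); first by rewrite mulr1.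
by rewrite mulr0 add0r.
Qed.

Let pt_shift_z s z h : pt s (h + z) = h *: (delta_mx 0 1 : 'rV[R]_2) + pt s z.
Proof.
apply/rowP => j; rewrite !mxE /=.
by case: j => [[|[|//]] //=] _; rewrite ?mulr0 ?add0r ?mulr1.
Qed.

Variables (d : nat) (T0 z0 : R).
Hypothesis z0_lt1 : z0 < 1.

(** The lower bound [z0 < 1] gives room around [z = 1], so that smoothness of a
    profile includes its behaviour at the pole. *)
Definition profile_domain : set 'rV[R]_2 := [set p | p 0 0 < T0 /\ z0 < p 0 1].
Local Notation D := profile_domain.

Lemma open_profile_domain : open D.
Proof.
have -> : D = (fun p : 'rV[R]_2 => p 0 0) @^-1` [set x | x < T0] `&`
              (fun p : 'rV[R]_2 => p 0 1) @^-1` [set x | z0 < x].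
  by apply/seteqP; split => p.
apply: openI; apply: open_comp; [|exact: open_lt| |exact: open_gt].
- by move=> p _; exact: coord_continuous.
- by move=> p _; exact: coord_continuous.
Qed.

Lemma profile_domain_pt s z : s < T0 -> 1 <= z -> D (pt s z).
Proof.
by move=> sT z1; split; rewrite ?pt0 ?pt1//; exact: lt_le_trans z0_lt1 z1.
Qed.

Definition dt (U : 'rV[R]_2 -> R) := partial 0 U.
Definition dz (U : 'rV[R]_2 -> R) := partial 1 U.

(** Half the Laplacian in the variable [z = cosh r]. *)
Definition gen (U : 'rV[R]_2 -> R) (p : 'rV[R]_2) : R :=
  ((p 0 1 ^+ 2 - 1) * dz (dz U) p + d%:R * p 0 1 * dz U p) / 2.

Lemma smooth_on_partial {n : nat} (D' : set 'rV[R]_n) i U :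
  smooth_on D' U -> smooth_on D' (partial i U).
Proof. by move=> sU k; exact: (sU k.+1).2.2. Qed.

Lemma smooth_on_gen U : smooth_on D U -> smooth_on D (gen U).
Proof.
move=> sU; have oD := open_profile_domain.
have sz := smooth_on_coord oD 1.
have sU1 : smooth_on D (dz U) by exact: smooth_on_partial.
have sU2 : smooth_on D (dz (dz U)) by exact: smooth_on_partial.
apply: smooth_onM => //; last exact: smooth_on_cst.
apply: smooth_onD => //; apply: smooth_onM => //.
  by apply: smooth_onB => //; [exact: smooth_onX | exact: smooth_on_cst].
by apply: smooth_onM => //; exact: smooth_on_cst.
Qed.

Lemma is_derive_dt U s z : smooth_on D U -> D (pt s z) ->
  is_derive s 1 (fun s => U (pt s z)) (dt U (pt s z)).
Proof.
move=> sU Dp; apply: (@is_derive_line _ U (fun s => pt s z) s (delta_mx 0 0)).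
  by move=> h; exact: pt_shift_s.
by apply: derivableP; exact: (sU 1%N).2.1.
Qed.

Lemma is_derive_dz U s z : smooth_on D U -> D (pt s z) ->
  is_derive z 1 (fun z => U (pt s z)) (dz U (pt s z)).
Proof.
move=> sU Dp; apply: (@is_derive_line _ U (fun z => pt s z) z (delta_mx 0 1)).
  by move=> h; exact: pt_shift_z.
by apply: derivableP; exact: (sU 1%N).2.1.
Qed.

(** Constancy for large [z] replaces compactness of the support: a constant may
    be subtracted without changing the martingale problem. *)
Definition eventually_constant (U : 'rV[R]_2 -> R) z1 :=
  forall s z, s < T0 -> z1 <= z -> U (pt s z) = U (pt s z1).

Lemma eventually_constant_dt U z1 : 1 <= z1 -> smooth_on D U ->
  eventually_constant U z1 -> eventually_constant (dt U) z1.
Proof.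
move=> z11 sU cU s z sT z1z.
have [_ <-] := is_derive_dt sU (profile_domain_pt sT z11).
have [_ <-] := is_derive_dt sU (profile_domain_pt sT (le_trans z11 z1z)).
apply: near_eq_derive.
have : nbhs s [set x | x < T0] by apply: open_nbhs_nbhs; split => //; exact: open_lt.
by apply: filterS => y yT; exact: cU.
Qed.

Lemma dz_eventually0 U z1 s z : 1 <= z1 -> smooth_on D U ->
  eventually_constant U z1 -> s < T0 -> z1 < z -> dz U (pt s z) = 0.
Proof.
move=> z11 sU cU sT z1z.
have z1' : 1 <= z by rewrite (le_trans z11)// ltW.
have [_ <-] := is_derive_dz sU (profile_domain_pt sT z1').
rewrite (@near_eq_derive _ _ _ _ (cst (U (pt s z1)))) ?derive_cst//.
have : nbhs z [set x | z1 < x] by apply: open_nbhs_nbhs; split => //; exact: open_gt.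
by apply: filterS => y z1y; apply: cU => //; exact: ltW.
Qed.

Lemma dzz_eventually0 U z1 s z : 1 <= z1 -> smooth_on D U ->
  eventually_constant U z1 -> s < T0 -> z1 < z -> dz (dz U) (pt s z) = 0.
Proof.
move=> z11 sU cU sT z1z.
have z1' : 1 <= z by rewrite (le_trans z11)// ltW.
have sdU : smooth_on D (dz U) by exact: smooth_on_partial.
have [_ <-] := is_derive_dz sdU (profile_domain_pt sT z1').
rewrite (@near_eq_derive _ _ _ _ (cst 0)) ?derive_cst//.
have : nbhs z [set x | z1 < x] by apply: open_nbhs_nbhs; split => //; exact: open_gt.
by apply: filterS => y z1y; exact: (dz_eventually0 z11).
Qed.

Lemma gen_eventually0 U z1 s z : 1 <= z1 -> smooth_on D U ->
  eventually_constant U z1 -> s < T0 -> z1 < z -> gen U (pt s z) = 0.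
Proof.
move=> z11 sU cU sT z1z.
by rewrite /gen (dzz_eventually0 z11 sU cU sT z1z) (dz_eventually0 z11 sU cU sT z1z)
  !mulr0 addr0 mul0r.
Qed.

Lemma eventually_constant_gen U z1 : 1 <= z1 -> smooth_on D U ->
  eventually_constant U z1 -> eventually_constant (gen U) (z1 + 1).
Proof.
move=> z11 sU cU s z sT zz1.
by rewrite !(gen_eventually0 z11)// ?ltrDl// (lt_le_trans _ zz1)// ltrDl.
Qed.

Lemma eventually_constant_bounded U z1 a b : 1 <= z1 -> b < T0 ->
  smooth_on D U -> eventually_constant U z1 ->
  exists2 K, 0 < K & forall s z, a <= s <= b -> 1 <= z -> `|U (pt s z)| <= K.
Proof.
move=> z11 bT sU cU.
pose A := [set p : 'rV[R]_2 | forall i,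
  (if i == 0 then `[a, b] else `[1, z1])%classic (p ord0 i)].
have cA : compact A.
  apply: (@rV_compact R 2
    (fun i => if i == 0 then `[a, b]%classic else `[1, z1]%classic)).
  by move=> i; case: ifP => _; exact: segment_compact.
have cU' : {within A, continuous U}.
  apply: continuous_in_subspaceT => p; rewrite inE => Ap.
  have Dp : D p.
    split; last first.
      have := Ap 1; rewrite /= in_itv /= => /andP[h _].
      exact: lt_le_trans z0_lt1 h.
    have := Ap 0; rewrite /= in_itv /= => /andP[_ h].
    exact: le_lt_trans bT.
  exact: (smooth_upto_continuous (sU 0%N) Dp).
have /ex_strict_bound_gt0[K K0 hK] : bounded_set (U @` A).
  exact/compact_bounded/continuous_compact.
have inA s z : a <= s <= b -> 1 <= z <= z1 -> `|U (pt s z)| <= K.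
  move=> sab zz; apply/ltW/hK; exists (pt s z) => // i.
  by rewrite mxE; case: ifP => _; rewrite /= in_itv.
exists K => // s z sab z1'; have [zz1|/ltW zz1] := leP z z1.
  by apply: inA => //; rewrite z1'.
have sT : s < T0 by case/andP: sab => _ sb; exact: le_lt_trans bT.
by rewrite cU//; apply: inA => //; rewrite z11 lexx.
Qed.

Lemma smooth_on_profile (n : nat) U s (D' : set 'rV[R]_n) (f : 'rV[R]_n -> R) :
  open D' -> s < T0 -> (forall x, D' x -> 1 <= f x) ->
  smooth_on D U -> smooth_on D' f -> smooth_on D' (fun x => U (pt s (f x))).
Proof.
move=> oD' sT f1 sU sf k; elim: k U sU => [|k IH] U sU.
  apply: (@smooth_upto_comp0 _ _ D' f (fun z => U (pt s z)) (fun z => dz U (pt s z))).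
    by move=> x Dx; apply: is_derive_dz => //; apply: profile_domain_pt => //; exact: f1.
  exact: sf 0%N.
apply: (@smooth_upto_comp _ _ D' oD' k f (fun z => U (pt s z)) (fun z => dz U (pt s z))).
- by move=> x Dx; apply: is_derive_dz => //; apply: profile_domain_pt => //; exact: f1.
- by apply: IH; exact: smooth_on_partial.
- exact: sf.
Qed.

End RadialProfiles.

Section TimeDependent.
Context {R : realType} {dO : measure_display} {Omega : measurableType dO}.
Context {d : nat} {X : R -> Omega -> 'rV[R]_d}.
Context {P : 'rV[R]_d -> probability Omega R}.
Hypothesis hX : hyperbolic_brownian_motion X P.
Variables (T0 z0 : R).
Hypothesis z0_lt1 : z0 < 1.
Implicit Types (s t z a b K : R) (U V : 'rV[R]_2 -> R).
Local Notation mu := (@lebesgue_measure R).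
Local Notation D := (profile_domain T0 z0).
Local Notation gen := (gen d).

Definition radial_profile U s (x : 'rV[R]_d) : R := U (pt s (cosh_dist x)).

Lemma smooth_radial_profile U s : s < T0 -> smooth_on D U ->
  smooth_on setT (radial_profile U s).
Proof.
move=> sT sU; apply: (smooth_on_profile z0_lt1 openT sT _ sU).
  by move=> x _; exact: cosh_dist_ge1.
exact/smooth_on_cosh_dist/openT.
Qed.

Lemma continuous_radial_profile U s : s < T0 -> smooth_on D U ->
  continuous (radial_profile U s).
Proof.
move=> sT sU x.
exact: (smooth_upto_continuous (smooth_radial_profile sT sU 0%N)).
Qed.

Lemma closed_cosh_dist_le z1 : closed [set x : 'rV[R]_d | cosh_dist x <= z1].
Proof.
rewrite (_ : [set _ | _] = cosh_dist @^-1` [set y | y <= z1])//.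
apply: closed_comp; last exact: closed_le.
move=> x _; exact: (smooth_upto_continuous (smooth_on_cosh_dist openT 0%N)).
Qed.

Lemma compact_cosh_dist_le z1 : compact [set x : 'rV[R]_d | cosh_dist x <= z1].
Proof.
apply: bounded_closed_compact; last exact: closed_cosh_dist_le.
exists (2 * z1); split; first exact: num_real.
move=> M zM x /= xz1; apply: le_trans (ltW zM).
have e : enorm x <= 2 * z1.
  have h1 := cosh_dist_sum x; have := expR_ge1Dx (enorm x).
  have h2 : sinh (enorm x) <= cosh_dist x.
    have hp := cosh_sq_sqr (- enorm x).
    have := expR_ge0 (- enorm x); rewrite -hp sqrrN mulNr sinhc_sqr enorm_sqr.
    by rewrite subr_ge0.
  lra.
apply: le_trans e.
rewrite [leLHS]/Num.Def.normr/= mx_normrE (bigmax_le _ (sqrtr_ge0 _))//= => -[i j] _.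
rewrite ord1 -sqrtr_sqr ler_wsqrtr//= /dotv (bigD1 j)//= -expr2 lerDl.
by apply: sumr_ge0 => l _; rewrite -expr2 sqr_ge0.
Qed.

Lemma test_function_profile U s z1 : s < T0 -> smooth_on D U ->
  eventually_constant T0 U z1 ->
  test_function (fun x => radial_profile U s x - U (pt s z1)).
Proof.
move=> sT sU cU; split.
  move=> k; apply: smooth_upto_Ck; apply: (smooth_onB openT) => //.
    exact: smooth_radial_profile.
  exact: (smooth_on_cst openT).
apply: (@subclosed_compact _ _ [set x : 'rV[R]_d | cosh_dist x <= z1]).
- exact: closed_closure.
- exact: compact_cosh_dist_le.
rewrite [X in _ `<=` X]((closure_id _).1 (@closed_cosh_dist_le z1)).
apply: closure_subset => x /= h; rewrite leNgt; apply/negP => /ltW zz.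
by move: h; rewrite /radial_profile cU// subrr eqxx.
Qed.

Lemma laplacian_profile U s c x : s < T0 -> smooth_on D U ->
  hyperbolic_laplacian (fun x => radial_profile U s x - c) x / 2 =
  radial_profile (gen U) s x.
Proof.
move=> sT sU.
have sdU : smooth_on D (dz U) by exact: smooth_on_partial.
have d1 (z : R) : 1 <= z ->
    is_derive z 1 (fun z => U (pt s z) - c) (dz U (pt s z)).
  move=> z1; have Dp := profile_domain_pt z0_lt1 sT z1.
  refine (is_derive_eq (is_derive_sub (is_derive_dz sU Dp)
    (is_derive_const c z 1)) _).
  by rewrite subr0.
have d2 (z : R) : 1 <= z ->
    is_derive z 1 (fun z => dz U (pt s z)) (dz (dz U) (pt s z)).
  by move=> z1; apply: (is_derive_dz sdU); exact: profile_domain_pt.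
have := hyperbolic_laplacian_radial x d1 d2.
by rewrite /radial_profile /gen !pt1 => <-.
Qed.

End TimeDependent.

Section Monotonicity.
Context {R : realType} {dO : measure_display} {Omega : measurableType dO}.
Context {d : nat} {X : R -> Omega -> 'rV[R]_d}.
Context {P : 'rV[R]_d -> probability Omega R}.
Hypothesis hX : hyperbolic_brownian_motion X P.
Variables (T0 z0 : R).
Hypothesis z0_lt1 : z0 < 1.
Implicit Types (s t z a b K : R) (U V : 'rV[R]_2 -> R).
Local Notation mu := (@lebesgue_measure R).
Local Notation D := (profile_domain T0 z0).
Local Notation gen := (gen d).

Local Notation mean := (@mean R dO Omega d X P).

Lemma mvt_le (f df : R -> R) K a b : a <= b ->
  (forall x, a <= x <= b -> is_derive x 1 f (df x)) ->
  (forall x, a <= x <= b -> `|df x| <= K) -> `|f b - f a| <= K * (b - a).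
Proof.
move=> ab fd fK; have [c cab ->] : exists2 c, c \in `[a, b] & f b - f a = df c * (b - a).
  apply: MVT_segment => //.
    by move=> x; rewrite in_itv /= => /andP[ax xb]; apply: fd; rewrite !ltW.
  apply: derivable_within_continuous => x; rewrite in_itv /= => xab.
  by have [] := fd x xab.
by rewrite normrM [X in _ * X]ger0_norm ?subr_ge0// ler_wpM2r ?subr_ge0// fK.
Qed.

(** The total decrease over [n] equal steps is at most [n K ((b - a) / n)^2], which
    tends to zero. *)
Lemma telescoping_le (h : R -> R) K a b : a <= b ->
  (forall x y, a <= x -> x <= y -> y <= b -> h x - h y <= K * (y - x) ^+ 2) ->
  h a <= h b.
Proof.
move=> ab hK; rewrite -subr_le0 leNgt; apply/negP => h0.
pose n := Num.truncn (K * (b - a) ^+ 2 / (h a - h b)).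
pose x (i : nat) := a + (b - a) / n.+1%:R * i%:R.
have n0 : 0 < n.+1%:R :> R by [].
have xn : x n.+1 = b by rewrite /x; field; rewrite ?natr1 ?nat1r gt_eqF.
have st0 : 0 <= (b - a) / n.+1%:R by rewrite divr_ge0// subr_ge0.
have step i : (i < n.+1)%N ->
    h (x i) - h (x i.+1) <= K * ((b - a) / n.+1%:R) ^+ 2.
  move=> ilt; have e : x i.+1 - x i = (b - a) / n.+1%:R.
    by rewrite /x -natr1; ring.
  rewrite -e; apply: hK.
  - by rewrite /x lerDl mulr_ge0.
  - by rewrite -subr_ge0 e.
  - by rewrite -xn /x lerD2l ler_wpM2l// ler_nat.
have : \sum_(i < n.+1) (h (x i) - h (x i.+1)) <=
    \sum_(i < n.+1) K * ((b - a) / n.+1%:R) ^+ 2.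
  by apply: ler_sum => i _; apply: step.
rewrite sumr_const card_ord -(big_mkord xpredT (fun i => h (x i) - h (x i.+1))).
rewrite -[X in X <= _]opprK -sumrN.
under eq_bigr do rewrite opprB.
rewrite telescope_sumr// xn opprB {1}/x mulr0 addr0 -mulr_natl.
rewrite [leRHS](_ : _ = K * (b - a) ^+ 2 / n.+1%:R); last first.
  by field; rewrite ?natr1 ?nat1r gt_eqF.
rewrite ler_pdivlMr// mulrC -ler_pdivlMr// leNgt => /negP; apply.
exact: truncnS_gt.
Qed.

Lemma integrable_profile U z1 s t : 1 <= z1 -> 0 <= t -> s < T0 ->
  smooth_on D U -> eventually_constant T0 U z1 ->
  (P pole).-integrable setT (EFin \o (fun w => radial_profile U s (X t w))).
Proof.
move=> z11 t0 sT sU cU.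
have [K _ hK] := eventually_constant_bounded z0_lt1 s z11 sT sU cU.
apply: (integrable_observable hX (K := K)) => //.
  exact: (continuous_radial_profile z0_lt1 sT sU).
by move=> x; apply: hK; rewrite ?lexx ?cosh_dist_ge1.
Qed.

Lemma mean_norm_le U z1 s t K : 1 <= z1 -> 0 <= t -> s < T0 ->
  smooth_on D U -> eventually_constant T0 U z1 ->
  (forall z, 1 <= z -> `|U (pt s z)| <= K) -> `|mean t (radial_profile U s)| <= K.
Proof.
move=> z11 t0 sT sU cU UK.
have iU := integrable_profile z11 t0 sT sU cU.
apply: (le_trans (le_normr_Rintegral measurableT iU)).
have eK : \int[P pole]_w K = K.
  by rewrite Rintegral_cst//= probability_setT mulr1.
rewrite -[leRHS]eK; apply: le_Rintegral => //.
- exact: (integrable_abse iU).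
- exact: finite_measure_integrable_cst.
by move=> w _; apply: UK; exact: cosh_dist_ge1.
Qed.

Lemma dynkin_profile U z1 s a b : 1 <= z1 -> s < T0 ->
  smooth_on D U -> eventually_constant T0 U z1 -> 0 <= a <= b ->
  mu.-integrable `[a, b] (EFin \o (fun t => mean t (radial_profile (gen U) s))) /\
  mean b (radial_profile U s) - mean a (radial_profile U s) =
  \int[mu]_(t in `[a, b]) mean t (radial_profile (gen U) s).
Proof.
move=> z11 sT sU cU ab; have sG := smooth_on_gen d sU.
have cG := eventually_constant_gen d z0_lt1 z11 sU cU.
have z12 : 1 <= z1 + 1 by rewrite (le_trans z11)// lerDl.
have [K _ hK] := eventually_constant_bounded z0_lt1 s z11 sT sU cU.
have [K' _ hK'] := eventually_constant_bounded z0_lt1 s z12 sT sG cG.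
set c := U (pt s z1).
have fK (x : 'rV[R]_d) : `|radial_profile U s x - c| <= K + K.
  apply: le_trans (ler_normB _ _) _.
  by apply: lerD; apply: hK; rewrite ?lexx ?cosh_dist_ge1.
have cf : continuous (fun x : 'rV[R]_d => radial_profile U s x - c).
  move=> x; apply: continuousB; last exact: cst_continuous.
  exact: (continuous_radial_profile z0_lt1 sT sU).
have gE : (fun x : 'rV[R]_d => hyperbolic_laplacian
    (fun x => radial_profile U s x - c) x / 2) = radial_profile (gen U) s.
  by apply/funext => x; exact: (laplacian_profile z0_lt1 c x sT sU).
have cg : continuous (fun x : 'rV[R]_d => hyperbolic_laplacian
    (fun x => radial_profile U s x - c) x / 2).
  by rewrite gE; exact: (continuous_radial_profile z0_lt1 sT sG).
have gK (x : 'rV[R]_d) : `|hyperbolic_laplacian (fun x => radial_profile U s x - c) x / 2| <= K'.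
  rewrite (laplacian_profile z0_lt1 c x sT sU) /radial_profile.
  apply: hK'; rewrite ?lexx//.
  exact: cosh_dist_ge1.
have tf := test_function_profile (d := d) z0_lt1 sT sU cU.
have := dynkin hX tf cf fK cg gK ab; rewrite gE => -[i e]; split=> //.
have mean_c t : 0 <= t ->
    mean t (fun x => radial_profile U s x - c) = mean t (radial_profile U s) - c.
  move=> t0; have iU := integrable_profile z11 t0 sT sU cU.
  have ic : (P pole).-integrable setT (EFin \o (fun=> c)).
    exact: finite_measure_integrable_cst.
  have := RintegralB measurableT iU ic.
  by rewrite Rintegral_cst//= probability_setT mulr1.
case/andP: ab => a0 ab.
by rewrite -e !mean_c ?(le_trans a0 ab)//; ring.
Qed.

End Monotonicity.

Section Comparison.
Context {R : realType} {dO : measure_display} {Omega : measurableType dO}.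
Context {d : nat} {X : R -> Omega -> 'rV[R]_d}.
Context {P : 'rV[R]_d -> probability Omega R}.
Hypothesis hX : hyperbolic_brownian_motion X P.
Variables (T0 z0 : R).
Hypothesis z0_lt1 : z0 < 1.
Implicit Types (s t z a b K : R) (U V : 'rV[R]_2 -> R).
Local Notation mu := (@lebesgue_measure R).
Local Notation D := (profile_domain T0 z0).
Local Notation gen := (gen d).
Local Notation mean := (@mean R dO Omega d X P).

Let Rintegral_itv_le (f : R -> R) K a b : a <= b ->
  mu.-integrable `[a, b] (EFin \o f) ->
  (forall t, a <= t <= b -> `|f t| <= K) ->
  `|\int[mu]_(t in `[a, b]) f t| <= K * (b - a).
Proof.
move=> ab fi fK; apply: le_trans (le_normr_Rintegral _ fi) _ => //.
have muab : fine (mu `[a, b]) = b - a.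
  rewrite lebesgue_measure_itv /= lte_fin; case: ltP => // ba.
  by rewrite (@le_anti _ _ a b) ?ab// subrr.
rewrite -muab -Rintegral_cst//; apply: le_Rintegral => //.
- exact: (integrable_abse fi).
- apply: continuous_compact_integrable; first exact: segment_compact.
  by move=> ?; exact: cst_continuous.
Qed.

Lemma mean_profile_lipschitz U z1 s K a b : 1 <= z1 -> s < T0 ->
  smooth_on D U -> eventually_constant T0 U z1 -> 0 <= a <= b ->
  (forall z, 1 <= z -> `|gen U (pt s z)| <= K) ->
  `|mean b (radial_profile U s) - mean a (radial_profile U s)| <= K * (b - a).
Proof.
move=> z11 sT sU cU ab gK.
have [i ->] := dynkin_profile hX z0_lt1 z11 sT sU cU ab.
case/andP: ab => a0 ab; apply: Rintegral_itv_le => // t /andP[at_ _].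
have z12 : 1 <= z1 + 1 by rewrite (le_trans z11)// lerDl.
have sG := smooth_on_gen d sU.
have cG := eventually_constant_gen d z0_lt1 z11 sU cU.
exact: (mean_norm_le hX z0_lt1 z12 (le_trans a0 at_) sT sG cG gK).
Qed.

(** Dynkin's formula applied to [U], then to [gen U]. *)
Lemma mean_profile_taylor U z1 s K a b : 1 <= z1 -> s < T0 ->
  smooth_on D U -> eventually_constant T0 U z1 -> 0 <= a <= b ->
  (forall z, 1 <= z -> `|gen (gen U) (pt s z)| <= K) ->
  `|mean b (radial_profile U s) - mean a (radial_profile U s) -
    (b - a) * mean a (radial_profile (gen U) s)| <= K * (b - a) ^+ 2.
Proof.
move=> z11 sT sU cU ab gK.
have [i ->] := dynkin_profile hX z0_lt1 z11 sT sU cU ab.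
case/andP: ab => a0 ab.
have z12 : 1 <= z1 + 1 by rewrite (le_trans z11)// lerDl.
have sG := smooth_on_gen d sU.
have cG := eventually_constant_gen d z0_lt1 z11 sU cU.
have K0 : 0 <= K by apply: le_trans (gK 1 (lexx _)).
have ic : mu.-integrable `[a, b]
    (EFin \o (fun=> mean a (radial_profile (gen U) s))).
  apply: continuous_compact_integrable; first exact: segment_compact.
  by move=> ?; exact: cst_continuous.
have muab : fine (mu `[a, b]) = b - a.
  rewrite lebesgue_measure_itv /= lte_fin; case: ltP => // ba.
  by rewrite (@le_anti _ _ a b) ?ab// subrr.
rewrite mulrC -muab -Rintegral_cst//.
rewrite -(RintegralB _ i ic)// muab expr2 mulrA.
apply: Rintegral_itv_le => //; first exact: (integrableB _ i ic).
move=> t /andP[at_ tb].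
have := @mean_profile_lipschitz (gen U) (z1 + 1) s K a t z12 sT sG cG.
rewrite a0 at_ => /(_ isT gK) h; apply: (le_trans h).
by rewrite ler_wpM2l// lerD2r.
Qed.

Let collect_errors (h e k1 k2 k3 m1 m2 m3 p q g : R) :
  - (k1 * e) <= m3 - m2 - h * g -> - (k2 * e) <= h * (q - p) ->
  m3 + h * q - k3 * e <= m1 -> 0 <= h * (p + g) ->
  m2 - m1 <= (k1 + k2 + k3) * e.
Proof. by rewrite mulrBr mulrDr !mulrDl; lra. Qed.

(** A subsolution of the backward equation has nondecreasing mean along the
    process, as Ito's formula would show. Over a short
    time the increment of the mean is the mean of [dt U + gen U] up to a quadratic
    error, and these errors vanish when the interval is subdivided. *)
Lemma mean_profile_le U z1 a b : 1 <= z1 -> 0 <= a -> a <= b -> b < T0 ->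
  smooth_on D U -> eventually_constant T0 U z1 ->
  (forall s z, a <= s <= b -> 1 <= z ->
    0 <= dt U (pt s z) + gen U (pt s z)) ->
  mean a (radial_profile U a) <= mean b (radial_profile U b).
Proof.
move=> z11 a0 ab bT sU cU W0.
have z12 : 1 <= z1 + 1 by rewrite (le_trans z11)// lerDl.
have z13 : 1 <= z1 + 1 + 1 by rewrite (le_trans z12)// lerDl.
have sG := smooth_on_gen d sU.
have cG := eventually_constant_gen d z0_lt1 z11 sU cU.
have st : smooth_on D (dt U) by exact: smooth_on_partial.
have ct := eventually_constant_dt z0_lt1 z11 sU cU.
have stt : smooth_on D (dt (dt U)) by exact: smooth_on_partial.
have ctt := eventually_constant_dt z0_lt1 z11 st ct.
have [K1 K10 hK1] := eventually_constant_bounded z0_lt1 a z13 bT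
  (smooth_on_gen d sG) (eventually_constant_gen d z0_lt1 z12 sG cG).
have [K2 K20 hK2] := eventually_constant_bounded z0_lt1 a z12 bT
  (smooth_on_gen d st) (eventually_constant_gen d z0_lt1 z11 st ct).
have [K3 K30 hK3] := eventually_constant_bounded z0_lt1 a z11 bT stt ctt.
apply: (@telescoping_le _ (fun s => mean s (radial_profile U s)) (K1 + K2 + K3)) => //.
move=> x y ax xy yb.
have x0 : 0 <= x := le_trans a0 ax.
have y0 : 0 <= y := le_trans x0 xy.
have xb := le_trans xy yb.
have xT : x < T0 := le_lt_trans xb bT.
have yT : y < T0 := le_lt_trans yb bT.
have xab : a <= x <= b by rewrite ax.
have x0y : 0 <= x <= y by rewrite x0.
have t1 := mean_profile_taylor z11 xT sU cU x0y (fun z => hK1 x z xab).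
have t2 := mean_profile_lipschitz z11 xT st ct x0y (fun z => hK2 x z xab).
have taylor_s z : 1 <= z ->
    `|U (pt y z) - U (pt x z) - (y - x) * dt U (pt x z)| <= K3 * (y - x) ^+ 2.
  move=> z1'.
  pose f s := U (pt s z) - s * dt U (pt x z).
  have -> : U (pt y z) - U (pt x z) - (y - x) * dt U (pt x z) = f y - f x.
    by rewrite /f; ring.
  rewrite expr2 mulrA.
  apply: (@mvt_le _ f (fun s => dt U (pt s z) - dt U (pt x z))) => // s /andP[xs sy].
    have sT : s < T0 := le_lt_trans sy yT.
    have Dp := profile_domain_pt z0_lt1 sT z1'.
    refine (is_derive_eq (is_derive_sub (is_derive_dt sU Dp)
      (is_derive_mul (is_derive_id _ _) (is_derive_const (dt U (pt x z)) s 1))) _).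
    by ring.
  apply: (@le_trans _ _ (K3 * (s - x))); last by rewrite ler_wpM2l ?lerD2r// ltW.
  apply: (@mvt_le _ (fun s => dt U (pt s z)) (fun s => dt (dt U) (pt s z))) => //.
    move=> r /andP[xr rs].
    have rT : r < T0 := le_lt_trans rs (le_lt_trans sy yT).
    exact: is_derive_dt st (profile_domain_pt z0_lt1 rT z1').
  move=> r /andP[xr rs]; apply: hK3 => //.
  by rewrite (le_trans ax xr)/= (le_trans rs)// (le_trans sy).
have iy := integrable_profile hX z0_lt1 z11 y0 yT sU cU.
have ix := integrable_profile hX z0_lt1 z11 y0 xT sU cU.
have it := integrable_profile hX z0_lt1 z11 y0 xT st ct.
have t3 : mean y (radial_profile U x) + (y - x) * mean y (radial_profile (dt U) x) -
    K3 * (y - x) ^+ 2 <= mean y (radial_profile U y).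
  have ic : (P pole).-integrable setT (EFin \o (fun=> K3 * (y - x) ^+ 2)).
    exact: finite_measure_integrable_cst.
  have izt := integrableZl measurableT (y - x) it.
  have e1 : \int[P pole]_w (radial_profile U x (X y w) +
      (y - x) * radial_profile (dt U) x (X y w) - K3 * (y - x) ^+ 2) =
      mean y (radial_profile U x) + (y - x) * mean y (radial_profile (dt U) x) -
      K3 * (y - x) ^+ 2.
    rewrite (RintegralB measurableT (integrableD measurableT ix izt) ic).
    rewrite (RintegralD measurableT ix izt) (RintegralZl _ measurableT it).
    by rewrite Rintegral_cst//= probability_setT mulr1.
  rewrite -e1; apply: le_Rintegral => //.
    exact: (integrableB measurableT (integrableD measurableT ix izt) ic).
  move=> w _; have := taylor_s _ (cosh_dist_ge1 (X y w)).
  by rewrite /radial_profile ler_norml; lra.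
have W_ge0 : 0 <= mean x (radial_profile (dt U) x) + mean x (radial_profile (gen U) x).
  have i1 := integrable_profile hX z0_lt1 z11 x0 xT st ct.
  have i2 := integrable_profile hX z0_lt1 z12 x0 xT sG cG.
  rewrite -(RintegralD measurableT i1 i2); apply: Rintegral_ge0 => w _.
  by apply: W0 => //; exact: cosh_dist_ge1.
have yx0 : 0 <= y - x by rewrite subr_ge0.
move: t1; rewrite ler_norml => /andP[t1 _].
have {}t2 : - (K2 * (y - x) ^+ 2) <= (y - x) * (mean y (radial_profile (dt U) x) -
    mean x (radial_profile (dt U) x)).
  move: t2; rewrite ler_norml => /andP[t2 _].
  by rewrite expr2 mulrA -mulNr mulrC ler_wpM2l.
have {}W_ge0 := mulr_ge0 yx0 W_ge0.
exact: collect_errors t1 t2 t3 W_ge0.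
Qed.

End Comparison.

(** * The normal tail *)

Section NormalTail.
Context {R : realType}.
Implicit Types x y : R.
Local Notation mu := (@lebesgue_measure R).

Definition gauss_density x : R := (Num.sqrt (2 * pi))^-1 * expR (- (x ^+ 2) / 2).

Let density_normal : gauss_density = normal_pdf 0 1.
Proof.
apply/funext => x; rewrite normal_pdfE ?oner_neq0//.
rewrite /normal_peak /normal_fun /gauss_density !expr1n subr0 mul1r.
by rewrite -[pi *+ 2]mulr_natl.
Qed.

Lemma gauss_density_gt0 x : 0 < gauss_density x.
Proof.
by rewrite mulr_gt0 ?expR_gt0// invr_gt0 sqrtr_gt0 mulr_gt0// pi_gt0.
Qed.

Lemma gauss_density_le1 x : gauss_density x <= 1.
Proof.
have pi2 : 1 <= Num.sqrt (2 * pi) :> R.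
  rewrite -[leLHS]sqrtr1 ler_wsqrtr//; have := pi_ge2 R; lra.
rewrite -[leRHS]mulr1 ler_pM ?expR_ge0 ?invr_ge0//.
  by rewrite invf_le1// (lt_le_trans ltr01).
by rewrite expR_le1 mulNr oppr_le0 divr_ge0// sqr_ge0.
Qed.

Lemma continuous_gauss_density : continuous gauss_density.
Proof. by rewrite density_normal; exact: continuous_normal_pdf (oner_neq0 _). Qed.

Lemma gauss_densityN x : gauss_density (- x) = gauss_density x.
Proof. by rewrite /gauss_density sqrrN. Qed.

Lemma normr_gauss_density_le1 x : `|x| * gauss_density x <= 1.
Proof.
rewrite /gauss_density mulrCA.
have pi2 : 1 <= Num.sqrt (2 * pi) :> R.
  rewrite -[leLHS]sqrtr1 ler_wsqrtr//; have := pi_ge2 R; lra.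
rewrite -[leRHS]mulr1 ler_pM ?invr_ge0 ?mulr_ge0 ?expR_ge0//.
  by rewrite invf_le1// (lt_le_trans ltr01).
rewrite mulNr expRN ler_pdivrMr ?expR_gt0// mul1r.
apply: le_trans (expR_ge1Dx (x ^+ 2 / 2)).
rewrite -(real_normK (num_real x)); have := sqr_ge0 (`|x| - 1).
by move: `|x| => r; lra.
Qed.

Let density_integrable (i : interval R) :
  mu.-integrable [set` i] (EFin \o gauss_density).
Proof.
apply: (@integrableS _ _ _ mu setT) => //.
by rewrite density_normal; exact: integrable_normal_pdf.
Qed.

Let total : \int[mu]_x gauss_density x = 1.
Proof. by rewrite /Rintegral density_normal integral_normal_pdf. Qed.

Lemma PhiE x : Phi x = \int[mu]_(u in `[x, +oo[) gauss_density u.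
Proof.
have c0 : Num.sqrt (2 * pi) != 0 :> R.
  by rewrite gt_eqF// sqrtr_gt0 mulr_gt0// pi_gt0.
rewrite /Phi /gauss_density RintegralZl//.
have i := density_integrable `[x, +oo[.
have : mu.-integrable `[x, +oo[
    (fun u => (Num.sqrt (2 * pi))%:E * (EFin \o gauss_density) u)%E.
  by apply: integrableZl.
apply: eq_integrable => //.
by move=> u _; rewrite /= -EFinM /gauss_density mulrA divff// mul1r.
Qed.

Lemma Phi_ge0 x : 0 <= Phi x.
Proof. by rewrite PhiE; apply: Rintegral_ge0 => u _; exact/ltW/gauss_density_gt0. Qed.

Let cdf x := \int[mu]_(u in `]-oo, x]) gauss_density u.

Let Phi_cdf x : Phi x = 1 - cdf x.
Proof.
have iT : mu.-integrable [set` `]-oo, +oo[] (EFin \o gauss_density).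
  exact: density_integrable.
have := @Rintegral_itvB _ gauss_density -oo%O +oo%O x iT.
rewrite set_itvNyy total => /(_ isT isT) ->.
by rewrite PhiE -Rintegral_itv_obnd_cbnd.
Qed.

Lemma PhiN x : Phi (- x) = 1 - Phi x.
Proof.
rewrite Phi_cdf PhiE /cdf; congr (_ - _).
rewrite /Rintegral.
have c : {within `]-oo, (- x)%R], continuous gauss_density}.
  exact: continuous_subspaceT continuous_gauss_density.
have nn : {in `]-oo, (- x)%R[, forall u, 0 <= gauss_density u}.
  by move=> u _; exact/ltW/gauss_density_gt0.
rewrite (ge0_integration_by_substitutionNy c nn).
by congr fine; apply: eq_integral => u _ /=; rewrite gauss_densityN.
Qed.

Lemma Phi_le1 x : Phi x <= 1.
Proof. by rewrite -subr_ge0 -PhiN Phi_ge0. Qed.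

Lemma is_derive_Phi x : is_derive x 1 Phi (- gauss_density x).
Proof.
have lt_x : x < x + 1 by rewrite ltrDl.
have ftc := @continuous_FTC1 _ gauss_density -oo%O x (x + 1) lt_x
  (density_integrable _).
have [|d e] := ftc _ (@continuous_gauss_density x); first by rewrite ltNyr.
have -> : Phi = (fun y => 1 - cdf y) by apply/funext => y; exact: Phi_cdf.
have dc : is_derive x 1 cdf (gauss_density x).
  by apply: DeriveDef => //; rewrite -derive1E.
refine (is_derive_eq (is_derive_sub (is_derive_const 1 x 1) dc) _).
by rewrite sub0r.
Qed.

Let density_le_sqr_inv x : 0 < x -> gauss_density x <= x ^- 2.
Proof.
move=> x0; rewrite -[leRHS]mul1r ler_pdivlMr ?exprn_gt0// /gauss_density.
have pi2 : 2 <= Num.sqrt (2 * pi) :> R.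
  rewrite -(@ler_sqr _ 2) ?nnegrE ?sqrtr_ge0// sqr_sqrtr ?mulr_ge0 ?pi_ge0//.
  by have := pi_ge2 R; lra.
have h1 : expR (- (x ^+ 2) / 2) * x ^+ 2 <= 2.
  rewrite mulNr expRN mulrC ler_pdivrMr ?expR_gt0//.
  by have := expR_ge1Dx (x ^+ 2 / 2); lra.
have h2 : (Num.sqrt (2 * pi))^-1 <= 2^-1 :> R.
  by rewrite lef_pV2 ?posrE// (lt_le_trans _ pi2).
rewrite -mulrA; apply: (@le_trans _ _ (2^-1 * 2)); last by rewrite mulVf.
by apply: ler_pM => //; rewrite ?invr_ge0 ?sqrtr_ge0// mulr_ge0 ?expR_ge0 ?sqr_ge0.
Qed.

(** The density is at most [x ^ -2], whose tail integral is [1 / x]. *)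
Lemma Phi_le_inv x : 0 < x -> Phi x <= x^-1.
Proof.
move=> x0; pose f (u : R) := u ^- 2; pose F (u : R) := - u^-1.
have dF (u : R) : 0 < u -> is_derive u 1 F (f u).
  move=> u0; have d := @is_derive_inv _ _ id u 1 1 (lt0r_neq0 u0) (is_derive_id _ _).
  apply: (is_derive_eq (is_deriveN d)).
  by rewrite mulNr opprK mulr1.
have F0 : F u @[u --> +oo] --> 0.
  apply/cvgrPdist_le => e e0; near=> u.
  have u0 : 0 < u by near: u; exact: nbhs_pinfty_gt.
  rewrite sub0r opprK ger0_norm ?invr_ge0 ?(ltW u0)// -[leRHS]invrK.
  rewrite lef_pV2 ?posrE ?invr_gt0//; near: u.
have cF (u : R) : 0 < u -> {for u, continuous F}.
  move=> u0; apply: differentiable_continuous; apply/derivable1_diffP.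
  by have [] := dF u u0.
have cf : {within `[x, +oo[, continuous f}.
  apply: continuous_in_subspaceT => u; rewrite inE /= in_itv /= andbT => xu.
  have u0 : 0 < u := lt_le_trans x0 xu.
  apply: (@continuous_comp _ _ _ (fun u : R => u ^+ 2) GRing.inv).
    exact: exprn_continuous.
  by apply: inv_continuous; rewrite expf_neq0// gt_eqF.
have e : (\int[mu]_(u in `[x, +oo[) (f u)%:E = (x^-1)%:E)%E.
  rewrite (@ge0_continuous_FTC2y _ f F x 0).
  - by rewrite /F -EFinB sub0r opprK.
  - by move=> u xu; rewrite invr_ge0 sqr_ge0.
  - exact: cf.
  - exact: F0.
  - by move=> u xu; have [] := dF u (lt_trans x0 xu).
  - exact/cvg_at_right_filter/cF.
  - move=> u; rewrite in_itv /= andbT => xu; rewrite derive1E.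
    by have [_ ->] := dF u (lt_trans x0 xu).
have i := density_integrable `[x, +oo[.
rewrite -lee_fin -e PhiE /Rintegral fineK; last first.
  by apply: integrable_fin_num => //.
apply: ge0_le_integral => //.
- by move=> u _; exact/ltW/gauss_density_gt0.
- by move/integrableP : i => [].
- apply/measurable_EFinP; apply: subspace_continuous_measurable_fun => //.
- move=> u; rewrite /= in_itv /= andbT => xu; rewrite lee_fin.
  exact: density_le_sqr_inv (lt_le_trans x0 xu).
Unshelve. all: by end_near. Qed.

Lemma Phi_lipschitz x y : x <= y -> 0 <= Phi x - Phi y <= y - x.
Proof.
move=> xy; have [c _ e] : exists2 c, c \in `[x, y] & Phi y - Phi x = - gauss_density c * (y - x).
  apply: MVT_segment => //; first by move=> u _; exact: is_derive_Phi.
  by apply: derivable_within_continuous => u _; have [] := is_derive_Phi u.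
have := gauss_density_gt0 c; have := gauss_density_le1 c.
by move: e; nra.
Qed.

(** Uniform in [x] because [x] times the density stays bounded: the mean value
    theorem on [[l x, x]] gives the factor [1 / l - 1] times [l x] times the
    density at a point beyond [l x]. *)
Lemma Phi_scale (x l : R) : 0 < l -> l <= 1 -> `|Phi (l * x) - Phi x| <= l^-1 - 1.
Proof.
move=> l0 l1; wlog x0 : x / 0 <= x => [wlog_pos|].
  have [x0|/ltW x0] := leP 0 x; first exact: wlog_pos.
  have := wlog_pos (- x); rewrite oppr_ge0 mulrN !PhiN => /(_ x0).
  by rewrite opprB addrC addrA subrK distrC.
have lx : l * x <= x by rewrite ler_piMl.
have lx0 : 0 <= l * x by rewrite mulr_ge0// ltW.
have [c cin e] : exists2 c, c \in `[l * x, x] & Phi x - Phi (l * x) =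
    - gauss_density c * (x - l * x).
  apply: MVT_segment => //; first by move=> u _; exact: is_derive_Phi.
  by apply: derivable_within_continuous => u _; have [] := is_derive_Phi u.
move: cin; rewrite in_itv /= => /andP[lc _].
have c0 := le_trans lx0 lc.
rewrite distrC e normrM normrN !ger0_norm ?subr_ge0//; last first.
  exact/ltW/gauss_density_gt0.
have l1' : 0 <= l^-1 - 1 by rewrite subr_ge0 invf_ge1.
have -> : x - l * x = (l^-1 - 1) * (l * x) by field; rewrite gt_eqF.
rewrite mulrCA -[leRHS]mulr1 ler_wpM2l//.
apply: le_trans (normr_gauss_density_le1 c); rewrite mulrC ger0_norm//.
by rewrite ler_wpM2r//; exact/ltW/gauss_density_gt0.
Qed.

End NormalTail.

(** * Comparison with sub- and supersolutions of the backward equation *)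

Section Profiles.
Context {R : realType}.
Variables (d : nat) (T0 z0 : R).
Implicit Types (A B As Az Azz Bs Bz Bzz : R -> R -> R) (s t z a b : R).
Local Notation D := (profile_domain T0 z0).

(** [A] is smooth in time and [z = cosh r], with the derivatives that enter the
    backward equation named. *)
Record is_profile A As Az Azz : Prop := IsProfile {
  profile_smooth : smooth_on D (fun p => A (p 0 0) (p 0 1)) ;
  profile_ds : forall s z, s < T0 -> z0 < z -> is_derive s 1 (A^~ z) (As s z) ;
  profile_dz : forall s z, s < T0 -> z0 < z -> is_derive z 1 (A s) (Az s z) ;
  profile_dzz : forall s z, s < T0 -> z0 < z -> is_derive z 1 (Az s) (Azz s z) }.

Definition backward As Az Azz s z : R :=
  As s z + ((z ^+ 2 - 1) * Azz s z + d%:R * z * Az s z) / 2.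

Lemma is_profile_add A As Az Azz B Bs Bz Bzz :
  is_profile A As Az Azz -> is_profile B Bs Bz Bzz ->
  is_profile (fun s z => A s z + B s z) (fun s z => As s z + Bs s z)
    (fun s z => Az s z + Bz s z) (fun s z => Azz s z + Bzz s z).
Proof.
move=> [sA A1 A2 A3] [sB B1 B2 B3]; split.
- by apply: smooth_onD => //; exact: open_profile_domain.
- by move=> s z sT zz; apply: is_derive_add; [exact: A1 | exact: B1].
- by move=> s z sT zz; apply: is_derive_add; [exact: A2 | exact: B2].
- by move=> s z sT zz; apply: is_derive_add; [exact: A3 | exact: B3].
Qed.

Lemma is_profile_mul A As Az Azz B Bs Bz Bzz :
  is_profile A As Az Azz -> is_profile B Bs Bz Bzz ->
  is_profile (fun s z => A s z * B s z)
    (fun s z => A s z * Bs s z + B s z * As s z)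
    (fun s z => A s z * Bz s z + B s z * Az s z)
    (fun s z => A s z * Bzz s z + 2 * Az s z * Bz s z + B s z * Azz s z).
Proof.
move=> [sA A1 A2 A3] [sB B1 B2 B3]; split.
- by apply: smooth_onM => //; exact: open_profile_domain.
- by move=> s z sT zz; apply: is_derive_mul; [exact: A1 | exact: B1].
- by move=> s z sT zz; apply: is_derive_mul; [exact: A2 | exact: B2].
- move=> s z sT zz.
  refine (is_derive_eq (is_derive_add
    (is_derive_mul (A2 _ _ sT zz) (B3 _ _ sT zz))
    (is_derive_mul (B2 _ _ sT zz) (A3 _ _ sT zz))) _).
  by ring.
Qed.

Lemma is_profile_opp A As Az Azz : is_profile A As Az Azz ->
  is_profile (fun s z => - A s z) (fun s z => - As s z)
    (fun s z => - Az s z) (fun s z => - Azz s z).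
Proof.
move=> [sA A1 A2 A3]; split.
- by apply: smooth_onN => //; exact: open_profile_domain.
- by move=> s z sT zz; apply: is_deriveN; exact: A1.
- by move=> s z sT zz; apply: is_deriveN; exact: A2.
- by move=> s z sT zz; apply: is_deriveN; exact: A3.
Qed.

Lemma is_profile_affine c e : is_profile (fun s _ => c + e * s) (fun _ _ => e)
  (fun _ _ => 0) (fun _ _ => 0).
Proof.
have oD := @open_profile_domain R T0 z0.
split=> [|s z _ _|s z _ _|s z _ _].
- apply: smooth_onD => //; first exact: smooth_on_cst.
  by apply: smooth_onM => //; [exact: smooth_on_cst | exact: smooth_on_coord].
- refine (is_derive_eq (is_derive_add (is_derive_const c s 1)
    (is_derive_mulC e (is_derive_id s 1))) _).
  by ring.
- exact: is_derive_const.
- exact: is_derive_const.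
Qed.

(** The cutoff at distance about [n], whose derivatives with respect to [ln z]
    are of order [1 / n]. *)
Definition chi (n : nat) (_ z : R) : R := bump (1 - ln z / n.+1%:R).
Definition chi_z (n : nat) (_ z : R) : R :=
  - (bump' (1 - ln z / n.+1%:R) / (n.+1%:R * z)).
Definition chi_zz (n : nat) (_ z : R) : R :=
  bump'' (1 - ln z / n.+1%:R) / (n.+1%:R * z) ^+ 2 +
  bump' (1 - ln z / n.+1%:R) / (n.+1%:R * z ^+ 2).

Lemma is_profile_chi n : 0 <= z0 ->
  is_profile (chi n) (fun _ _ => 0) (chi_z n) (chi_zz n).
Proof.
move=> z0_ge0; have oD := @open_profile_domain R T0 z0.
have n0 : n.+1%:R != 0 :> R by rewrite pnatr_eq0.
have darg (z : R) : z0 < z -> is_derive z 1 (fun z => 1 - ln z / n.+1%:R)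
    (- (n.+1%:R * z)^-1).
  move=> z0z; have zgt0 : 0 < z := le_lt_trans z0_ge0 z0z.
  refine (is_derive_eq (is_derive_sub (is_derive_const 1 z 1)
    (is_derive_mul (is_derive_lnf zgt0 (is_derive_id z 1))
      (is_derive_const n.+1%:R^-1 z 1))) _).
  by field; rewrite ?nat1r ?natr1 ?pnatr_eq0 ?gt_eqF.
split=> [|s z _ _|s z _ zz|s z _ zz].
- apply: smooth_on_bump => //; apply: smooth_onB => //.
    exact: smooth_on_cst.
  apply: smooth_onM => //; last exact: smooth_on_cst.
  apply: smooth_on_ln => //; last exact: smooth_on_coord.
  by move=> p [_ zp]; exact: le_lt_trans zp.
- exact: is_derive_const.
- refine (is_derive_eq (is_derive_comp_dir (darg z zz) (is_derive_flat 1 _)) _).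
  by rewrite /chi_z mulrN.
- have zgt0 : 0 < z := le_lt_trans z0_ge0 zz.
  have zN0 : n.+1%:R * z != 0 by rewrite mulf_neq0// gt_eqF.
  have d1 := is_derive_comp_dir (darg z zz) (is_derive_flat (flat_deriv 1) _).
  have d2 := is_derive_inv zN0 (is_derive_mulC n.+1%:R (is_derive_id z 1)).
  refine (is_derive_eq (is_deriveN (is_derive_mul d1 d2)) _).
  rewrite /chi_zz /bump' /bump'' /=.
  set P1 := flat _ _; set P2 := flat _ _.
  by field; rewrite ?nat1r ?natr1 ?pnatr_eq0 ?gt_eqF.
Qed.

Lemma chi_ge0 n s z : 0 <= chi n s z. Proof. exact: bump_ge0. Qed.

Lemma chi_le1 n s z : 1 <= z -> chi n s z <= 1.
Proof. by move=> z1; apply: bump_le1; rewrite gerBl divr_ge0// ln_ge0. Qed.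

Lemma chi_one n s : chi n s 1 = 1.
Proof. by rewrite /chi ln1 mul0r subr0 bump1. Qed.

Lemma chi_eq0 n s z : expR n.+1%:R <= z -> chi n s z = 0.
Proof.
move=> nz; apply: flat_le0; rewrite subr_le0 ler_pdivlMr// mul1r.
by rewrite -[leLHS]expRK ler_ln ?posrE ?expR_gt0// (lt_le_trans (expR_gt0 _) nz).
Qed.

(** The operators [z d/dz] and [z^2 d^2/dz^2] have constant coefficients in the
    variable [ln z], in which the cutoff varies on the scale [n]. *)
Lemma chi_bounds : exists2 C, 0 < C & forall n s z, 1 <= z ->
  z * `|chi_z n s z| <= C / n.+1%:R /\
  `|backward (fun _ _ => 0) (chi_z n) (chi_zz n) s z| <= C / n.+1%:R.
Proof.
have [K1 K10 hK1] := flat_bounded (flat_deriv (1 : {poly R})).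
have [K2 K20 hK2] := flat_bounded (flat_deriv (flat_deriv (1 : {poly R}))).
exists (K2 + K1 + d%:R * K1 + 1).
  by rewrite ltr_wpDl// !addr_ge0// mulr_ge0.
move=> n s z z1; have z_gt0 : 0 < z := lt_le_trans ltr01 z1.
have n0 : 0 < n.+1%:R :> R by [].
have n1 : 1 <= n.+1%:R :> R by rewrite ler1n.
set x := 1 - ln z / n.+1%:R.
have h1 : `|bump' x| <= K1 := hK1 x.
have h2 : `|bump'' x| <= K2 := hK2 x.
have e1 : z * chi_z n s z = - (bump' x / n.+1%:R).
  by rewrite /chi_z -/x; field; rewrite ?nat1r ?natr1 ?pnatr_eq0 ?gt_eqF.
split.
  rewrite -[X in X * _](gtr0_norm z_gt0) -normrM e1 normrN normrM normfV.
  rewrite [X in _ / X]gtr0_norm// ler_wpM2r ?invr_ge0// (le_trans h1)//.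
  by rewrite -!addrA ler_wpDl// lerDl addr_ge0 ?mulr_ge0.
rewrite /backward add0r.
have -> : ((z ^+ 2 - 1) * chi_zz n s z + d%:R * z * chi_z n s z) / 2 =
  ((1 - z ^- 2) * (bump'' x / n.+1%:R + bump' x) - d%:R * bump' x) / 2 / n.+1%:R.
  rewrite -mulrA e1 /chi_zz -/x.
  by field; rewrite ?nat1r ?natr1 ?pnatr_eq0 ?gt_eqF.
rewrite normrM normfV [X in _ / X]gtr0_norm// ler_wpM2r ?invr_ge0//.
have hz : `|1 - z ^- 2| <= 1.
  rewrite ger0_norm ?gerBl ?invr_ge0 ?sqr_ge0// subr_ge0 invf_le1 ?exprn_gt0//.
  exact: exprn_ege1.
have h3 : `|bump'' x / n.+1%:R| <= K2.
  rewrite normrM normfV [X in _ / X]gtr0_norm// ler_pdivrMr// (le_trans h2)//.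
  by rewrite ler_peMr.
have h4 : `|(1 - z ^- 2) * (bump'' x / n.+1%:R + bump' x)| <= K2 + K1.
  rewrite normrM -[leRHS]mul1r ler_pM// (le_trans (ler_normD _ _))//.
  exact: lerD.
have h5 : `|d%:R * bump' x| <= d%:R * K1.
  by rewrite normrM normr_nat ler_wpM2l.
rewrite normrM [X in _ * X]ger0_norm ?invr_ge0//.
have := ler_normB ((1 - z ^- 2) * (bump'' x / n.+1%:R + bump' x)) (d%:R * bump' x).
have : 0 <= d%:R * K1 by rewrite mulr_ge0.
lra.
Qed.

End Profiles.

Section NoncompactComparison.
Context {R : realType} {dO : measure_display} {Omega : measurableType dO}.
Context {d : nat} {X : R -> Omega -> 'rV[R]_d}.
Context {P : 'rV[R]_d -> probability Omega R}.
Hypothesis hX : hyperbolic_brownian_motion X P.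
Implicit Types (A B As Az Azz Bs Bz Bzz : R -> R -> R) (s t z a b : R).
Implicit Types f g : 'rV[R]_d -> R.
Local Notation mean := (@mean R dO Omega d X P).

Definition bounded_continuous f := continuous f /\ exists K, forall x, `|f x| <= K.

Lemma bounded_continuous_cst c : bounded_continuous (fun=> c).
Proof. by split; [move=> x; exact: cst_continuous | exists `|c|]. Qed.

Lemma bounded_continuousD f g : bounded_continuous f -> bounded_continuous g ->
  bounded_continuous (fun x => f x + g x).
Proof.
move=> [cf [K fK]] [cg [L gL]]; split.
  by move=> x; apply: continuousD; [exact: cf | exact: cg].
by exists (K + L) => x; rewrite (le_trans (ler_normD _ _))// lerD.
Qed.

Lemma bounded_continuousM f g : bounded_continuous f -> bounded_continuous g ->
  bounded_continuous (fun x => f x * g x).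
Proof.
move=> [cf [K fK]] [cg [L gL]]; split.
  by move=> x; apply: continuousM; [exact: cf | exact: cg].
by exists (K * L) => x; rewrite normrM ler_pM.
Qed.

Let integrable_bc t f : 0 <= t -> bounded_continuous f ->
  (P pole).-integrable setT (EFin \o (fun w => f (X t w))).
Proof. by move=> t0 [cf [K fK]]; exact: (integrable_observable hX t0 cf fK). Qed.

Lemma mean_le t f g : 0 <= t -> bounded_continuous f -> bounded_continuous g ->
  (forall x, f x <= g x) -> mean t f <= mean t g.
Proof.
by move=> t0 bf bg fg; apply: le_Rintegral => //; exact: integrable_bc.
Qed.

Lemma meanD t f g : 0 <= t -> bounded_continuous f -> bounded_continuous g ->
  mean t (fun x => f x + g x) = mean t f + mean t g.
Proof. by move=> t0 bf bg; apply: RintegralD => //; exact: integrable_bc. Qed.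

Lemma meanZ t c f : 0 <= t -> bounded_continuous f ->
  mean t (fun x => c * f x) = c * mean t f.
Proof. by move=> t0 bf; apply: RintegralZl => //; exact: integrable_bc. Qed.

Lemma mean_cst t c : mean t (fun=> c) = c.
Proof. by rewrite /mean Rintegral_cst//= probability_setT mulr1. Qed.

Section FixedDomain.
Variables (T0 z0 : R).
Hypothesis z0_lt1 : z0 < 1.
Local Notation D := (profile_domain T0 z0).
Local Notation is_profile := (is_profile T0 z0).

Let lift A (p : 'rV[R]_2) : R := A (p 0 0) (p 0 1).

Let liftE A s z : lift A (pt s z) = A s z.
Proof. by rewrite /lift pt0 pt1. Qed.

Lemma backwardE A As Az Azz s z : is_profile A As Az Azz -> s < T0 -> 1 <= z ->
  dt (lift A) (pt s z) + gen d (lift A) (pt s z) = backward d As Az Azz s z.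
Proof.
move=> [sA A1 A2 A3] sT z1; have Dp := profile_domain_pt z0_lt1 sT z1.
have zz := lt_le_trans z0_lt1 z1.
have dA z' : z0 < z' -> dz (lift A) (pt s z') = Az s z'.
  move=> zz'; have Dp' : D (pt s z') by split; rewrite ?pt0 ?pt1.
  have d1 := is_derive_dz (sA : smooth_on D (lift A)) Dp'.
  rewrite (_ : (fun z => _) = A s) in d1; last by apply/funext => y; exact: liftE.
  by have [_ <-] := d1; have [_ <-] := A2 s z' sT zz'.
have -> : dt (lift A) (pt s z) = As s z.
  have d1 := is_derive_dt (sA : smooth_on D (lift A)) Dp.
  rewrite (_ : (fun s => _) = A^~ z) in d1; last by apply/funext => y; exact: liftE.
  by have [_ <-] := d1; have [_ <-] := A1 s z sT zz.
have -> : gen d (lift A) (pt s z) =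
    ((z ^+ 2 - 1) * Azz s z + d%:R * z * Az s z) / 2.
  rewrite /gen pt1 dA//.
  have sdA : smooth_on D (dz (lift A)) by exact: smooth_on_partial.
  have [_ <-] := is_derive_dz sdA Dp; have [_ <-] := A3 s z sT zz.
  congr ((_ * _ + _) / _); apply: near_eq_derive.
  have : nbhs z [set x | z0 < x].
    by apply: open_nbhs_nbhs; split => //; exact: open_gt.
  by apply: filterS => y; exact: dA.
by [].
Qed.

Lemma continuous_profile A As Az Azz s : is_profile A As Az Azz -> s < T0 ->
  continuous (fun x : 'rV[R]_d => A s (cosh_dist x)).
Proof.
move=> [sA _ _ _] sT; have := continuous_radial_profile (d := d) z0_lt1 sT sA.
rewrite (_ : radial_profile _ s = (fun x => A s (cosh_dist x)))//.
by apply/funext => x; exact: liftE.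
Qed.

Lemma compare_compact A As Az Azz z1 a b : is_profile A As Az Azz ->
  1 <= z1 -> 0 <= a -> a <= b -> b < T0 ->
  (forall s z, s < T0 -> z1 <= z -> A s z = A s z1) ->
  (forall s z, a <= s <= b -> 1 <= z -> 0 <= backward d As Az Azz s z) ->
  mean a (fun x => A a (cosh_dist x)) <= mean b (fun x => A b (cosh_dist x)).
Proof.
move=> pA z11 a0 ab bT cA W0.
have := @mean_profile_le _ _ _ _ _ _ hX T0 z0 z0_lt1 (lift A) z1 a b z11 a0 ab bT.
have e s : radial_profile (lift A) s = (fun x : 'rV[R]_d => A s (cosh_dist x)).
  by apply/funext => x; exact: liftE.
rewrite !e; apply.
- exact: (profile_smooth pA).
- by move=> s z sT zz; rewrite !liftE; exact: cA.
- move=> s z sab zz; have sT : s < T0.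
    by case/andP: sab => _ sb; exact: le_lt_trans bT.
  by rewrite (backwardE pA)//; exact: W0.
Qed.

End FixedDomain.

(** Escape to infinity in finite time is excluded by the cutoffs themselves. *)
Lemma mean_chi_ge C : (forall n s z, 1 <= z ->
    `|backward d (fun _ _ => 0) (chi_z n) (chi_zz n) s z| <= C / n.+1%:R) ->
  forall n t, 0 <= t -> bounded_continuous (fun x => chi n t (cosh_dist x)) /\
    1 - C / n.+1%:R * t <= mean t (fun x => chi n t (cosh_dist x)).
Proof.
move=> hC n t t0.
have p1 := @is_profile_chi R (t + 1) 0 n (lexx 0).
have tT : t < t + 1 by rewrite ltrDl.
have bc s : s < t + 1 -> bounded_continuous (fun x => chi n s (cosh_dist x)).
  move=> sT; split; first exact: (continuous_profile ltr01 p1 sT).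
  exists 1 => x; rewrite ger0_norm ?chi_ge0// chi_le1//.
  exact: cosh_dist_ge1.
split; first exact: bc.
have p2 := is_profile_add p1 (is_profile_affine (t + 1) 0 0 (C / n.+1%:R)).
have := compare_compact ltr01 p2 (z1 := expR n.+1%:R) _ (lexx 0) t0 tT.
rewrite (mean_pole hX) ?cosh_dist_pole ?chi_one; last first.
  have T_gt0 : 0 < t + 1 by rewrite ltr_wpDl.
  exact: (continuous_profile ltr01 p2 T_gt0).
rewrite mulr0 !addr0 meanD//; last 2 first.
- exact: bc.
- exact: bounded_continuous_cst.
rewrite mean_cst => h; rewrite lerBlDr -[X in _ + X]add0r; apply: h.
- by rewrite -expR0 ler_expR.
- by move=> s z _ nz; rewrite !chi_eq0.
- move=> s z _ z1; have := hC n s z z1; rewrite ler_norml => /andP[h _].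
  by move: h; rewrite /backward /= !addr0 !add0r -lerBlDl sub0r.
Qed.

Let subr_le_of_close (p q p' q' u u' k a b : R) :
  `|p - q| <= u -> `|p' - q'| <= u' -> q + k * a <= q' + k * b ->
  p - p' <= u + u' + k * (b - a).
Proof. by rewrite !ler_norml => /andP[_ +] /andP[+ _]; lra. Qed.

(** Adding [K s] with [K] of order [1 / n] to the truncated profile [A chi] makes
    it a subsolution that is constant for large [z]; the truncation errors are
    controlled by [mean_chi_ge], and [n] tends to infinity. The product rule
    produces the cross term [(z^2 - 1) Az chi_z], which is why [z Az] has to be
    bounded. *)
Lemma compare A As Az Azz (T0 z0 M a b : R) : 0 <= z0 -> z0 < 1 ->
  is_profile T0 z0 A As Az Azz -> 0 <= a -> a <= b -> b < T0 ->
  (forall s z, a <= s <= b -> 1 <= z -> `|A s z| <= M) ->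
  (forall s z, a <= s <= b -> 1 <= z -> z * `|Az s z| <= M) ->
  (forall s z, a <= s <= b -> 1 <= z -> 0 <= backward d As Az Azz s z) ->
  mean a (fun x => A a (cosh_dist x)) <= mean b (fun x => A b (cosh_dist x)).
Proof.
move=> z0_ge0 z0_lt1 pA a0 ab bT AM AzM W0.
have b0 := le_trans a0 ab; have aT := le_lt_trans ab bT.
have [C C0 hC] := @chi_bounds R d.
have M0 : 0 <= M by apply: le_trans (AM a 1 _ _); rewrite ?lexx.
have main n : mean a (fun x => A a (cosh_dist x)) - mean b (fun x => A b (cosh_dist x))
    <= (M * C * (b - a) * 2 + M * C * (a + b)) / n.+1%:R.
  have n0 : 0 < n.+1%:R :> R by [].
  pose K := M * C * 2 / n.+1%:R.
  have pc := @is_profile_chi R T0 z0 n z0_ge0.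
  have pU := is_profile_add (is_profile_mul pA pc) (is_profile_affine T0 z0 0 K).
  have := compare_compact z0_lt1 pU (z1 := expR n.+1%:R) _ a0 ab bT.
  have bcA s : a <= s <= b -> bounded_continuous (fun x => A s (cosh_dist x)).
    move=> sab; have sT : s < T0 by case/andP: sab => _ sb; exact: le_lt_trans bT.
    split; first exact: (continuous_profile z0_lt1 pA sT).
    by exists M => x; apply: AM => //; exact: cosh_dist_ge1.
  have aab : a <= a <= b by rewrite lexx.
  have bab : a <= b <= b by rewrite lexx ab.
  have hC2 m s z (h : 1 <= z) := (hC m s z h).2.
  have [bca ca] := mean_chi_ge hC2 n a0.
  have [bcb cb] := mean_chi_ge hC2 n b0.
  rewrite !meanD//; try exact: bounded_continuous_cst; try
    (apply: bounded_continuousM => //; exact: bcA).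
  rewrite !mean_cst !add0r => h.
  have cut s : 0 <= s -> a <= s <= b ->
      bounded_continuous (fun x => chi n s (cosh_dist x)) ->
      1 - C / n.+1%:R * s <= mean s (fun x => chi n s (cosh_dist x)) ->
      `|mean s (fun x => A s (cosh_dist x)) -
        mean s (fun x => A s (cosh_dist x) * chi n s (cosh_dist x))| <=
      M * (C / n.+1%:R * s).
    move=> s0 sab bcs cs.
    have bAc := bounded_continuousM (bcA s sab) bcs.
    have key e : `|e| <= 1 -> e * (mean s (fun x => A s (cosh_dist x)) -
        mean s (fun x => A s (cosh_dist x) * chi n s (cosh_dist x))) <=
        M * (C / n.+1%:R * s).
      move=> e1; pose f (x : 'rV[R]_d) := A s (cosh_dist x) + (-1) * (A s (cosh_dist x) * chi n s (cosh_dist x)).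
      have bf : bounded_continuous f.
        apply: bounded_continuousD; first exact: bcA.
        by apply: bounded_continuousM => //; exact: bounded_continuous_cst.
      have bm1 : bounded_continuous (fun x : 'rV[R]_d =>
          (-1) * (A s (cosh_dist x) * chi n s (cosh_dist x))).
        by apply: bounded_continuousM => //; exact: bounded_continuous_cst.
      have ef : mean s f = mean s (fun x => A s (cosh_dist x)) -
        mean s (fun x => A s (cosh_dist x) * chi n s (cosh_dist x)).
        by rewrite meanD ?meanZ ?mulN1r//; exact: bcA.
      rewrite -ef -meanZ//.
      pose g (x : 'rV[R]_d) := M + (- M) * chi n s (cosh_dist x).
      have bg2 : bounded_continuous (fun x : 'rV[R]_d => (- M) * chi n s (cosh_dist x)).
        by apply: bounded_continuousM => //; exact: bounded_continuous_cst.
      have bg : bounded_continuous g.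
        by apply: bounded_continuousD => //; exact: bounded_continuous_cst.
      have eg : mean s g = M - M * mean s (fun x => chi n s (cosh_dist x)).
        rewrite meanD ?mean_cst ?meanZ ?mulNr//.
        exact: bounded_continuous_cst.
      apply: (@le_trans _ _ (mean s g)); last first.
        by rewrite eg -[X in X - _]mulr1 -mulrBr ler_wpM2l// lerBlDr addrC -lerBlDr.
      apply: mean_le => //.
        by apply: bounded_continuousM => //; exact: bounded_continuous_cst.
      move=> x; have x1 := cosh_dist_ge1 x.
      have c1 := chi_le1 n s x1; have := AM s _ sab x1.
      rewrite /f /g => hA.
      have -> : e * (A s (cosh_dist x) + -1 * (A s (cosh_dist x) * chi n s (cosh_dist x)))
          = (e * A s (cosh_dist x)) * (1 - chi n s (cosh_dist x)) by ring.
      have -> : M + - M * chi n s (cosh_dist x) = M * (1 - chi n s (cosh_dist x)).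
        by ring.
      rewrite ler_wpM2r ?subr_ge0// (le_trans (ler_norm _))// normrM -[leRHS]mul1r.
      exact: ler_pM.
    rewrite ler_norml; apply/andP; split.
      by have := key (-1); rewrite normrN1 lexx mulN1r lerNl; apply.
    by have := key 1; rewrite normr1 lexx mul1r; apply.
  have {}ca := cut a a0 aab bca ca.
  have {}cb := cut b b0 bab bcb cb.
  have {}h : mean a (fun x => A a (cosh_dist x) * chi n a (cosh_dist x)) + K * a <=
    mean b (fun x => A b (cosh_dist x) * chi n b (cosh_dist x)) + K * b.
    apply: h.
    - by rewrite -expR0 ler_expR.
    - by move=> s z _ nz; rewrite !chi_eq0// !mulr0.
    move=> s z sab z1.
    have [c1 c2] := hC n s z z1.
    have hA := AM s z sab z1; have hAz := AzM s z sab z1; have hW := W0 s z sab z1.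
    have z_gt0 : 0 < z := lt_le_trans ltr01 z1.
    have -> : backward d (fun s z => A s z * 0 + chi n s z * As s z + K)
        (fun s z => A s z * chi_z n s z + chi n s z * Az s z + 0)
        (fun s z => A s z * chi_zz n s z + 2 * Az s z * chi_z n s z +
                    chi n s z * Azz s z + 0) s z =
        chi n s z * backward d As Az Azz s z +
        A s z * backward d (fun _ _ => 0) (chi_z n) (chi_zz n) s z +
        (z ^+ 2 - 1) * (Az s z * chi_z n s z) + K.
      by rewrite /backward; field.
    have h1 : 0 <= chi n s z * backward d As Az Azz s z by rewrite mulr_ge0// chi_ge0.
    have h2 : `|A s z * backward d (fun _ _ => 0) (chi_z n) (chi_zz n) s z| <=
        M * (C / n.+1%:R) by rewrite normrM ler_pM.
    have h3 : `|(z ^+ 2 - 1) * (Az s z * chi_z n s z)| <= M * (C / n.+1%:R).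
      apply: (@le_trans _ _ ((z * `|Az s z|) * (z * `|chi_z n s z|))); last first.
        by apply: ler_pM => //; rewrite mulr_ge0// ltW.
      rewrite normrM normrM mulrACA ler_wpM2r ?mulr_ge0//.
      by rewrite ger0_norm ?subr_ge0 ?exprn_ege1// -expr2 gerBl.
    have eK : K = M * (C / n.+1%:R) + M * (C / n.+1%:R) by rewrite /K; ring.
    move: h2 h3; rewrite !ler_norml => /andP[h2 _] /andP[h3 _].
    rewrite eK addrACA -[X in X <= _]addr0; apply: lerD.
      by rewrite -addrA addr_ge0// -lerBlDr sub0r.
    by rewrite -lerBlDr sub0r.
  apply: le_trans (subr_le_of_close ca cb h) _.
  by rewrite le_eqVlt; apply/orP; left; apply/eqP; rewrite /K; ring.
rewrite -subr_le0 leNgt; apply/negP => pos.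
set x := _ - _ in pos main; set L := _ + _ in main.
have := main (Num.truncn (L / x)); rewrite ler_pdivlMr// mulrC -ler_pdivlMr//.
by rewrite leNgt truncnS_gt.
Qed.

End NoncompactComparison.

(** * Gaussian profiles moving at the speed of the drift *)

Section GaussianProfiles.
Context {R : realType}.
Implicit Types (A As Az Azz : R -> R -> R) (s z u v w x y : R).

Lemma is_derive_gauss_density x :
  is_derive x 1 (@gauss_density R) (- x * gauss_density x).
Proof.
have d1 := is_derive_mulC (- 2^-1)
  (is_derive_mul (is_derive_id x 1) (is_derive_id x 1)).
have := is_derive_mulC (Num.sqrt (2 * pi))^-1 (is_derive_expRf d1).
have -> : (fun y : R => (Num.sqrt (2 * pi))^-1 * expR (- 2^-1 * (id y * id y))) =
    gauss_density.
  by apply/funext => y; rewrite /gauss_density; congr (_ * expR _); field.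
move=> d2; refine (is_derive_eq d2 _).
have e : expR (- 2^-1 * (id x * id x)) = expR (- (x ^+ 2) / 2).
  by congr expR; rewrite /=; field.
by rewrite e /gauss_density /=; field; rewrite gt_eqF// sqrtr_gt0 mulr_gt0// pi_gt0.
Qed.

Lemma is_derive_Phi_opp x :
  is_derive x 1 (fun y : R => Phi (- y)) (gauss_density x).
Proof.
refine (is_derive_eq (is_derive_comp_dir (is_deriveN (is_derive_id x 1))
  (is_derive_Phi _)) _).
by rewrite /= gauss_densityN mulrN1 opprK.
Qed.

(** The expected positive part [E (x + N)^+] for a standard normal [N], whose
    derivative is [P (N >= - x)]. *)
Definition call x : R := gauss_density x + x * Phi (- x).

Lemma is_derive_call x : is_derive x 1 call (Phi (- x)).
Proof.
refine (is_derive_eq (is_derive_add (is_derive_gauss_density x)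
  (is_derive_mul (is_derive_id x 1) (is_derive_Phi_opp x))) _).
by rewrite /=; ring.
Qed.

Lemma smooth_on_gauss_density {n} (D : set 'rV[R]_n) f : open D ->
  smooth_on D f -> smooth_on D (fun p => gauss_density (f p)).
Proof.
move=> oD sf; apply: smooth_onM => //; first exact: smooth_on_cst.
apply: smooth_on_expR => //; apply: smooth_onM => //; last exact: smooth_on_cst.
by apply: smooth_onN => //; exact: smooth_onX.
Qed.

Lemma smooth_on_Phi_opp {n} (D : set 'rV[R]_n) f : open D ->
  smooth_on D f -> smooth_on D (fun p => Phi (- f p)).
Proof.
move=> oD sf.
apply: (@smooth_on_comp _ _ _ oD f (fun y => Phi (- y)) gauss_density) => //.
- by move=> p _; exact: is_derive_Phi_opp.
- exact: smooth_on_gauss_density.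
Qed.

Lemma smooth_on_call {n} (D : set 'rV[R]_n) f : open D ->
  smooth_on D f -> smooth_on D (fun p => call (f p)).
Proof.
move=> oD sf; apply: smooth_onD => //; first exact: smooth_on_gauss_density.
by apply: smooth_onM => //; exact: smooth_on_Phi_opp.
Qed.

Variables (T0 z0 : R).
Hypothesis z0_ge0 : 0 <= z0.
Local Notation D := (profile_domain T0 z0).
Local Notation is_profile := (is_profile T0 z0).

Lemma is_profile_comp (g g1 g2 : R -> R) A As Az Azz :
  (forall x, is_derive x 1 g (g1 x)) -> (forall x, is_derive x 1 g1 (g2 x)) ->
  smooth_on D (fun p => g (A (p 0 0) (p 0 1))) ->
  is_profile A As Az Azz ->
  is_profile (fun s z => g (A s z)) (fun s z => g1 (A s z) * As s z)
    (fun s z => g1 (A s z) * Az s z)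
    (fun s z => g2 (A s z) * Az s z ^+ 2 + g1 (A s z) * Azz s z).
Proof.
move=> dg dg1 sg [sA A1 A2 A3]; split=> // s z sT zz.
- exact: is_derive_comp_dir (A1 _ _ sT zz) (dg _).
- exact: is_derive_comp_dir (A2 _ _ sT zz) (dg _).
- refine (is_derive_eq (is_derive_mul
    (is_derive_comp_dir (A2 _ _ sT zz) (dg1 _)) (A3 _ _ sT zz)) _).
  by rewrite /=; ring.
Qed.

(** For [z0 = 1] this would be the distance [arcosh z] to the pole, which is not
    smooth at [z = 1]. *)
Definition root z := Num.sqrt (z ^+ 2 - z0 ^+ 2).
Definition psi z := ln (z + root z).

Lemma root_gt0 z : z0 < z -> 0 < root z.
Proof. by move=> zz; rewrite sqrtr_gt0 subr_gt0 ltrXn2r// (le_trans z0_ge0)// ltW. Qed.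

Lemma root_sqr z : z0 <= z -> root z ^+ 2 = z ^+ 2 - z0 ^+ 2.
Proof.
move=> zz; rewrite sqr_sqrtr// subr_ge0 lerXn2r// nnegrE//.
exact: le_trans z0_ge0 zz.
Qed.

Lemma is_derive_root z : z0 < z -> is_derive z 1 root (z / root z).
Proof.
move=> zz; have rz := root_gt0 zz.
have pos : 0 < z ^+ 2 - z0 ^+ 2 by rewrite -sqrtr_gt0.
have d1 := is_derive_sub (is_derive_mul (is_derive_id z 1) (is_derive_id z 1))
  (is_derive_const (z0 ^+ 2) z 1).
refine (is_derive_eq (@is_derive_sqrtf _ _ (fun y : R => id y * id y - z0 ^+ 2) z 1 _
  _ d1) _) => //.
by rewrite /= -/(root z); field; rewrite gt_eqF.
Qed.

Lemma is_derive_psi z : z0 < z -> is_derive z 1 psi (root z)^-1.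
Proof.
move=> zz; have rz := root_gt0 zz; have z_gt0 := le_lt_trans z0_ge0 zz.
refine (is_derive_eq (@is_derive_lnf _ _ (fun y : R => id y + root y) z 1 _
  (addr_gt0 z_gt0 rz)
  (is_derive_add (is_derive_id z 1) (is_derive_root zz))) _).
by field; rewrite !gt_eqF// addr_gt0.
Qed.

Lemma smooth_on_psi : smooth_on D (fun p => psi (p 0 1)).
Proof.
have oD := @open_profile_domain R T0 z0.
have sz : smooth_on D (fun p : 'rV[R]_2 => p 0 1) by exact: smooth_on_coord.
apply: smooth_on_ln => //.
  by move=> p [_ zp]; rewrite addr_gt0 ?root_gt0// (le_lt_trans z0_ge0).
apply: smooth_onD => //; apply: smooth_on_sqrt => //.
  by move=> p [_ zp]; rewrite -sqrtr_gt0 root_gt0.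
by apply: smooth_onB => //; [exact: smooth_onX | exact: smooth_on_cst].
Qed.

Variables (m c : R).

(** Distance ahead of a front moving at speed [m], and the same distance in
    units of the standard deviation remaining at time [T0]. *)
Definition front s z := psi z - c + m * (T0 - s).
Definition zscore s z := front s z / Num.sqrt (T0 - s).

Lemma is_profile_sd : is_profile (fun s _ => Num.sqrt (T0 - s))
  (fun s _ => - (2 * Num.sqrt (T0 - s))^-1) (fun _ _ => 0) (fun _ _ => 0).
Proof.
have oD := @open_profile_domain R T0 z0.
split=> [|s z sT zz|s z _ _|s z _ _].
- apply: smooth_on_sqrt => //; first by move=> p [pT _]; rewrite subr_gt0.
  by apply: smooth_onB => //; [exact: smooth_on_cst | exact: smooth_on_coord].
- have pos : 0 < T0 - s by rewrite subr_gt0.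
  have d1 := is_derive_sub (is_derive_const T0 s 1) (is_derive_id s 1).
  refine (is_derive_eq (@is_derive_sqrtf _ _ (fun s : R => T0 - id s) s 1 _ pos d1) _).
  by rewrite /= sub0r mulrN1.
- exact: is_derive_const.
- exact: is_derive_const.
Qed.

Lemma is_profile_zscore : is_profile zscore
  (fun s z => - m / Num.sqrt (T0 - s) + front s z / (2 * (T0 - s) * Num.sqrt (T0 - s)))
  (fun s z => (Num.sqrt (T0 - s) * root z)^-1)
  (fun s z => - z / (Num.sqrt (T0 - s) * root z ^+ 3)).
Proof.
have oD := @open_profile_domain R T0 z0.
have sT0 : smooth_on D (fun p : 'rV[R]_2 => T0 - p 0 0).
  by apply: smooth_onB => //; [exact: smooth_on_cst | exact: smooth_on_coord].
split=> [|s z sT zz|s z sT zz|s z sT zz].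
- apply: smooth_onM => //.
    apply: smooth_onD => //; last by apply: smooth_onM => //; exact: smooth_on_cst.
    by apply: smooth_onB => //; [exact: smooth_on_psi | exact: smooth_on_cst].
  apply: smooth_onV => //.
    by move=> p [pT _]; rewrite gt_eqF// sqrtr_gt0 subr_gt0.
  by apply: smooth_on_sqrt => // p [pT _]; rewrite subr_gt0.
- have pos : 0 < T0 - s by rewrite subr_gt0.
  have sd0 : Num.sqrt (T0 - s) != 0 by rewrite gt_eqF// sqrtr_gt0.
  have d1 := is_derive_add (is_derive_const (psi z - c) s 1)
    (is_derive_mulC m (is_derive_sub (is_derive_const T0 s 1) (is_derive_id s 1))).
  refine (is_derive_eq (is_derive_mul d1
    (@is_derive_inv _ _ (fun s : R => Num.sqrt (T0 - s)) s 1 _ sd0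
      (profile_ds is_profile_sd sT zz))) _).
  have e : 2 * (T0 - s) * Num.sqrt (T0 - s) = 2 * Num.sqrt (T0 - s) ^+ 3.
    by rewrite -{1}(sqr_sqrtr (ltW pos)); ring.
  rewrite /= e -/(front s z); move: sd0; set sd := Num.sqrt _; set W := front s z.
  by move=> sd0; field.
- refine (is_derive_eq (is_derive_mul (is_derive_add (is_derive_sub
    (is_derive_psi zz) (is_derive_const c z 1)) (is_derive_const (m * (T0 - s)) z 1))
    (is_derive_const (Num.sqrt (T0 - s))^-1 z 1)) _).
  by rewrite invfM; ring.
- have pos : 0 < T0 - s by rewrite subr_gt0.
  have sd0 : Num.sqrt (T0 - s) != 0 by rewrite gt_eqF// sqrtr_gt0.
  have rz : root z != 0 by rewrite gt_eqF// root_gt0.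
  have r0 : Num.sqrt (T0 - s) * root z != 0 by rewrite mulf_neq0.
  refine (is_derive_eq (@is_derive_inv _ _
    (fun y : R => Num.sqrt (T0 - s) * root y) z 1 _ r0
    (is_derive_mulC (Num.sqrt (T0 - s)) (is_derive_root zz))) _).
  by field; rewrite rz sd0.
Qed.

(** The probability that a Brownian motion with drift [m], started at [psi z] at
    time [s], exceeds [c] at time [T0]. *)
Definition tail s z := Phi (- zscore s z).

Definition tail_s s z := gauss_density (zscore s z) *
  (- m / Num.sqrt (T0 - s) + front s z / (2 * (T0 - s) * Num.sqrt (T0 - s))).
Definition tail_z s z := gauss_density (zscore s z) * (Num.sqrt (T0 - s) * root z)^-1.
Definition tail_zz s z :=
  - zscore s z * gauss_density (zscore s z) * (Num.sqrt (T0 - s) * root z)^-1 ^+ 2 +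
  gauss_density (zscore s z) * (- z / (Num.sqrt (T0 - s) * root z ^+ 3)).

Lemma is_profile_tail : is_profile tail tail_s tail_z tail_zz.
Proof.
have sA := smooth_on_Phi_opp (@open_profile_domain R T0 z0)
  (profile_smooth is_profile_zscore).
exact: (@is_profile_comp (fun y => Phi (- y)) (@gauss_density R)
  (fun y => - y * gauss_density y) zscore _ _ _ is_derive_Phi_opp
  is_derive_gauss_density sA is_profile_zscore).
Qed.

End GaussianProfiles.

(** * The smoothed tail profile is a subsolution *)

Section TailSubsolution.
Context {R : realType}.
Implicit Types (s t z x y : R).

Lemma le_gauss_density x y : `|x| <= `|y| -> gauss_density y <= gauss_density x.
Proof.
move=> xy; rewrite ler_wpM2l ?invr_ge0 ?sqrtr_ge0// ler_expR ler_wpM2r//.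
by rewrite lerN2 -(real_normK (num_real x)) -(real_normK (num_real y)) lerXn2r ?nnegrE.
Qed.

Variables (d : nat) (m e T0 c : R).
Hypotheses (dm : d%:R = 2 * m + 1) (m_gt0 : 0 < m) (e_gt0 : 0 < e) (e_le : e <= 2^-1).

(** The value of [z0] for which [root z = sqrt (z^2 - 1 + e^2)]. *)
Definition cap : R := Num.sqrt (1 - e ^+ 2).
Local Notation z0 := cap.

Let e2_le : e ^+ 2 <= 4^-1.
Proof.
apply: le_trans (_ : (2^-1) ^+ 2 <= _); last lra.
by rewrite lerXn2r ?nnegrE// ltW.
Qed.

Lemma cap_ge0 : 0 <= z0. Proof. exact: sqrtr_ge0. Qed.

Lemma cap_sqr : z0 ^+ 2 = 1 - e ^+ 2.
Proof. by rewrite sqr_sqrtr// subr_ge0 (le_trans e2_le)//; lra. Qed.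

Lemma cap_lt1 : z0 < 1.
Proof.
rewrite -(@ltr_pXn2r _ 2)// ?nnegrE ?cap_ge0// cap_sqr expr1n.
by rewrite ltrBlDr ltrDl exprn_gt0.
Qed.

Local Notation root := (root z0).
Local Notation psi := (psi z0).
Local Notation tail := (tail T0 z0 m c).
Local Notation tail_s := (tail_s T0 z0 m c).
Local Notation tail_z := (tail_z T0 z0 m c).
Local Notation tail_zz := (tail_zz T0 z0 m c).
Local Notation front := (front T0 z0 m c).
Local Notation zscore := (zscore T0 z0 m c).

Lemma cap_root_gt0 z : 1 <= z -> 0 < root z.
Proof. by move=> z1; rewrite root_gt0 ?cap_ge0// (lt_le_trans cap_lt1). Qed.

Lemma cap_root_sqr z : 1 <= z -> root z ^+ 2 = z ^+ 2 - 1 + e ^+ 2.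
Proof.
move=> z1; rewrite (root_sqr cap_ge0) ?cap_sqr; first by ring.
by rewrite ltW// (lt_le_trans cap_lt1).
Qed.

Lemma cap_root_le z : 1 <= z -> root z <= z.
Proof.
move=> z1; have z_gt0 := lt_le_trans ltr01 z1.
rewrite -(@ler_pXn2r _ 2)// ?nnegrE ?(ltW (cap_root_gt0 z1)) ?ltW// cap_root_sqr//.
have := e2_le; lra.
Qed.

Lemma cap_root_ge z : 1 <= z -> e * z <= root z.
Proof.
move=> z1; have z_gt0 := lt_le_trans ltr01 z1.
have ez : 0 <= e * z by rewrite mulr_ge0 ?ltW.
have r0 := ltW (cap_root_gt0 z1).
rewrite -ler_sqr ?nnegrE// (cap_root_sqr z1) -subr_ge0.
have -> : z ^+ 2 - 1 + e ^+ 2 - (e * z) ^+ 2 = (z ^+ 2 - 1) * (1 - e ^+ 2) by ring.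
apply: mulr_ge0; rewrite subr_ge0; first exact: exprn_ege1.
by rewrite (le_trans e2_le)//; lra.
Qed.

Lemma cap_psi_ge0 z : 1 <= z -> 0 <= psi z.
Proof. by move=> z1; rewrite ln_ge0// ler_wpDr// ltW// cap_root_gt0. Qed.

Lemma cap_psi_le z : 1 <= z -> psi z <= 1 + ln z.
Proof.
move=> z1; have z_gt0 := lt_le_trans ltr01 z1.
have rz := cap_root_gt0 z1.
rewrite -[X in X + _](expRK 1) -lnM ?posrE ?expR_gt0// ler_ln ?posrE ?addr_gt0//.
  rewrite (le_trans (_ : _ <= 2 * z))//; first by have := cap_root_le z1; lra.
  by rewrite ler_pM2r// -natr1 addrC; exact: expR_ge1Dx.
by rewrite mulr_gt0 ?expR_gt0.
Qed.

(** The second order terms cancel up to the correction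
    [(z^2 - 1) / root z ^ 2 = 1 - e^2 / root z ^ 2] due to the regularisation;
    what remains is the excess of the drift over [m]. *)
Lemma backward_tail s z : s < T0 -> 1 <= z ->
  backward d tail_s tail_z tail_zz s z =
  gauss_density (zscore s z) / Num.sqrt (T0 - s) *
  (z / root z * (m + e ^+ 2 / root z ^+ 2 / 2) - m +
   e ^+ 2 / root z ^+ 2 * front s z / (2 * (T0 - s))).
Proof.
move=> sT z1; have pos : 0 < T0 - s by rewrite subr_gt0.
have := cap_root_gt0 z1; have := cap_root_sqr z1; move=> rr rz.
have sd0 : 0 < Num.sqrt (T0 - s) by rewrite sqrtr_gt0.
rewrite /backward /tail_s /tail_z /tail_zz dm; set g := gauss_density _.
have -> : zscore s z = front s z / Num.sqrt (T0 - s) by [].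
have -> : z ^+ 2 - 1 = root z ^+ 2 - e ^+ 2 by rewrite rr; ring.
have e2 : T0 - s = Num.sqrt (T0 - s) ^+ 2 by rewrite sqr_sqrtr// ltW.
move: g sd0 rz e2 (front s z); set sd := Num.sqrt _; set r := root z.
move=> g sd0 rz -> W.
by field; rewrite !gt_eqF.
Qed.

(** The only possibly negative term carries the sign of the front. Where the
    front is negative it is at least [- |c|], since [psi] is nonnegative, so the
    term is of order [e |c| / del^2] relative to the excess drift; this is where
    [e] must be small compared with [del^2]. *)
Lemma backward_tail_ge del s z : 0 < del -> del ^+ 2 <= T0 - s ->
  4 * e * `|c| <= m * del ^+ 2 -> 1 <= z ->
  gauss_density (zscore s z) / Num.sqrt (T0 - s) * (m / (4 * z ^+ 2)) <=
  backward d tail_s tail_z tail_zz s z.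
Proof.
move=> del_gt0 hv small z1; have z_gt0 := lt_le_trans ltr01 z1.
have d2 : 0 < del ^+ 2 by rewrite exprn_gt0.
have v_gt0 : 0 < T0 - s by exact: lt_le_trans hv.
have sT : s < T0 by rewrite -subr_gt0.
rewrite backward_tail// ler_wpM2l//.
  by rewrite divr_ge0 ?sqrtr_ge0// ltW// gauss_density_gt0.
have rz := cap_root_gt0 z1; have rle := cap_root_le z1; have rge := cap_root_ge z1.
have rr := cap_root_sqr z1; have psi0 := cap_psi_ge0 z1.
set r := root z in rz rle rge rr *; set v := T0 - s in v_gt0 hv *.
have zr : 0 < (z * r)^-1 by rewrite invr_gt0 mulr_gt0.
have h1 : m * (3 / 8) * (z * r)^-1 <= m * (z / r) - m.
  have -> : m * (z / r) - m = m * (1 - e ^+ 2) * (r * (z + r))^-1.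
    have -> : 1 - e ^+ 2 = z ^+ 2 - r ^+ 2 by rewrite rr; ring.
    by field; rewrite !gt_eqF// addr_gt0.
  have -> : m * (3 / 8) * (z * r)^-1 = m * (3 / 4) * (r * (2 * z))^-1.
    by field; rewrite !gt_eqF.
  have k0 : 0 <= m * (3 / 4) by rewrite mulr_ge0 ?ltW.
  have k1 : m * (3 / 4) <= m * (1 - e ^+ 2).
    by rewrite ler_pM2l//; have := e2_le; lra.
  apply: ler_pM => //; first by rewrite invr_ge0 !mulr_ge0 ?ltW.
  by rewrite lef_pV2 ?posrE ?mulr_gt0 ?addr_gt0// ler_pM2l//; lra.
have h2 : 0 <= z / r * (e ^+ 2 / r ^+ 2 / 2).
  by rewrite !mulr_ge0 ?invr_ge0 ?sqr_ge0// ltW.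
have h3 : - (m / 8 * (z * r)^-1) <= e ^+ 2 / r ^+ 2 * front s z / (2 * v).
  have fr : - `|c| <= front s z.
    have : 0 <= m * v by rewrite mulr_ge0 ?ltW.
    have := ler_norm c; rewrite /front -/v; lra.
  apply: (@le_trans _ _ (e ^+ 2 / r ^+ 2 * - `|c| / (2 * v))); last first.
    rewrite ler_pM2r ?invr_gt0 ?mulr_gt0// ler_wpM2l//.
    by rewrite divr_ge0 ?sqr_ge0// ltW// exprn_gt0.
  rewrite mulrN mulNr lerN2 -mulrA.
  have -> : m / 8 * (z * r)^-1 = e / (z * r) * (m / (8 * e)) by field; rewrite !gt_eqF.
  apply: ler_pM.
  - by rewrite divr_ge0 ?sqr_ge0.
  - by rewrite divr_ge0// mulr_ge0 ?ltW.
  - rewrite ler_pdivrMr ?exprn_gt0//.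
    have -> : e / (z * r) * r ^+ 2 = e * (r / z) by field; rewrite !gt_eqF.
    by rewrite expr2 ler_pM2l// ler_pdivlMr.
  - rewrite ler_pdivrMr ?mulr_gt0//.
    have -> : m / (8 * e) * (2 * v) = m * v / (4 * e) by field; rewrite gt_eqF.
    rewrite ler_pdivlMr ?mulr_gt0// mulrC (le_trans small)//.
    by rewrite ler_pM2l.
have h4 : m / (4 * z ^+ 2) <= m / 4 * (z * r)^-1.
  rewrite invfM mulrA ler_pM2l ?divr_gt0// lef_pV2 ?posrE ?mulr_gt0 ?exprn_gt0//.
  by rewrite expr2 ler_pM2l.
move: h2; set q := e ^+ 2 / r ^+ 2 in h3 *; set F := _ / (2 * v) in h3 *.
have -> : z / r * (m + q / 2) = m * (z / r) + z / r * (q / 2) by ring.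
move: h1 h3 h4; set A1 := m * (z / r); set A2 := z / r * (q / 2); set A3 := m / (4 * _).
move: (z * r)^-1 => i; lra.
Qed.

Lemma backward_tail_ge0 del s z : 0 < del -> del ^+ 2 <= T0 - s ->
  4 * e * `|c| <= m * del ^+ 2 -> 1 <= z ->
  0 <= backward d tail_s tail_z tail_zz s z.
Proof.
move=> del_gt0 hv small z1.
apply: le_trans (backward_tail_ge del_gt0 hv small z1).
have g0 := ltW (gauss_density_gt0 (zscore s z)).
apply: mulr_ge0; apply: divr_ge0; rewrite ?sqrtr_ge0 ?(ltW m_gt0)//.
by rewrite mulr_ge0 ?sqr_ge0.
Qed.

Lemma normr_tail_le1 s z : `|tail s z| <= 1.
Proof. by rewrite ger0_norm ?Phi_ge0// Phi_le1. Qed.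

Lemma tail_z_le del s z : 0 < del -> del ^+ 2 <= T0 - s -> 1 <= z ->
  z * `|tail_z s z| <= (del * e)^-1.
Proof.
move=> del_gt0 hv z1; have z_gt0 := lt_le_trans ltr01 z1.
have rz := cap_root_gt0 z1; have rge := cap_root_ge z1.
have sd : del <= Num.sqrt (T0 - s).
  by rewrite -[leLHS](ger0_norm (ltW del_gt0)) -sqrtr_sqr ler_wsqrtr.
have sd0 := lt_le_trans del_gt0 sd.
have g0 := gauss_density_gt0 (zscore s z); have g1 := gauss_density_le1 (zscore s z).
have i0 : 0 <= (Num.sqrt (T0 - s) * root z)^-1 by rewrite invr_ge0 mulr_ge0 ?ltW.
rewrite /tail_z normrM (gtr0_norm g0) (ger0_norm i0).
apply: (@le_trans _ _ (z * (Num.sqrt (T0 - s) * root z)^-1)).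
  by rewrite ler_pM2l// ler_piMl.
rewrite ler_pdivrMr ?mulr_gt0// mulrC ler_pdivlMr ?mulr_gt0//.
have -> : z * (del * e) = del * (e * z) by ring.
by apply: ler_pM => //; [exact: ltW | rewrite mulr_ge0 ?ltW].
Qed.

End TailSubsolution.

(** * The gain over the central limit approximation *)

Section TailGain.
Context {R : realType}.
Variables (d : nat) (m : R).
Hypotheses (dm : d%:R = 2 * m + 1) (m_gt0 : 0 < m).
Implicit Types (s t z e del : R).

Section Process.
Context {dO : measure_display} {Omega : measurableType dO}.
Context {X : R -> Omega -> 'rV[R]_d} {P : 'rV[R]_d -> probability Omega R}.
Hypothesis hX : hyperbolic_brownian_motion X P.
Local Notation mean := (@mean R dO Omega d X P).

Lemma bounded_continuous_tail e t del c s : 0 < e -> e <= 2^-1 -> s < t + del ^+ 2 ->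
  bounded_continuous (fun x : 'rV[R]_d => tail (t + del ^+ 2) (cap e) m c s (cosh_dist x)).
Proof.
move=> e0 e1 sT; split; last by exists 1 => x; exact: normr_tail_le1.
exact: (continuous_profile (cap_lt1 e0 e1) (is_profile_tail _ (cap_ge0 e) _ _)).
Qed.

Lemma mean_tail_le e t del c a b : 0 < e -> e <= 2^-1 -> 0 < del ->
  4 * e * `|c| <= m * del ^+ 2 -> 0 <= a -> a <= b -> b <= t ->
  mean a (fun x => tail (t + del ^+ 2) (cap e) m c a (cosh_dist x)) <=
  mean b (fun x => tail (t + del ^+ 2) (cap e) m c b (cosh_dist x)).
Proof.
move=> e0 e1 del0 small a0 ab bt.
have pt := is_profile_tail (t + del ^+ 2) (cap_ge0 e) m c.
have hv s : a <= s <= b -> del ^+ 2 <= t + del ^+ 2 - s.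
  by case/andP=> _ sb; rewrite addrAC lerDr subr_ge0 (le_trans sb).
apply: (compare hX (M := 1 + (del * e)^-1) (cap_ge0 e) (cap_lt1 e0 e1) pt) => //.
- by rewrite (le_lt_trans bt)// ltrDl exprn_gt0.
- move=> s z _ _; rewrite (le_trans (normr_tail_le1 _ _ _ _ _ _))// lerDl.
  by rewrite invr_ge0 mulr_ge0 ?ltW.
- move=> s z sab z1.
  by rewrite (le_trans (tail_z_le m c e0 e1 del0 (hv s sab) z1))// lerDr.
- move=> s z sab z1; exact: (backward_tail_ge0 dm m_gt0 e0 e1 del0 (hv s sab)).
Qed.

End Process.

(** The profile [tail + kap (1/2 - s) chi n] starts [kap / 2] higher than [tail] and
    meets it at time [1/2]. It is still a subsolution up to the cutoff errors:
    the term [- kap chi n] in its defect is compensated by the excess drift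
    wherever [chi n] does not vanish. *)
Lemma tail_gain : exists2 k : R, 0 < k &
  forall dO (Omega : measurableType dO) (X : R -> Omega -> 'rV[R]_d)
    (P : 'rV[R]_d -> probability Omega R), hyperbolic_brownian_motion X P ->
  forall t e del eta, 1 <= t -> 0 < e -> e <= 2^-1 -> 0 < del -> del <= 1 ->
    0 <= eta -> eta <= 1 ->
    let c := m * t + eta + m * del ^+ 2 in
    4 * e * `|c| <= m * del ^+ 2 ->
  tail (t + del ^+ 2) (cap e) m c 0 1 + k / Num.sqrt t <=
  @mean R dO Omega d X P t
    (fun x => tail (t + del ^+ 2) (cap e) m c t (cosh_dist x)).
Proof.
have [C C0 hC] := @chi_bounds R d.
(* With [C <= n.+1] the cutoff errors consume at most half of the initial gain. *)
pose n := Num.truncn C.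
have N_gt0 : 0 < n.+1%:R :> R by [].
have CN : C / n.+1%:R <= 1 by rewrite ler_pdivrMr// mul1r ltW// truncnS_gt.
(* [L] bounds the front on the support of the cutoff, up to time [1/2]. *)
pose L : R := n.+1%:R + m + 2.
pose k0 : R := gauss_density (2 * L) / 2 * (m / (4 * expR n.+1%:R ^+ 2)).
have k0_gt0 : 0 < k0.
  have g0 := gauss_density_gt0 (2 * L).
  have x0 : 0 < 4 * expR n.+1%:R ^+ 2 :> R by rewrite mulr_gt0// exprn_gt0// expR_gt0.
  exact: mulr_gt0 (divr_gt0 g0 _) (divr_gt0 m_gt0 x0).
exists (k0 / 4); first by rewrite divr_gt0.
move=> dO Omega X P hX t e del eta t1 e0 e1 del0 del1 eta0 eta1 c small.
have t_gt0 : 0 < t := lt_le_trans ltr01 t1.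
have st : 0 < Num.sqrt t by rewrite sqrtr_gt0.
pose T0 := t + del ^+ 2.
have d21 : del ^+ 2 <= 1 by rewrite exprn_ile1// ltW.
have d20 : 0 < del ^+ 2 by rewrite exprn_gt0.
pose kap := k0 / Num.sqrt t.
have kap0 : 0 < kap by rewrite divr_gt0.
have local_gain s z : 0 <= s <= 2^-1 -> 1 <= z -> z <= expR n.+1%:R ->
    kap <= backward d (tail_s T0 (cap e) m c) (tail_z T0 (cap e) m c)
             (tail_zz T0 (cap e) m c) s z.
  case/andP=> s0 s1 z1 zN; have z_gt0 := lt_le_trans ltr01 z1.
  have hv : del ^+ 2 <= T0 - s by rewrite /T0; lra.
  apply: le_trans (backward_tail_ge dm m_gt0 e0 e1 del0 hv small z1).
  have vge : 2^-1 <= T0 - s by rewrite /T0; lra.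
  have vle : T0 - s <= 4 * t by rewrite /T0; lra.
  have sd_ge : 2^-1 <= Num.sqrt (T0 - s).
    rewrite -ler_sqr ?nnegrE ?sqrtr_ge0// (@sqr_sqrtr _ (T0 - s)); last lra.
    by apply: le_trans vge; lra.
  have sd_le : Num.sqrt (T0 - s) <= 2 * Num.sqrt t.
    rewrite -ler_sqr ?nnegrE ?sqrtr_ge0 ?mulr_ge0 ?sqrtr_ge0//.
    rewrite exprMn (@sqr_sqrtr _ (T0 - s)); last lra.
    by rewrite (sqr_sqrtr (ltW t_gt0)) (le_trans vle)// ler_pM2r//; lra.
  have sd0 : 0 < Num.sqrt (T0 - s) by lra.
  have frE : front T0 (cap e) m c s z = psi (cap e) z - eta - m * s.
    by rewrite /front /c /T0; ring.
  have lz : ln z <= n.+1%:R by rewrite -[leRHS]expRK ler_ln// ?posrE// expR_gt0.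
  have p0 := cap_psi_ge0 e0 e1 z1; have p1 := cap_psi_le e0 e1 z1.
  have ms0 : 0 <= m * s by exact: mulr_ge0 (ltW m_gt0) s0.
  have ms1 : m * s <= m by rewrite ler_piMr ?(ltW m_gt0)//; lra.
  have frL : `|front T0 (cap e) m c s z| <= L.
    rewrite frE ler_norml /L; apply/andP; split; lra.
  have zsL : `|zscore T0 (cap e) m c s z| <= `|2 * L|.
    rewrite (le_trans _ (ler_norm _))// normrM normfV (gtr0_norm sd0).
    rewrite ler_pdivrMr// (le_trans frL)//.
    have L0 : 0 <= L by exact: le_trans frL.
    have -> : 2 * L * Num.sqrt (T0 - s) = L * (2 * Num.sqrt (T0 - s)) by ring.
    by rewrite ler_peMr//; lra.
  have g := le_gauss_density zsL.
  have -> : kap = gauss_density (2 * L) / (2 * Num.sqrt t) *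
      (m / (4 * expR n.+1%:R ^+ 2)).
    by rewrite /kap /k0; field; rewrite !gt_eqF ?expR_gt0.
  have gl0 := ltW (gauss_density_gt0 (2 * L)).
  apply: ler_pM.
  - by rewrite divr_ge0// mulr_ge0// ltW.
  - by rewrite divr_ge0 ?(ltW m_gt0)// mulr_ge0 ?sqr_ge0.
  - apply: ler_pM => //.
    by rewrite lef_pV2 ?posrE ?mulr_gt0.
  - rewrite ler_pM2l// lef_pV2 ?posrE ?mulr_gt0 ?exprn_gt0 ?expR_gt0//.
    by rewrite ler_pM2l// lerXn2r ?nnegrE ?expR_ge0 ?(ltW z_gt0).
pose K := kap / 2 * (C / n.+1%:R).
have K0 : 0 < K by rewrite mulr_gt0 ?divr_gt0.
have half0 : 0 <= 2^-1 :> R by [].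
have half_t : 2^-1 <= t by lra.
have half_T : 2^-1 < T0 by rewrite /T0; lra.
have pt := is_profile_tail T0 (cap_ge0 e) m c.
have pA := is_profile_add (is_profile_add pt (is_profile_mul
  (is_profile_affine T0 (cap e) (kap / 2) (- kap))
  (@is_profile_chi R T0 (cap e) n (cap_ge0 e)))) (is_profile_affine T0 (cap e) 0 K).
have early := compare hX (M := 1 + (del * e)^-1 + kap + K + kap * C) (cap_ge0 e)
  (cap_lt1 e0 e1) pA (lexx 0) half0 half_T.
have late := mean_tail_le hX e0 e1 del0 small half0 half_t (lexx t).
apply: le_trans late.
have bct s : s <= 2^-1 -> bounded_continuous
    (fun x : 'rV[R]_d => tail T0 (cap e) m c s (cosh_dist x)).
  by move=> sh; apply: bounded_continuous_tail => //; exact: le_lt_trans half_T.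
have de0 : 0 < (del * e)^-1 by rewrite invr_gt0 mulr_gt0.
have kC0 : 0 < kap * C by rewrite mulr_gt0.
have coef s : 0 <= s <= 2^-1 -> 0 <= kap / 2 + - kap * s <= kap / 2.
  case/andP=> s0 s1.
  have : kap * s <= kap * 2^-1 by rewrite ler_pM2l.
  have : 0 <= kap * s by exact: mulr_ge0 (ltW kap0) s0.
  by move=> ? ?; apply/andP; split; lra.
have Ks s : 0 <= s <= 2^-1 -> 0 <= K * s <= K.
  by case/andP=> s0 s1; rewrite (mulr_ge0 (ltW K0) s0)/= ler_piMr ?(ltW K0)//; lra.
move: early; rewrite (mean_pole hX); last first.
  by apply: (continuous_profile (cap_lt1 e0 e1) pA); rewrite /T0; lra.
rewrite cosh_dist_pole chi_one.
have -> : (fun x : 'rV[R]_d => tail T0 (cap e) m c 2^-1 (cosh_dist x) +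
    (kap / 2 + - kap * 2^-1) * chi n 2^-1 (cosh_dist x) + (0 + K * 2^-1)) =
    (fun x => tail T0 (cap e) m c 2^-1 (cosh_dist x) + K * 2^-1).
  by apply/funext => x; ring.
rewrite (meanD hX) ?mean_cst//; last 2 first.
- exact: bct.
- exact: bounded_continuous_cst.
move=> early.
have Kle : K <= kap / 2 by rewrite ler_piMr// ltW// divr_gt0.
suff : tail T0 (cap e) m c 0 1 + (kap / 2 + - kap * 0) * 1 + (0 + K * 0) <=
    @mean R dO Omega d X P 2^-1 (fun x => tail T0 (cap e) m c 2^-1 (cosh_dist x)) + K * 2^-1.
  have -> : k0 / 4 / Num.sqrt t = kap / 4 by rewrite /kap; field; rewrite gt_eqF.
  lra.
have hv s : 0 <= s <= 2^-1 -> del ^+ 2 <= T0 - s by case/andP=> s0 s1; rewrite /T0; lra.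
apply: early => s z sab z1; have z_gt0 := lt_le_trans ltr01 z1.
- have c0 := chi_ge0 n s z; have c1 := chi_le1 n s z1.
  have /andP[a0 a1] := coef s sab; have /andP[b0 b1] := Ks s sab.
  have := normr_tail_le1 m e T0 c s z; move: (tail _ _ _ _ _ _) => T hT.
  have ac0 := mulr_ge0 a0 c0.
  have ac1 : (kap / 2 + - kap * s) * chi n s z <= kap / 2.
    by rewrite -[leRHS]mulr1 ler_pM.
  move: hT ac0 ac1; set u := _ * chi n s z; rewrite !ler_norml => /andP[? ?] ? ?.
  by apply/andP; split; lra.
- have /andP[a0 a1] := coef s sab.
  have h1 := tail_z_le m c e0 e1 del0 (hv s sab) z1.
  have [h2 _] := hC n s z z1.
  rewrite mulr0 !addr0 (le_trans (ler_wpM2l (ltW z_gt0) (ler_normD _ _)))//.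
  rewrite mulrDr (normrM (kap / 2 + - kap * s)) (ger0_norm a0) (mulrCA z).
  have : (kap / 2 + - kap * s) * (z * `|chi_z n s z|) <= kap / 2 * 1.
    apply: ler_pM => //; first by rewrite mulr_ge0// ltW.
    exact: le_trans CN.
  move: h1; set h := z * `|tail_z _ _ _ _ _ _|; set h' := (del * e)^-1.
  by set u := _ * (z * _); lra.
- have c0 := chi_ge0 n s z; have c1 := chi_le1 n s z1.
  have /andP[a0 a1] := coef s sab.
  have [_ h2] := hC n s z z1.
  have W0 := backward_tail_ge0 dm m_gt0 e0 e1 del0 (hv s sab) small z1.
  have WL := local_gain s z sab z1.
  have -> : backward d
     (fun s0 z0 => tail_s T0 (cap e) m c s0 z0 +
        ((kap / 2 + - kap * s0) * 0 + chi n s0 z0 * - kap) + K)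
     (fun s0 z0 => tail_z T0 (cap e) m c s0 z0 +
        ((kap / 2 + - kap * s0) * chi_z n s0 z0 + chi n s0 z0 * 0) + 0)
     (fun s0 z0 => tail_zz T0 (cap e) m c s0 z0 +
        ((kap / 2 + - kap * s0) * chi_zz n s0 z0 + 2 * 0 * chi_z n s0 z0 +
         chi n s0 z0 * 0) + 0) s z =
     (backward d (tail_s T0 (cap e) m c) (tail_z T0 (cap e) m c)
        (tail_zz T0 (cap e) m c) s z - kap * chi n s z) +
     ((kap / 2 + - kap * s) *
       backward d (fun _ _ => 0) (chi_z n) (chi_zz n) s z + K).
    by rewrite /backward; field.
  apply: addr_ge0.
    rewrite subr_ge0; have [zN|/ltW zN] := leP z (expR n.+1%:R).
      by rewrite (le_trans _ (WL zN))// ler_piMr// ltW.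
    by rewrite chi_eq0// mulr0.
  rewrite -lerBlDr sub0r; apply: le_trans (_ : - (kap / 2 * (C / n.+1%:R)) <= _) _ => //.
  have : `|(kap / 2 + - kap * s) *
      backward d (fun _ _ => 0) (chi_z n) (chi_zz n) s z| <= K.
    by rewrite normrM (ger0_norm a0) ler_pM.
  by rewrite ler_norml => /andP[].
Qed.

End TailGain.

(** * Tail probabilities of the radial part *)

Section RadialTail.
Context {R : realType} {dO : measure_display} {Omega : measurableType dO}.
Context {d : nat} {X : R -> Omega -> 'rV[R]_d}.
Context {P : 'rV[R]_d -> probability Omega R}.
Hypothesis hX : hyperbolic_brownian_motion X P.
Implicit Types (t a eps : R) (f : 'rV[R]_d -> R).
Local Notation mean := (@mean R dO Omega d X P).

Definition far_prob t a : R := fine (P pole [set w | a <= enorm (X t w)]).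

Lemma radial_tailE t x : 0 < t ->
  radial_tail X P t x = far_prob t ((d%:R - 1) * t / 2 + x * Num.sqrt t).
Proof.
move=> t0; rewrite /radial_tail /far_prob; congr (fine (P pole _)).
apply/seteqP; split=> w /=; rewrite /radial_part hyperbolic_distance_pole;
  by rewrite ler_pdivlMr ?sqrtr_gt0// lerBrDl.
Qed.

Lemma continuous_enorm : continuous (@enorm R d).
Proof.
move=> x; apply: (@continuous_comp _ _ _ (fun x : 'rV[R]_d => dotv x x) Num.sqrt);
  last exact: sqrt_continuous.
have sd : smooth_on [set: 'rV[R]_d] (fun x => dotv x x) by apply: smooth_on_dotv; exact: openT.
exact: (smooth_upto_continuous (sd 0%N)).
Qed.

Lemma measurable_far t a : 0 <= t -> measurable [set w | a <= enorm (X t w)].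
Proof.
move=> t0; rewrite -[X in measurable X]setCK; apply: measurableC.
have -> : ~` [set w | a <= enorm (X t w)] = X t @^-1` [set x | enorm x < a].
  apply/seteqP; split=> w /=; first by move=> /negP; rewrite -ltNge.
  by rewrite ltNge => /negP.
apply: (diffusion_measurable hX) => //.
have /continuousP/(_ [set y | y < a]) := continuous_enorm; apply.
exact: open_lt.
Qed.

Let integrable_far t a b : 0 <= t -> (P pole).-integrable setT
  (EFin \o (fun w => \1_[set w | a <= enorm (X t w)] w + b)).
Proof.
move=> t0; have i1 := integrable_indic (P pole) (measurable_far a t0).
have i2 := finite_measure_integrable_cst (P pole) b (@measurableT _ Omega).
exact: (integrableD measurableT i1 i2).
Qed.

Let integral_far t a b : 0 <= t ->
  \int[P pole]_w (\1_[set w | a <= enorm (X t w)] w + b) = far_prob t a + b.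
Proof.
move=> t0; rewrite RintegralD//; last 2 first.
- exact: integrable_indic (measurable_far a t0).
- exact: finite_measure_integrable_cst.
rewrite Rintegral_cst//= probability_setT mulr1; congr (_ + _).
have mE := measurable_far a t0.
by rewrite /Rintegral integral_indic// setIT.
Qed.

Lemma mean_le_far_prob t a eps f : 0 <= t -> 0 <= eps -> bounded_continuous f ->
  (forall x, f x <= 1) -> (forall x, enorm x < a -> f x <= eps) ->
  mean t f <= far_prob t a + eps.
Proof.
move=> t0 eps0 [cf [K fK]] f1 feps; rewrite -integral_far//.
apply: le_Rintegral => //.
- exact: (integrable_observable hX t0 cf fK).
- exact: integrable_far.
move=> w _; rewrite indicE; have [wa|wa] := leP a (enorm (X t w)).
  by rewrite mem_set//= (le_trans (f1 _))// lerDl.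
rewrite memNset/=; last by apply/negP; rewrite -ltNge.
by rewrite add0r; exact: feps.
Qed.

Lemma far_prob_le_mean t a eps f : 0 <= t -> 0 <= eps -> bounded_continuous f ->
  (forall x, 0 <= f x) -> (forall x, a <= enorm x -> 1 - eps <= f x) ->
  far_prob t a - eps <= mean t f.
Proof.
move=> t0 eps0 [cf [K fK]] f0 feps; rewrite -integral_far//.
apply: le_Rintegral => //.
- exact: integrable_far.
- exact: (integrable_observable hX t0 cf fK).
move=> w _; rewrite indicE; have [wa|wa] := leP a (enorm (X t w)).
  by rewrite mem_set//=; exact: feps.
rewrite memNset/=; last by apply/negP; rewrite -ltNge.
by rewrite add0r (le_trans _ (f0 _))// oppr_le0.
Qed.

End RadialTail.

Section PsiDistance.
Context {R : realType} {d : nat}.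
Implicit Types (x : 'rV[R]_d) (z e : R).

Lemma cosh_dist_sqr x : cosh_dist x ^+ 2 - 1 = sinh (enorm x) ^+ 2.
Proof.
have := cosh_dist_sum x; set c := cosh_dist x; set r := enorm x => h.
have -> : c = expR r - sinh r by rewrite -h addrK.
rewrite /sinh expRN; field; rewrite gt_eqF ?expR_gt0//.
Qed.

Lemma sinh_enorm_ge0 x : 0 <= sinh (enorm x).
Proof.
have r0 : 0 <= enorm x by exact: sqrtr_ge0.
by rewrite divr_ge0// subr_ge0 ler_expR (le_trans _ r0)// oppr_le0.
Qed.

(** The function [psi] is [arcosh] up to an additive error. *)
Lemma enorm_le_psi z0 x : 0 <= z0 -> z0 <= 1 -> enorm x <= psi z0 (cosh_dist x).
Proof.
move=> z00 z01; rewrite -[leLHS]expRK ler_ln ?posrE ?expR_gt0//; last first.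
  rewrite ltr_wpDr ?sqrtr_ge0// (lt_le_trans ltr01)//; exact: cosh_dist_ge1.
rewrite -cosh_dist_sum lerD2l -[leLHS](ger0_norm (sinh_enorm_ge0 x)) -sqrtr_sqr.
by rewrite ler_wsqrtr// -cosh_dist_sqr lerB// exprn_ile1.
Qed.

Lemma psi_le_enorm e x : 0 < e -> e <= 2^-1 ->
  psi (cap e) (cosh_dist x) <= enorm x + e.
Proof.
move=> e0 e1; have c1 := cosh_dist_ge1 x.
have r0 : 0 <= enorm x by exact: sqrtr_ge0.
have rt := cap_root_gt0 e0 e1 c1.
have pos : 0 < cosh_dist x + root (cap e) (cosh_dist x).
  by rewrite addr_gt0// (lt_le_trans ltr01).
rewrite -[leRHS]expRK ler_ln ?posrE ?expR_gt0//.
have rle : root (cap e) (cosh_dist x) <= sinh (enorm x) + e.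
  rewrite -ler_sqr ?nnegrE ?(ltW rt)//; last by rewrite addr_ge0 ?sinh_enorm_ge0 ?ltW.
  rewrite (cap_root_sqr e0 e1 c1) cosh_dist_sqr sqrrD lerD2r lerDl.
  by rewrite mulrn_wge0// mulr_ge0 ?sinh_enorm_ge0 ?ltW.
apply: (@le_trans _ _ (expR (enorm x) + e)).
  by rewrite -cosh_dist_sum -addrA lerD2l.
rewrite expRD; apply: (@le_trans _ _ (expR (enorm x) * (1 + e))); last first.
  by rewrite ler_pM2l ?expR_gt0//; exact: expR_ge1Dx.
have : 1 <= expR (enorm x) by rewrite -expR0 ler_expR.
by rewrite mulrDr mulr1 lerD2l => h; rewrite ler_peMl// ltW.
Qed.

End PsiDistance.

(** * Lower bounds for the tail of the radial part *)

Section LowerBound.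
Context {R : realType}.
Variables (d : nat) (m : R).
Hypotheses (dm : d%:R = 2 * m + 1) (m_gt0 : 0 < m).
Implicit Types (t a g : R).

Lemma Phi_le (x y : R) : x <= y -> Phi y <= Phi x.
Proof. by move/Phi_lipschitz => /andP[]; rewrite subr_ge0. Qed.

Section Process.
Context {dO : measure_display} {Omega : measurableType dO}.
Context {X : R -> Omega -> 'rV[R]_d} {P : 'rV[R]_d -> probability Omega R}.
Hypothesis hX : hyperbolic_brownian_motion X P.
Local Notation mean := (@mean R dO Omega d X P).

(** A gain for the smoothed tails survives when the smoothing scale [del] and the
    cap [e] at the pole are sent to zero. *)
Lemma far_prob_ge t a g : 1 <= t ->
  (forall eta del e c, 0 < eta -> eta <= 1 -> del = eta ^+ 2 -> 0 < e -> e <= 2^-1 ->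
    c = a + eta + m * del ^+ 2 -> 4 * e * `|c| <= m * del ^+ 2 ->
    tail (t + del ^+ 2) (cap e) m c 0 1 + g <=
    mean t (fun x => tail (t + del ^+ 2) (cap e) m c t (cosh_dist x))) ->
  Phi ((a - m * t) / Num.sqrt t) + g <= @far_prob _ _ _ _ X P t a.
Proof.
move=> t1 h; have t_gt0 := lt_le_trans ltr01 t1.
have st1 : 1 <= Num.sqrt t by rewrite -[leLHS]sqrtr1 ler_wsqrtr.
have st0 := lt_le_trans ltr01 st1.
suff main eta : 0 < eta -> eta <= 1 ->
    Phi ((a - m * t) / Num.sqrt t) + g <= @far_prob _ _ _ _ X P t a + 4 * eta.
  rewrite leNgt; apply/negP => lt; move: main; set A := _ + g in lt *.
  set B := far_prob _ _ in lt * => main.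
  have x0 : 0 < A - B by rewrite subr_gt0.
  have y0 : 0 < Num.min 1 ((A - B) / 8) by rewrite lt_min ltr01 divr_gt0.
  have := main _ y0; rewrite ge_min lexx => /(_ isT).
  have : Num.min 1 ((A - B) / 8) <= (A - B) / 8 by rewrite ge_min lexx orbT.
  lra.
(* The threshold is shifted by [eta], and the terminal standard deviation [del]
   is much smaller than [eta], so that [tail] is at most [2 eta] below [a]. *)
move=> eta0 eta1; pose del := eta ^+ 2; pose c := a + eta + m * del ^+ 2.
have del0 : 0 < del by rewrite exprn_gt0.
have del_le : del <= eta by rewrite /del expr2 ler_piMl // ltW.
pose e := Num.min (eta / 2) (m * del ^+ 2 / (4 * (`|c| + 1))).
have c1 : 0 < `|c| + 1 by rewrite ltr_wpDl.
have md0 : 0 < m * del ^+ 2 by rewrite mulr_gt0 ?exprn_gt0.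
have e0 : 0 < e by rewrite lt_min !divr_gt0 ?mulr_gt0.
have e_eta : e <= eta / 2 by rewrite ge_min lexx.
have e1 : e <= 2^-1 by rewrite (le_trans e_eta)// ler_piMl.
have small : 4 * e * `|c| <= m * del ^+ 2.
  have : e <= m * del ^+ 2 / (4 * (`|c| + 1)) by rewrite ge_min lexx orbT.
  rewrite ler_pdivlMr ?mulr_gt0// => he; apply: le_trans he.
  by rewrite [leLHS](_ : _ = e * (4 * `|c|)); [rewrite !ler_pM2l// lerDl | ring].
have := h eta del e c eta0 eta1 erefl e0 e1 erefl small.
pose T0 := t + del ^+ 2; rewrite -/T0 => hm.
have tT : t < T0 by rewrite ltrDl exprn_gt0.
have bc : bounded_continuous (fun x : 'rV[R]_d => tail T0 (cap e) m c t (cosh_dist x)).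
  exact: bounded_continuous_tail.
have up : mean t (fun x => tail T0 (cap e) m c t (cosh_dist x)) <=
    @far_prob _ _ _ _ X P t a + 2 * eta.
  apply: (mean_le_far_prob hX) => //; first exact: ltW.
  - by rewrite mulr_ge0// ltW.
  - by move=> x; exact: Phi_le1.
  move=> x xa; have := psi_le_enorm x e0 e1; set p := psi _ _ => hp.
  have zsE : - zscore T0 (cap e) m c t (cosh_dist x) = (a + eta - p) / del.
    rewrite /zscore /front -/p /T0 (addrC t) addrK sqrtr_sqr (gtr0_norm del0) /c.
    by field; rewrite gt_eqF.
  have zge : (2 * eta)^-1 <= (a + eta - p) / del.
    rewrite ler_pdivlMr// /del.
    have -> : (2 * eta)^-1 * eta ^+ 2 = eta / 2 by field; rewrite gt_eqF.
    lra.
  have i0 : 0 < (2 * eta)^-1 by rewrite invr_gt0 mulr_gt0.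
  rewrite /tail zsE (le_trans (Phi_le zge))// (le_trans (Phi_le_inv i0))//.
  by rewrite invrK.
have sT0 : 0 < Num.sqrt T0 by rewrite sqrtr_gt0; lra.
have start : Phi ((a - m * t) / Num.sqrt t) - 2 * eta <= tail T0 (cap e) m c 0 1.
  pose x' := (a + eta - m * t) / Num.sqrt t.
  have s1 : Phi ((a - m * t) / Num.sqrt t) - eta <= Phi x'.
    have xx : (a - m * t) / Num.sqrt t <= x'.
      by rewrite /x' ler_pM2r ?invr_gt0//; lra.
    have /andP[_ ] := Phi_lipschitz xx.
    have -> : x' - (a - m * t) / Num.sqrt t = eta / Num.sqrt t.
      by rewrite /x'; field; rewrite gt_eqF.
    have : eta / Num.sqrt t <= eta by rewrite ler_pdivrMr// ler_peMr// ltW.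
    lra.
  pose l := Num.sqrt t / Num.sqrt T0.
  have l0 : 0 < l by rewrite divr_gt0.
  have l1 : l <= 1 by rewrite ler_pdivrMr// mul1r ler_wsqrtr// ltW.
  have linv : l^-1 - 1 <= eta.
    rewrite lerBlDr invfM invrK mulrC ler_pdivrMr//.
    have p0 : 0 <= (eta + 1) * Num.sqrt t by rewrite mulr_ge0 ?addr_ge0 ?ltW.
    rewrite -ler_sqr ?nnegrE ?(ltW sT0)//.
    rewrite sqr_sqrtr; last by rewrite /T0 addr_ge0 ?sqr_ge0 ?ltW.
    rewrite exprMn (sqr_sqrtr (ltW t_gt0)) /T0.
    have -> : (eta + 1) ^+ 2 * t = t + (2 * eta + eta ^+ 2) * t by ring.
    rewrite lerD2l (le_trans (_ : _ <= eta ^+ 2))//.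
      by rewrite lerXn2r ?nnegrE ?(ltW del0) ?(ltW eta0).
    have : eta ^+ 2 <= eta ^+ 2 * t by rewrite ler_peMr ?sqr_ge0.
    have : 0 <= 2 * eta * t by rewrite !mulr_ge0 ?ltW.
    lra.
  have := Phi_scale x' l0 l1; rewrite ler_norml => /andP[s2 _].
  have s3 : Phi (l * x') <= tail T0 (cap e) m c 0 1.
    apply: Phi_le; rewrite /zscore subr0 -mulNr.
    have -> : l * x' = (a + eta - m * t) / Num.sqrt T0.
      by rewrite /l /x'; field; rewrite !gt_eqF.
    rewrite ler_pM2r ?invr_gt0// /front /c /T0 subr0.
    have := cap_psi_ge0 e0 e1 (lexx 1); lra.
  lra.
lra.
Qed.

Lemma far_prob_ge_Phi t a : 1 <= t ->
  Phi ((a - m * t) / Num.sqrt t) <= @far_prob _ _ _ _ X P t a.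
Proof.
move=> t1; have t_gt0 := lt_le_trans ltr01 t1.
rewrite -[leLHS]addr0; apply: far_prob_ge => // eta del e c eta0 eta1 delE e0 e1 cE small.
have del0 : 0 < del by rewrite delE exprn_gt0.
have := mean_tail_le dm m_gt0 hX e0 e1 del0 small (lexx 0) (ltW t_gt0) (lexx t).
have T0 : 0 < t + del ^+ 2 by rewrite addr_gt0 ?exprn_gt0.
have [cf _] : bounded_continuous
    (fun x : 'rV[R]_d => tail (t + del ^+ 2) (cap e) m c 0 (cosh_dist x)).
  exact: bounded_continuous_tail.
by rewrite (mean_pole hX cf) cosh_dist_pole addr0.
Qed.

End Process.

Lemma far_prob_gain : exists2 k : R, 0 < k &
  forall dO (Omega : measurableType dO) (X : R -> Omega -> 'rV[R]_d)
    (P : 'rV[R]_d -> probability Omega R), hyperbolic_brownian_motion X P ->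
  forall t, 1 <= t -> Phi 0 + k / Num.sqrt t <= @far_prob _ _ _ _ X P t (m * t).
Proof.
have [k k0 hk] := tail_gain dm m_gt0; exists k => // dO Omega X P hX t t1.
rewrite -[X in Phi X](mul0r (Num.sqrt t)^-1) -[X in X / _](subrr (m * t)).
apply: (far_prob_ge hX) => // eta del e c eta0 eta1 delE e0 e1 cE small.
rewrite cE in small *; apply: (hk dO Omega X P hX) => //; try exact: ltW.
  by rewrite delE exprn_gt0.
by rewrite delE exprn_ile1// ltW.
Qed.

End LowerBound.

(** * A supersolution of the backward equation *)

Section Supersolution.
Context {R : realType}.
Variables (d : nat) (m T0 : R).
Hypotheses (d_ge2 : (2 <= d)%N) (dm : d%:R = 2 * m + 1).
Implicit Types (s z c : R).
Local Notation is_profile := (is_profile T0 0).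
Local Notation sd s := (Num.sqrt (T0 - s)).
Local Notation y c s z := (zscore T0 0 m c s z).

(** With [z0 = 0], [psi z = ln (2 z)]. *)
Lemma root0 z : 0 <= z -> root 0 z = z.
Proof. by move=> z0; rewrite /root expr0n subr0 sqrtr_sqr ger0_norm. Qed.

Lemma is_profile_congr (A As Az Azz As' Az' Azz' : R -> R -> R) :
  is_profile A As Az Azz ->
  (forall s z, s < T0 -> 0 < z ->
     [/\ As s z = As' s z, Az s z = Az' s z & Azz s z = Azz' s z]) ->
  is_profile A As' Az' Azz'.
Proof.
move=> [sA A1 A2 A3] e; split=> // s z sT z0; have [e1 e2 e3] := e s z sT z0.
- by rewrite -e1; exact: A1.
- by rewrite -e2; exact: A2.
rewrite -e3; have [dA <-] := A3 s z sT z0.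
have near_e : {near z, Az s =1 Az' s}.
  have : nbhs z [set x | 0 < x] by apply: open_nbhs_nbhs; split => //; exact: open_gt.
  by apply: filterS => x x0; have [] := e s x sT x0.
apply: DeriveDef; first by have := near_eq_derivable near_e dA.
by apply/esym/near_eq_derive.
Qed.

(** The expected positive part of [front + sqrt (T0 - s) N], for a standard normal
    [N]: a smoothed positive part of the front. *)
Definition price c s z := sd s * call (y c s z).

Definition price_s c s z := - m * Phi (- y c s z) - gauss_density (y c s z) / (2 * sd s).
Definition price_z c s z := Phi (- y c s z) / z.
Definition price_zz c s z :=
  gauss_density (y c s z) / (sd s * z ^+ 2) - Phi (- y c s z) / z ^+ 2.

Lemma is_profile_price c :
  is_profile (price c) (price_s c) (price_z c) (price_zz c).
Proof.
have pz := is_profile_zscore T0 (lexx 0) m c.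
have sA := smooth_on_call (@open_profile_domain R T0 0) (profile_smooth pz).
have pc := @is_profile_comp R T0 0 call (fun x => Phi (- x)) (@gauss_density R)
  _ _ _ _ (@is_derive_call R) (@is_derive_Phi_opp R) sA pz.
apply: (is_profile_congr (is_profile_mul (is_profile_sd T0 0) pc)) => s z sT z0.
have v0 : 0 < T0 - s by rewrite subr_gt0.
have sd0 : 0 < sd s by rewrite sqrtr_gt0.
have ev : T0 - s = sd s ^+ 2 by rewrite sqr_sqrtr// ltW.
have yE : y c s z = front T0 0 m c s z / sd s by [].
rewrite root0 ?ltW// /price_s /price_z /price_zz /call yE.
set p := Phi _; set g := gauss_density _; set W := front _ _ _ _ _ _.
move: ev sd0; set u := sd s => ev u0; rewrite ev.
by split; field; rewrite !gt_eqF.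
Qed.

(** In the variable [ln (2 z)] the generator is that of Brownian motion with drift
    [m], whose backward equation [price] solves, plus a perturbation in [z^-2]. *)
Lemma backward_price c s z : s < T0 -> 0 < z ->
  backward d (price_s c) (price_z c) (price_zz c) s z =
  (Phi (- y c s z) - gauss_density (y c s z) / sd s) / (2 * z ^+ 2).
Proof.
move=> sT z0; have sd0 : 0 < sd s by rewrite sqrtr_gt0 subr_gt0.
rewrite /backward /price_s /price_z /price_zz dm.
by field; rewrite !gt_eqF.
Qed.

(** A smoothed version of the indicator of a positive front, with error of
    order one in the space variable. *)
Definition ramp c s z := price (c - 2) s z - price (c - 1) s z.
Definition ramp_s c s z := price_s (c - 2) s z - price_s (c - 1) s z.
Definition ramp_z c s z := price_z (c - 2) s z - price_z (c - 1) s z.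
Definition ramp_zz c s z := price_zz (c - 2) s z - price_zz (c - 1) s z.

Lemma zscore_shift c k s z : s < T0 -> y (c - k) s z = y c s z + k / sd s.
Proof. by move=> sT; rewrite /zscore /front -mulrDl; congr (_ / _); ring. Qed.

(** The two fronts differ by one, so by the mean value theorem the ramp is a value
    of the derivative of the call price in between. *)
Lemma ramp_bounds c s z : s < T0 ->
  Phi (- y (c - 1) s z) <= ramp c s z <= Phi (- y (c - 2) s z).
Proof.
move=> sT; have sd0 : 0 < sd s by rewrite sqrtr_gt0 subr_gt0.
have e12 : y (c - 2) s z - y (c - 1) s z = (sd s)^-1.
  by rewrite !zscore_shift//; field; rewrite gt_eqF.
have lt12 : y (c - 1) s z < y (c - 2) s z by rewrite -subr_gt0 e12 invr_gt0.
have cc : {within `[y (c - 1) s z, y (c - 2) s z], continuous (@call R)}.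
  apply: continuous_subspaceT => x; apply: differentiable_continuous.
  by apply/derivable1_diffP; have [] := is_derive_call x.
have [xi] := MVT lt12 (fun x _ => is_derive_call x) cc.
rewrite in_itv/= => /andP[/ltW x1 /ltW x2] e.
have -> : ramp c s z = Phi (- xi).
  by rewrite /ramp /price -mulrBr e e12; field; rewrite gt_eqF.
by apply/andP; split; apply: Phi_le; rewrite lerN2.
Qed.

Lemma backward_ramp c s z : s < T0 -> 1 <= z ->
  `|backward d (ramp_s c) (ramp_z c) (ramp_zz c) s z| <= (sd s * z ^+ 2)^-1.
Proof.
move=> sT z1; have z0 := lt_le_trans ltr01 z1.
have sd0 : 0 < sd s by rewrite sqrtr_gt0 subr_gt0.
have -> : backward d (ramp_s c) (ramp_z c) (ramp_zz c) s z =
    backward d (price_s (c - 2)) (price_z (c - 2)) (price_zz (c - 2)) s z -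
    backward d (price_s (c - 1)) (price_z (c - 1)) (price_zz (c - 1)) s z.
  by rewrite /backward /ramp_s /ramp_z /ramp_zz; field.
rewrite !backward_price//.
have e12 : y (c - 2) s z - y (c - 1) s z = (sd s)^-1.
  by rewrite !zscore_shift//; field; rewrite gt_eqF.
have le12 : - y (c - 2) s z <= - y (c - 1) s z.
  by rewrite lerN2 -subr_ge0 e12 invr_ge0 ltW.
have /andP[p1 p2] := Phi_lipschitz le12.
have {p2} : Phi (- y (c - 2) s z) - Phi (- y (c - 1) s z) <= (sd s)^-1.
  by rewrite -e12 (le_trans p2)// opprK addrC.
have g1 := gauss_density_gt0 (y (c - 1) s z).
have g2 := gauss_density_gt0 (y (c - 2) s z).
have h1 := gauss_density_le1 (y (c - 1) s z).
have h2 := gauss_density_le1 (y (c - 2) s z).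
move: p1 g1 g2 h1 h2; set P1 := Phi _; set P2 := Phi _.
set G1 := gauss_density _; set G2 := gauss_density _ => p1 g1 g2 h1 h2 p2.
have -> : (P1 - G2 / sd s) / (2 * z ^+ 2) - (P2 - G1 / sd s) / (2 * z ^+ 2) =
    ((P1 - P2) - (G2 - G1) / sd s) / (2 * z ^+ 2) by ring.
have gg : `|(G2 - G1) / sd s| <= (sd s)^-1.
  rewrite normrM normfV (gtr0_norm sd0) ler_piMl ?invr_ge0 ?(ltW sd0)//.
  by rewrite ler_norml; apply/andP; split; lra.
have zz : 0 < 2 * z ^+ 2 by rewrite mulr_gt0 ?exprn_gt0.
rewrite normrM normfV (gtr0_norm zz) ler_pdivrMr//.
have -> : (sd s * z ^+ 2)^-1 * (2 * z ^+ 2) = (sd s)^-1 + (sd s)^-1.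
  by field; rewrite !gt_eqF.
rewrite (le_trans (ler_normB _ _))// lerD// ger0_norm//.
Qed.

Lemma is_profile_ramp c : is_profile (ramp c) (ramp_s c) (ramp_z c) (ramp_zz c).
Proof.
exact: is_profile_add (is_profile_price _) (is_profile_opp (is_profile_price _)).
Qed.

(** The power [z^(-1/2)] satisfies [Z z^(-1/2) <= - z^(-1/2) / 8] for every [d >= 2].
    The amplitude is chosen so that [- amp / 8 + amp' <= - 1 / sqrt v] with
    [v = T0 - s]; it behaves like [sqrt v] for small [v] and like [1 / sqrt v] for
    large [v]. *)
Definition barrier_amp s := 32 * sd s / (T0 - s + 8).
Definition barrier_amp' s := - (16 * (8 - (T0 - s)) / (sd s * (T0 - s + 8) ^+ 2)).
Definition barrier s z := barrier_amp s * (Num.sqrt z)^-1.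
Definition barrier_s s z := barrier_amp' s * (Num.sqrt z)^-1.
Definition barrier_z s z := barrier_amp s * - (2 * z * Num.sqrt z)^-1.
Definition barrier_zz s z := barrier_amp s * (3 / (4 * z ^+ 2 * Num.sqrt z)).

Lemma is_profile_barrier : is_profile barrier barrier_s barrier_z barrier_zz.
Proof.
have oD := @open_profile_domain R T0 0.
have sqr_sd s : s < T0 -> T0 - s = sd s ^+ 2.
  by move=> sT; rewrite sqr_sqrtr// subr_ge0 ltW.
split=> [|s z sT z0|s z sT z0|s z sT z0].
- have sT0 : smooth_on (profile_domain T0 0) (fun p : 'rV[R]_2 => T0 - p 0 0).
    by apply: smooth_onB => //; [exact: smooth_on_cst | exact: smooth_on_coord].
  have sz : smooth_on (profile_domain T0 0) (fun p : 'rV[R]_2 => p 0 1).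
    exact: smooth_on_coord.
  apply: smooth_onM => //; first (apply: smooth_onM => //; first apply: smooth_onM => //).
  + exact: smooth_on_cst.
  + by apply: smooth_on_sqrt => // p [pT _]; rewrite subr_gt0.
  + apply: smooth_onV => //.
      by move=> p [pT _]; rewrite gt_eqF// addr_gt0// subr_gt0.
    by apply: smooth_onD => //; exact: smooth_on_cst.
  + apply: smooth_onV => //; first by move=> p [_ pz]; rewrite gt_eqF// sqrtr_gt0.
    by apply: smooth_on_sqrt => // p [].
- have v0 : 0 < T0 - s by rewrite subr_gt0.
  have v8 : T0 - s + 8 != 0 by rewrite gt_eqF// addr_gt0.
  have sd0 : 0 < sd s by rewrite sqrtr_gt0.
  have d1 := profile_ds (is_profile_sd T0 0) sT z0.
  have d2 := is_derive_add (is_derive_sub (is_derive_const T0 s 1) (is_derive_id s 1))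
    (is_derive_const 8 s 1).
  refine (is_derive_eq (is_derive_mul (is_derive_mul (is_derive_mulC 32 d1)
    (@is_derive_inv _ _ (fun s : R => T0 - id s + 8) s 1 _ v8 d2))
    (is_derive_const (Num.sqrt z)^-1 s 1)) _).
  rewrite /barrier_s /barrier_amp' /=; move: (sqr_sd s sT) v8 sd0.
  set u := sd s => ev; rewrite ev => v8 u0; set r := (Num.sqrt z)^-1.
  by field; rewrite v8 gt_eqF.
- have sz : 0 < Num.sqrt z by rewrite sqrtr_gt0.
  have d1 := @is_derive_inv _ _ Num.sqrt z 1 _ (lt0r_neq0 sz) (is_derive1_sqrt z0).
  refine (is_derive_eq (is_derive_mulC (barrier_amp s) d1) _).
  rewrite /barrier_z; congr (_ * _).
  have ez : z = Num.sqrt z ^+ 2 by rewrite sqr_sqrtr// ltW.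
  move: ez sz; set r := Num.sqrt z => -> sz.
  by field; rewrite gt_eqF.
- have sz : 0 < Num.sqrt z by rewrite sqrtr_gt0.
  have zsz : 2 * z * Num.sqrt z != 0 by rewrite gt_eqF// !mulr_gt0.
  have d1 := is_derive_mul (is_derive_mulC 2 (is_derive_id z 1)) (is_derive1_sqrt z0).
  have d2 := @is_derive_inv _ _ (fun z : R => 2 * id z * Num.sqrt z) z 1 _ zsz d1.
  refine (is_derive_eq (is_derive_mulC (barrier_amp s) (is_deriveN d2)) _).
  rewrite /barrier_zz /=; congr (_ * _).
  have ez : z = Num.sqrt z ^+ 2 by rewrite sqr_sqrtr// ltW.
  move: ez sz zsz; set r := Num.sqrt z => -> sz zsz.
  by field; rewrite gt_eqF.
Qed.

Lemma barrier_amp_bounds s : s < T0 -> 0 <= barrier_amp s <= 32.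
Proof.
move=> sT; have v0 : 0 < T0 - s by rewrite subr_gt0.
have v8 : 0 < T0 - s + 8 by rewrite addr_gt0.
have sd0 : 0 < sd s by rewrite sqrtr_gt0.
rewrite divr_ge0 ?mulr_ge0 ?(ltW sd0) ?(ltW v8)//= ler_pdivrMr// ler_pM2l//.
have [h|/ltW h] := leP (sd s) 1; first by rewrite (le_trans h)//; lra.
have : sd s * 1 <= sd s * sd s by rewrite ler_pM2l.
rewrite -expr2 (sqr_sqrtr (ltW v0)); lra.
Qed.

Lemma backward_barrier s z : s < T0 -> 1 <= z ->
  backward d barrier_s barrier_z barrier_zz s z <= - (sd s * Num.sqrt z)^-1.
Proof.
move=> sT z1; have z0 := lt_le_trans ltr01 z1.
have v0 : 0 < T0 - s by rewrite subr_gt0.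
have v8 : 0 < T0 - s + 8 by rewrite addr_gt0.
have sd0 : 0 < sd s by rewrite sqrtr_gt0.
have sz : 0 < Num.sqrt z by rewrite sqrtr_gt0.
have /andP[b0 _] := barrier_amp_bounds sT.
have d2 : 2 <= d%:R :> R by rewrite ler_nat.
have -> : backward d barrier_s barrier_z barrier_zz s z =
    (barrier_amp' s - barrier_amp s * (2 * d%:R - 3 + 3 / z ^+ 2) / 8) * (Num.sqrt z)^-1.
  by rewrite /backward /barrier_s /barrier_z /barrier_zz; field; rewrite !gt_eqF.
have -> : - (sd s * Num.sqrt z)^-1 = - (sd s)^-1 * (Num.sqrt z)^-1.
  by rewrite invfM mulNr.
rewrite ler_pM2r ?invr_gt0//.
apply: (@le_trans _ _ (barrier_amp' s - barrier_amp s / 8)).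
  rewrite lerB// ler_pM2r ?invr_gt0// ler_peMr//.
  have : 0 <= 3 / z ^+ 2 by rewrite divr_ge0 ?sqr_ge0.
  lra.
rewrite -subr_ge0.
have ev : T0 - s = sd s ^+ 2 by rewrite sqr_sqrtr// ltW.
have -> : - (sd s)^-1 - (barrier_amp' s - barrier_amp s / 8) =
    (3 * (T0 - s) ^+ 2 + 64) / (sd s * (T0 - s + 8) ^+ 2).
  rewrite /barrier_amp /barrier_amp'; move: ev v8 sd0.
  set u := sd s => ev; rewrite ev => v8 u0.
  by field; rewrite !gt_eqF.
by rewrite divr_ge0 ?addr_ge0 ?mulr_ge0 ?sqr_ge0// ltW.
Qed.

End Supersolution.

(** * Upper bound for the tail of the radial part *)

Section UpperBound.
Context {R : realType}.
Variables (d : nat) (m : R).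
Hypotheses (d_ge2 : (2 <= d)%N) (dm : d%:R = 2 * m + 1).
Context {dO : measure_display} {Omega : measurableType dO}.
Context {X : R -> Omega -> 'rV[R]_d} {P : 'rV[R]_d -> probability Omega R}.
Hypothesis hX : hyperbolic_brownian_motion X P.
Implicit Types (s t z a c : R).
Local Notation mean := (@mean R dO Omega d X P).

Lemma mean_ramp_le t c : 1 <= t -> let T0 := t + t^-1 in
  bounded_continuous (fun x : 'rV[R]_d =>
    ramp m T0 c t (cosh_dist x) + barrier T0 t (cosh_dist x)) /\
  mean t (fun x => ramp m T0 c t (cosh_dist x) + barrier T0 t (cosh_dist x)) <=
  ramp m T0 c 0 1 + barrier T0 0 1.
Proof.
move=> t1 T0; have t_gt0 := lt_le_trans ltr01 t1.
have tT : t < T0 by rewrite ltrDl invr_gt0.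
have T0_gt0 : 0 < T0 by exact: lt_trans tT.
have ramp01 s z : s < T0 -> 0 <= ramp m T0 c s z <= 1.
  move=> sT; have /andP[h1 h2] := ramp_bounds m c z sT.
  by rewrite (le_trans (Phi_ge0 _) h1) (le_trans h2 (Phi_le1 _)).
have barrier01 s z : s < T0 -> 1 <= z -> 0 <= barrier T0 s z <= 32.
  move=> sT z1; have /andP[h1 h2] := barrier_amp_bounds sT.
  have sz1 : 1 <= Num.sqrt z by rewrite -[leLHS]sqrtr1 ler_wsqrtr.
  have sz0 := lt_le_trans ltr01 sz1.
  rewrite divr_ge0 ?(ltW sz0)//= ler_pdivrMr// (le_trans h2)// ler_peMr//.
have pA := is_profile_add (is_profile_ramp m T0 c) (is_profile_barrier T0).
have pN := is_profile_opp pA.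
have bc s : s < T0 -> bounded_continuous (fun x : 'rV[R]_d =>
    ramp m T0 c s (cosh_dist x) + barrier T0 s (cosh_dist x)).
  move=> sT; split; first exact: (continuous_profile ltr01 pA sT).
  exists 33 => x; have /andP[? ?] := ramp01 s (cosh_dist x) sT.
  have /andP[? ?] := barrier01 s _ sT (cosh_dist_ge1 x).
  by rewrite ger0_norm; lra.
split; first exact: bc.
have := compare hX (M := 33) (lexx 0) ltr01 pN (lexx 0) (ltW t_gt0) tT.
rewrite (mean_pole hX); last exact: (continuous_profile ltr01 pN T0_gt0).
rewrite cosh_dist_pole.
have -> : (fun x : 'rV[R]_d => - (ramp m T0 c t (cosh_dist x) + barrier T0 t (cosh_dist x)))
  = (fun x => -1 * (ramp m T0 c t (cosh_dist x) + barrier T0 t (cosh_dist x))).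
  by apply/funext => x; rewrite mulN1r.
rewrite (meanZ hX _ (ltW t_gt0) (bc t tT)) mulN1r lerN2; apply=> s z /andP[_ st] z1;
  have z_gt0 := lt_le_trans ltr01 z1; have sT := le_lt_trans st tT.
- have /andP[? ?] := ramp01 s z sT; have /andP[? ?] := barrier01 s z sT z1.
  by rewrite normrN ger0_norm; lra.
- have sz1 : 1 <= Num.sqrt z by rewrite -[leLHS]sqrtr1 ler_wsqrtr.
  have sz0 := lt_le_trans ltr01 sz1.
  rewrite normrN (le_trans (ler_wpM2l (ltW z_gt0) (ler_normD _ _)))// mulrDr.
  have h1 : z * `|ramp_z m T0 c s z| <= 1.
    rewrite /ramp_z /price_z -mulrBl normrM normfV (gtr0_norm z_gt0).
    rewrite mulrC -mulrA mulVf ?gt_eqF// mulr1.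
    have := Phi_ge0 (- zscore T0 0 m (c - 2) s z).
    have := Phi_ge0 (- zscore T0 0 m (c - 1) s z).
    have := Phi_le1 (- zscore T0 0 m (c - 2) s z).
    have := Phi_le1 (- zscore T0 0 m (c - 1) s z).
    by move=> ? ? ? ?; rewrite ler_norml; apply/andP; split; lra.
  have h2 : z * `|barrier_z T0 s z| <= 32.
    have /andP[b0 b1] := barrier_amp_bounds sT.
    rewrite /barrier_z mulrN normrN normrM (ger0_norm b0) normfV ger0_norm; last first.
      by rewrite !mulr_ge0 ?ltW.
    have -> : z * (barrier_amp T0 s / (2 * z * Num.sqrt z)) =
        barrier_amp T0 s * (2 * Num.sqrt z)^-1 by field; rewrite !gt_eqF.
    rewrite ler_pdivrMr ?mulr_gt0// (le_trans b1)// ler_peMr//; lra.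
  lra.
- have -> : backward d
    (fun s z => - (ramp_s m T0 c s z + barrier_s T0 s z))
    (fun s z => - (ramp_z m T0 c s z + barrier_z T0 s z))
    (fun s z => - (ramp_zz m T0 c s z + barrier_zz T0 s z)) s z =
    - (backward d (ramp_s m T0 c) (ramp_z m T0 c) (ramp_zz m T0 c) s z) -
    backward d (barrier_s T0) (barrier_z T0) (barrier_zz T0) s z.
    by rewrite /backward; field.
  have := backward_ramp dm c sT z1; rewrite ler_norml => /andP[_ h1].
  have h2 := backward_barrier d_ge2 sT z1.
  have sd0 : 0 < Num.sqrt (T0 - s) by rewrite sqrtr_gt0 subr_gt0.
  have sz0 : 0 < Num.sqrt z by rewrite sqrtr_gt0.
  have h3 : (Num.sqrt (T0 - s) * z ^+ 2)^-1 <= (Num.sqrt (T0 - s) * Num.sqrt z)^-1.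
    rewrite lef_pV2 ?posrE ?mulr_gt0 ?exprn_gt0// ler_pM2l//.
    have z2 : 0 <= z ^+ 2 by exact: sqr_ge0.
    rewrite -ler_sqr ?nnegrE ?(ltW sz0)// (sqr_sqrtr (ltW z_gt0)) -exprM.
    by rewrite -[leLHS]expr1 ler_weXn2l.
  move: h1 h2 h3; lra.
Qed.

(** With terminal variance [1 / t] and threshold [a] the ramp is at least
    [1 - 1 / sqrt t] on [R_t >= a]. *)
Lemma far_prob_le_Phi t a : 1 <= t ->
  @far_prob _ _ _ _ X P t a <= Phi ((a - m * t) / Num.sqrt t) + 37 / Num.sqrt t.
Proof.
move=> t1; have t_gt0 := lt_le_trans ltr01 t1.
have st1 : 1 <= Num.sqrt t by rewrite -[leLHS]sqrtr1 ler_wsqrtr.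
have st0 := lt_le_trans ltr01 st1.
pose T0 := t + t^-1; pose c := a + m * t^-1.
have [bc main] := mean_ramp_le c t1; rewrite -/T0 in bc main.
have tT : t < T0 by rewrite ltrDl invr_gt0.
have T0_gt0 : 0 < T0 by exact: lt_trans tT.
have sT0 : 0 < Num.sqrt T0 by rewrite sqrtr_gt0.
have i0 : 0 < (Num.sqrt t)^-1 by rewrite invr_gt0.
have barrier0 s z : s < T0 -> 0 <= barrier T0 s z.
  move=> sT; have /andP[h1 _] := barrier_amp_bounds sT.
  by rewrite divr_ge0 ?sqrtr_ge0.
have low : @far_prob _ _ _ _ X P t a - (Num.sqrt t)^-1 <=
    mean t (fun x => ramp m T0 c t (cosh_dist x) + barrier T0 t (cosh_dist x)).
  apply: (far_prob_le_mean hX) => //; [exact: ltW | |].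
    move=> x; have /andP[h1 _] := ramp_bounds m c (cosh_dist x) tT.
    by rewrite addr_ge0 ?barrier0// (le_trans _ h1)// Phi_ge0.
  move=> x ax; have /andP[h1 _] := ramp_bounds m c (cosh_dist x) tT.
  have p0 := enorm_le_psi x (lexx 0) ler01.
  have sdE : Num.sqrt (T0 - t) = (Num.sqrt t)^-1.
    by rewrite /T0 addrC addKr sqrtrV// ltW.
  have y1 : Num.sqrt t <= zscore T0 0 m (c - 1) t (cosh_dist x).
    rewrite /zscore sdE invrK ler_peMl ?(ltW st0)// /front /c /T0.
    rewrite (addrC t) addrK; lra.
  have := le_trans (Phi_le (_ : - zscore T0 0 m (c - 1) t (cosh_dist x) <=
    - Num.sqrt t)) h1; rewrite lerN2 => /(_ y1).
  rewrite PhiN; have := Phi_le_inv st0; have := barrier0 t (cosh_dist x) tT.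
  lra.
have start : barrier T0 0 1 <= 32 / Num.sqrt t.
  have tle : Num.sqrt t <= Num.sqrt T0 by rewrite ler_wsqrtr// ltW.
  rewrite /barrier sqrtr1 invr1 mulr1 /barrier_amp subr0.
  have T8 : 0 < T0 + 8 by rewrite ltr_wpDr.
  rewrite ler_pdivrMr//.
  have -> : 32 / Num.sqrt t * (T0 + 8) = 32 * ((T0 + 8) / Num.sqrt t) by ring.
  rewrite ler_pM2l// ler_pdivlMr//.
  have : Num.sqrt T0 * Num.sqrt t <= Num.sqrt T0 * Num.sqrt T0 by rewrite ler_pM2l.
  by rewrite -expr2 (sqr_sqrtr (ltW T0_gt0)); lra.
have final : ramp m T0 c 0 1 <= Phi ((a - m * t) / Num.sqrt t) + 4 / Num.sqrt t.
  have /andP[_ h1] := ramp_bounds m c 1 T0_gt0; apply: le_trans h1 _.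
  pose x' := (a - m * t - 3) / Num.sqrt t; pose l := Num.sqrt t / Num.sqrt T0.
  have l0 : 0 < l by rewrite divr_gt0.
  have l1 : l <= 1 by rewrite ler_pdivrMr// mul1r ler_wsqrtr// ltW.
  have linv : l^-1 - 1 <= (Num.sqrt t)^-1.
    have it : 0 < t^-1 by rewrite invr_gt0.
    have p0 : 0 <= (t^-1 + 1) * Num.sqrt t by rewrite mulr_ge0 ?addr_ge0 ?ltW.
    apply: (@le_trans _ _ t^-1); last first.
      rewrite lef_pV2 ?posrE// -{2}(sqr_sqrtr (ltW t_gt0)) expr2.
      by rewrite ler_peMr// ltW.
    rewrite lerBlDr invfM invrK mulrC ler_pdivrMr//.
    rewrite -ler_sqr ?nnegrE ?(ltW sT0)// (sqr_sqrtr (ltW T0_gt0)).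
    rewrite exprMn (sqr_sqrtr (ltW t_gt0)) /T0.
    have -> : (t^-1 + 1) ^+ 2 * t = t + 2 + t^-1 by field; rewrite gt_eqF.
    lra.
  have s1 : Phi x' <= Phi ((a - m * t) / Num.sqrt t) + 3 / Num.sqrt t.
    have xx : x' <= (a - m * t) / Num.sqrt t.
      by rewrite /x' ler_pM2r ?invr_gt0//; lra.
    have /andP[_ ] := Phi_lipschitz xx.
    have -> : (a - m * t) / Num.sqrt t - x' = 3 / Num.sqrt t.
      by rewrite /x'; field; rewrite gt_eqF.
    lra.
  have := Phi_scale x' l0 l1; rewrite ler_norml => /andP[_ s2].
  have s3 : Phi (- zscore T0 0 m (c - 2) 0 1) <= Phi (l * x').
    apply: Phi_le; rewrite /zscore subr0 -mulNr.
    have -> : l * x' = (a - m * t - 3) / Num.sqrt T0.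
      by rewrite /l /x'; field; rewrite !gt_eqF.
    rewrite ler_pM2r ?invr_gt0// /front /c /T0 subr0 /psi root0//.
    have : ln (1 + 1) <= 1 :> R.
      rewrite -[leRHS](expRK 1) ler_ln ?posrE ?expR_gt0//.
      exact: expR_ge1Dx.
    lra.
  rewrite (_ : 4 / Num.sqrt t = 3 / Num.sqrt t + (Num.sqrt t)^-1); last ring.
  lra.
move: low main start final; set i := (Num.sqrt t)^-1; lra.
Qed.

End UpperBound.

Theorem theorem1p1 (R : realType) (d : nat) (hd : (2 <= d)%N) :
  (exists2 c1 : R, 0 < c1 &
     forall (dO : measure_display) (Omega : measurableType dO)
       (X : R -> Omega -> 'rV[R]_d) (P : 'rV[R]_d -> probability Omega R),
     hyperbolic_brownian_motion X P ->
     forall t : R, 1 <= t ->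
       (ereal_sup [set `|radial_tail X P t x - Phi x|%:E | x in [set: R]]
        <= (c1 / Num.sqrt t)%:E)%E) /\
  (d = 2%N \/ ((3 <= d)%N /\ odd d) ->
   exists2 c2 : R, 0 < c2 &
     forall (dO : measure_display) (Omega : measurableType dO)
       (X : R -> Omega -> 'rV[R]_d) (P : 'rV[R]_d -> probability Omega R),
     hyperbolic_brownian_motion X P ->
     forall t : R, 1 <= t ->
       radial_tail X P t 0 - Phi 0 >= c2 / Num.sqrt t).
Proof.
pose m : R := (d%:R - 1) / 2.
have dm : d%:R = 2 * m + 1 by rewrite /m; field.
have m_gt0 : 0 < m.
  by rewrite divr_gt0// subr_gt0 ltr1n.
have centered (t x : R) : 0 < t ->
    ((d%:R - 1) * t / 2 + x * Num.sqrt t - m * t) / Num.sqrt t = x.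
  by move=> t0; rewrite /m; field; rewrite gt_eqF// sqrtr_gt0.
split=> [|_].
  exists 37 => // dO Omega X P hX t t1; have t0 := lt_le_trans ltr01 t1.
  apply: ge_ereal_sup => _ [x _ <-]; rewrite lee_fin radial_tailE//.
  have := far_prob_ge_Phi dm m_gt0 hX ((d%:R - 1) * t / 2 + x * Num.sqrt t) t1.
  have := far_prob_le_Phi hd dm hX ((d%:R - 1) * t / 2 + x * Num.sqrt t) t1.
  rewrite centered// => up low; rewrite ger0_norm ?subr_ge0//.
  by rewrite lerBlDl.
have [k k0 hk] := far_prob_gain dm m_gt0; exists k => // dO Omega X P hX t t1.
have t0 := lt_le_trans ltr01 t1; have := hk dO Omega X P hX t t1.
rewrite radial_tailE// mul0r addr0 -lerBrDl.
by rewrite (_ : m * t = (d%:R - 1) * t / 2)// /m; ring.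
Qed.
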